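(* Let $m\ge1$ and $n\ge0$ be integers, let $\alpha_{-(m-1)},\dots,\alpha_{-1},\alpha_0,\dots,\alpha_n\in\mathbb{C}$ with $\alpha_n\ne0$, and put $$q(z)=z^m+\sum_{i=1}^{m-1}\overline{\alpha}_{-(m-i)}z^{m-i},\qquad p(z)=\sum_{i=0}^n\alpha_iz^i,\qquad \varphi(z)=\overline{q(z)}+p(z).$$ For $\lambda\in\mathbb{C}$ let $$\varphi_\lambda(z):=\Big(1+\sum_{i=1}^{m+n}\alpha_{i-m}z^i\Big)-\lambda z^m.$$ If $\varphi_\lambda$ satisfies the Poincaré condition for every $\lambda\notin\varphi(\mathbb{T})$, then $$\sigma(T_\varphi)=\varphi(\mathbb{T})\cup\{\lambda\in\mathbb{C}:\lambda\notin\sigma_e(T_\varphi),\ \mathrm{ind}(T_\varphi-\lambda I)\ne0\}=\varphi(\mathbb{T})\cup\{\lambda\in\mathbb{C}:\lambda\notin\varphi(\mathbb{T}),\ \mathrm{wind}(\varphi(\mathbb{T}),\lambda)\ne0\},$$ where $T_\varphi$ is the Toeplitz operator on $L^2_a(\mathbb{D})$ with symbol $\varphi$.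
   Context: $\mathbb{D}$ is the open unit disk, $\mathbb{T}$ the unit circle, and $dA$ the normalized Lebesgue area measure on $\mathbb{D}$. The Bergman space $L^2_a(\mathbb{D})$ is the closed subspace of analytic functions in $L^2(\mathbb{D},dA)$, and $P:L^2(\mathbb{D},dA)\to L^2_a(\mathbb{D})$ is the orthogonal projection. For $\varphi\in L^\infty(\mathbb{D},dA)$ the Toeplitz operator is $T_\varphi f=P(\varphi f)$ on $L^2_a(\mathbb{D})$. $\sigma$ denotes spectrum, $\sigma_e$ the essential spectrum ($\lambda\in\sigma_e(T)$ iff $T-\lambda I$ is not Fredholm), and $\mathrm{ind}$ the Fredholm index $\dim\ker T-\dim\ker T^*$. $\mathrm{wind}(\varphi(\mathbb{T}),\lambda)$ is the winding number about $\lambda$ of the closed oriented curve $\theta\mapsto\varphi(e^{i\theta})$, $0\le\theta\le2\pi$. A polynomial satisfies the Poincaré condition (is ''Poincaré'') if its zeros (listed with multiplicity) have distinct moduli. *)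

(* Defs.v *)
From HB Require Import structures.
From mathcomp Require Import all_boot all_order all_algebra.
From mathcomp Require Import complex.
From mathcomp Require Import all_classical all_reals all_analysis.
From mathcomp Require Import measurable_realfun.
From mathcomp Require Import ring.
Set Implicit Arguments.
Unset Strict Implicit.
Unset Printing Implicit Defensive.
Import Order.TTheory GRing.Theory Num.Theory.
Import numFieldNormedType.Exports.
Local Open Scope classical_set_scope.
Local Open Scope ring_scope.

Section Plane.
Variable R : realType.
Local Notation C := R[i].

Definition unit_disk : set C := [set z | `|z| < 1].
Definition unit_circle : set C := [set z | `|z| = 1].

(* Measure and integration take place on R * R, identified with C by cplx. *)
Definition cplx (p : measurableTypeR R * measurableTypeR R) : C :=
  (p.1 +i* p.2)%C.

Definition disk2 : set (measurableTypeR R * measurableTypeR R) :=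
  cplx @^-1` unit_disk.

Lemma inv_pi_ge0 : 0 <= (pi : R)^-1.
Proof. by rewrite invr_ge0 pi_ge0. Qed.

(* Lebesgue measure divided by pi, so that the unit disk has area 1. *)
Definition area :
    {measure set (measurableTypeR R * measurableTypeR R) -> \bar R} :=
  mscale (NngNum inv_pi_ge0) (@lebesgue_measure R \x @lebesgue_measure R)%E.

Definition disk_integral (F : C -> C) : C :=
  ((\int[area]_(p in disk2) complex.Re (F (cplx p))) +i*
   (\int[area]_(p in disk2) complex.Im (F (cplx p))))%C.

Definition L2_disk (f : C -> C) : Prop :=
  [/\ measurable_fun disk2 (fun p => complex.Re (f (cplx p))),
      measurable_fun disk2 (fun p => complex.Im (f (cplx p))) &
      (\int[area]_(p in disk2) ((Normc.normc (f (cplx p)) ^+ 2)%:E) < +oo)%E].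

Definition L2_dot (f g : C -> C) : C := disk_integral (fun z => f z * (g z)^*).

Definition analytic_disk (f : C -> C) : Prop :=
  forall z, unit_disk z -> derivable (f : C^o -> C^o) z 1.

(* A function on the disk is represented by its extension by 0 to C, so that
   Leibniz equality in the Bergman space is equality on the disk. *)
Definition bergman_pred : {pred C -> C} :=
  mem [set f | [/\ analytic_disk f, L2_disk f &
                   forall z, ~ unit_disk z -> f z = 0]].

Lemma normc_sqr (z : C) :
  Normc.normc z ^+ 2 = complex.Re z ^+ 2 + complex.Im z ^+ 2.
Proof. by case: z => a b /=; rewrite sqr_sqrtr // addr_ge0 ?sqr_ge0. Qed.

Lemma measurable_disk2 : measurable disk2.
Proof.
pose h (p : measurableTypeR R * measurableTypeR R) : R := p.1 ^+ 2 + p.2 ^+ 2.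
have mh : measurable_fun setT h.
  by apply: measurable_funD; apply: measurable_funX;
    [exact: measurable_fst|exact: measurable_snd].
have -> : disk2 = h @^-1` `]-oo, 1[%classic.
  suff H p : unit_disk (cplx p) = (h p \in `]-oo, 1[ : Prop) by exact/funext.
  rewrite /unit_disk /h in_itv /= ltcE /= eqxx /=.
  by rewrite -[X in _ < X](@sqrtr1 R) ltr_sqrt.
by rewrite -[X in measurable X]setTI; exact: mh.
Qed.

Lemma L2_disk_lin (a : C) (f g : C -> C) :
  L2_disk f -> L2_disk g -> L2_disk (a *: f + g).
Proof.
move=> [f1 f2 f3] [g1 g2 g3].
have ReE p : complex.Re ((a *: f + g) p) =
    complex.Re a * complex.Re (f p) - complex.Im a * complex.Im (f p)
      + complex.Re (g p).
  rewrite -[(a *: f + g) p]/(a * f p + g p).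
  by case: (a) (f p) (g p) => ? ? [? ?] [].
have ImE p : complex.Im ((a *: f + g) p) =
    complex.Re a * complex.Im (f p) + complex.Im a * complex.Re (f p)
      + complex.Im (g p).
  rewrite -[(a *: f + g) p]/(a * f p + g p).
  by case: (a) (f p) (g p) => ? ? [? ?] [].
have m1 : measurable_fun disk2 (fun p => complex.Re ((a *: f + g) (cplx p))).
  under eq_fun do rewrite ReE.
  apply: measurable_funD => //; apply: measurable_funB => //;
    exact: measurable_funM.
have m2 : measurable_fun disk2 (fun p => complex.Im ((a *: f + g) (cplx p))).
  under eq_fun do rewrite ImE.
  apply: measurable_funD => //; apply: measurable_funD => //;
    exact: measurable_funM.
have mN (h : C -> C) : measurable_fun disk2 (fun p => complex.Re (h (cplx p))) ->
    measurable_fun disk2 (fun p => complex.Im (h (cplx p))) ->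
    measurable_fun disk2 (fun p => ((Normc.normc (h (cplx p)) ^+ 2)%:E : \bar R)).
  move=> h1 h2; apply/measurable_EFinP; under eq_fun do rewrite normc_sqr.
  by apply: measurable_funD; exact: measurable_funX.
have N0 (h : C -> C) p : (0 <= (Normc.normc (h (cplx p)) ^+ 2)%:E :> \bar R)%E.
  by rewrite lee_fin sqr_ge0.
split=> //.
pose A := 2 * Normc.normc a ^+ 2.
have A0 : 0 <= A by rewrite mulr_ge0 ?sqr_ge0.
apply: (@le_lt_trans _ _ (\int[area]_(p in disk2)
   (A%:E * (Normc.normc (f (cplx p)) ^+ 2)%:E +
    2%:E * (Normc.normc (g (cplx p)) ^+ 2)%:E))%E).
  apply: ge0_le_integral => //; first exact: measurable_disk2.
  - exact: mN.
  - by apply: emeasurable_funD; apply: measurable_funeM; exact: mN.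
  - move=> p _; rewrite -!EFinM -EFinD lee_fin /A !normc_sqr ReE ImE.
    set x := complex.Re (f _); set y := complex.Im (f _).
    set u := complex.Re (g _); set v := complex.Im (g _).
    set c := complex.Re a; set d := complex.Im a.
    rewrite -subr_ge0; set Q := (X in 0 <= X).
    have -> : Q = (c * x - d * y - u) ^+ 2 + (c * y + d * x - v) ^+ 2.
      by rewrite /Q; ring.
    by rewrite addr_ge0 ?sqr_ge0.
have C0 (k : R) (h : C -> C) p : 0 <= k ->
    (0 <= k%:E * (Normc.normc (h (cplx p)) ^+ 2)%:E :> \bar R)%E.
  by move=> k0; rewrite mule_ge0 ?lee_fin ?sqr_ge0.
rewrite (ge0_integralD _ measurable_disk2).
- rewrite !(ge0_integralZl_EFin _ measurable_disk2) //; try exact: mN.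
  by rewrite lte_add_pinfty ?lte_mul_pinfty ?lee_fin.
- by move=> p _; exact: C0.
- by apply: measurable_funeM; exact: mN.
- by move=> p _; exact: C0.
- by apply: measurable_funeM; exact: mN.
Qed.

Lemma bergman_submod_closed : submod_closed bergman_pred.
Proof.
split.
  rewrite inE /=; split.
  - by move=> z _; exact: (@derivable_cst C C^o C^o 0).
  - split; [exact: measurable_cst|exact: measurable_cst|].
    rewrite integral0_eq // => p _.
    by rewrite normc_sqr /= expr0n /= addr0.
  - by [].
move=> a f g; rewrite !inE /= => -[f1 f2 f3] [g1 g2 g3]; split.
- move=> z Dz; apply: (@derivableD C C^o C^o (a \*: (f : C^o -> C^o)) g).
    by apply: derivableZ; exact: f1.
  exact: g1.
- exact: L2_disk_lin.
- by move=> z Dz; rewrite -[LHS]/(a * f z + g z) f3 // g3 // mulr0 addr0.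
Qed.

HB.instance Definition _ :=
  GRing.isSubmodClosed.Build C (C -> C) bergman_pred bergman_submod_closed.

Record bergman : Type := Bergman {
  bergman_fun :> C -> C;
  _ : bergman_fun \in bergman_pred }.

HB.instance Definition _ := [isSub for bergman_fun].
HB.instance Definition _ := [Choice of bergman by <:].
HB.instance Definition _ := [SubChoice_isSubLmodule of bergman by <:].

(* Orthogonal projection of L^2(D, dA) onto the Bergman space. *)
Definition bergman_proj (g : C -> C) : bergman :=
  xget 0 [set h : bergman | forall k : bergman, L2_dot (g - h) k = 0].

Definition toeplitz (phi : C -> C) (f : bergman) : bergman :=
  bergman_proj (fun z => phi z * f z).

Definition bergman_dot (f g : bergman) : C := L2_dot f g.

End Plane.

(* Operators on an inner product space (V, dot) over the complex numbers. *)
Section Operators.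
Variables (R : realType) (V : lmodType R[i]) (dot : V -> V -> R[i]).
Local Notation C := R[i].
Implicit Types (T S : V -> V) (W : set V).

Definition hnorm (x : V) : R := Num.sqrt (complex.Re (dot x x)).

Definition bounded_operator T : Prop :=
  linear T /\ exists M : R, forall x, hnorm (T x) <= M * hnorm x.

Definition shift_op T (lambda : C) : V -> V := fun x => T x - lambda *: x.

Definition invertible_op T : Prop :=
  exists S, [/\ bounded_operator S, cancel T S & cancel S T].

Definition spectrum T : set C :=
  [set lambda | ~ invertible_op (shift_op T lambda)].

Definition adjoint T : V -> V :=
  xget (fun=> 0) [set S | forall x y, dot (T x) y = dot x (S y)].

Definition op_ker T : set V := [set x | T x = 0].

Definition closed_range T : Prop :=
  forall y, (forall e : R, 0 < e -> exists x, hnorm (T x - y) < e) ->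
  exists x, T x = y.

Definition has_dim W (d : nat) : Prop :=
  exists e : 'I_d -> V,
    (forall c : 'I_d -> C, \sum_i c i *: e i = 0 -> forall i, c i = 0) /\
    W = [set x | exists c : 'I_d -> C, x = \sum_i c i *: e i].

Definition finite_dim W : Prop := exists d, has_dim W d.

(* Meaningful when W is a finite-dimensional subspace. *)
Definition dim W : nat := xget 0%N [set d | has_dim W d].

Definition fredholm T : Prop :=
  [/\ closed_range T, finite_dim (op_ker T) & finite_dim (op_ker (adjoint T))].

Definition ess_spectrum T : set C :=
  [set lambda | ~ fredholm (shift_op T lambda)].

Definition fredholm_index T : int :=
  (dim (op_ker T))%:Z - (dim (op_ker (adjoint T)))%:Z.

End Operators.

Section Curves.
Variable R : realType.
Local Notation C := R[i].

Definition cis (t : R) : C := (cos t +i* sin t)%C.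

(* k is the winding number about lambda of the closed curve gamma, with
   parameter in [0, 2 pi]: a is a continuous argument of gamma - lambda, and
   2 pi k its increment. *)
Definition is_wind (gamma : R -> C) (lambda : C) (k : int) : Prop :=
  exists a : R -> R,
    [/\ {within `[0, 2 * pi], continuous a},
        forall t, 0 <= t <= 2 * pi ->
          gamma t - lambda = `|gamma t - lambda| * cis (a t) &
        a (2 * pi) - a 0 = 2 * pi * k%:~R].

Definition wind (gamma : R -> C) (lambda : C) : int :=
  xget 0 [set k | is_wind gamma lambda k].

End Curves.

Section Symbol.
Variable R : realType.
Local Notation C := R[i].

Definition poincare (P : {poly C}) : Prop :=
  P != 0 /\
  exists s : seq C, P = lead_coef P *: \prod_(a <- s) ('X - a%:P) /\
                    uniq [seq `|a| | a <- s].

Variables (m n : nat) (alpha : int -> C).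

Definition symbol_q : {poly C} :=
  'X^m + \sum_(1 <= i < m) (alpha (- (m - i)%N%:Z))^* *: 'X^(m - i).

Definition symbol_p : {poly C} := \sum_(0 <= i < n.+1) alpha i%:Z *: 'X^i.

Definition symbol (z : C) : C := (symbol_q.[z])^* + symbol_p.[z].

Definition symbol_poly (lambda : C) : {poly C} :=
  (1 + \sum_(1 <= i < (m + n).+1) alpha (i%:Z - m%:Z) *: 'X^i)
    - lambda *: 'X^m.

End Symbol.

(* Main.v *)
(* The Poincare condition is very restrictive.  If m >= 2, the map
   phi_0(z) / z^m = u^-m, with u a coordinate near 0, identifies the points with
   parameters u and zeta u, where zeta^m = 1; along a small circle |u| = d the
   moduli of these two points cannot always be distinct, since their differences
   telescope to 0 around the circle.  So some phi_lambda with lambda large, hence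
   off the curve phi(T), has two roots of the same modulus.  The same argument at
   infinity excludes n >= 2, and for m = n = 1 the value lambda = alpha_0 forces
   |alpha_1| = 1.  Hence phi(z) = conj z + a + b z with b = 0 or |b| = 1.

   If |b| = 1, phi maps the disk into a segment, and off this segment
   T_phi - lambda is coercive up to a rotation, hence invertible, with winding
   number 0.  If b = 0, phi(T) is a circle; T_phi - lambda is coercive outside,
   and inside it is the adjoint of multiplication by z - w, which is bounded
   below, so it is onto with a kernel spanned by the reproducing kernel at w,
   while the winding number is -1.  On the curve, at lambda = phi(zeta), the
   reproducing kernels at w = t zeta, t -> 1, are approximate eigenvectors:
   T_phi - phi(w) maps k_w to b (z - w) k_w, and
   ||(z - w) k_w||^2 = ||z k_w||^2 - |w|^2 ||k_w||^2.

   The Bergman space is treated through its reproducing kernels and not through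
   Taylor coefficients: Goursat's theorem on rectangles gives Cauchy's formula,
   and averaging it over the position of the four sides bounds point evaluations
   by area integrals, whence completeness. *)
Require Import Defs.
From HB Require Import structures.
From mathcomp Require Import all_boot all_order all_algebra.
From mathcomp Require Import complex.
From mathcomp Require Import all_classical all_reals all_analysis.
From mathcomp Require Import measurable_realfun ring lra.
Set Implicit Arguments.
Unset Strict Implicit.
Unset Printing Implicit Defensive.
Import Order.TTheory GRing.Theory Num.Theory.
Import numFieldNormedType.Exports.
Local Open Scope classical_set_scope.
Local Open Scope ring_scope.

(** The Poincare condition is assumed only off the curve, so two equimodular roots of [phi_lambda]
    contradict it only if [lambda] provably avoids [phi(T)]. The curve is bounded; hence the
    collision is produced with [|lambda|] beyond any given bound, by shrinking the circle on which
    [u] moves.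

    One weighted estimate carries the function theory: for [|w| < 1], the norm of [(z - w) k]
    controls both the values of [k] near [w] and the norm of [k]. It makes evaluations bounded,
    bounds multiplication by [z - w] from below, and keeps quotients by [z - w] square integrable,
    so that the kernel found inside the circle is exactly one-dimensional.

    [bergman_proj], [adjoint], [dim] and [wind] are choices with a default value. Each use is
    therefore backed by the existence of a solution (from Riesz' theorem for the first two), and by
    uniqueness where the value itself matters. *)

Local Notation nc := Normc.normc.

(** * Complex derivatives and integrals *)

Section ComplexNorm.
Variable R : realType.
Local Notation C := R[i].
Implicit Types (z w : C) (x y r : R).

(** In [R[i]] the norm is itself a complex number. Estimates are made with the real-valued [nc];
    this is the passage between the two. *)
Lemma normc_normE z : `|z| = (nc z)%:C%C. Proof. by []. Qed.

Lemma normc_lt z r : (`|z| < r%:C%C) = (nc z < r).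
Proof. by rewrite normc_normE ltcR. Qed.

Lemma normc_ge0 z : 0 <= nc z.
Proof. by case: z => a b /=; exact: sqrtr_ge0. Qed.

Lemma normcN z : nc (- z) = nc z. Proof. by case: z => a b /=; rewrite !sqrrN. Qed.

Lemma normcB z w : nc (z - w) = nc (w - z).
Proof. by rewrite -normcN opprB. Qed.

Lemma normcM z w : nc (z * w) = nc z * nc w.
Proof. exact: Normc.normcM. Qed.

Lemma normcV z : nc z^-1 = (nc z)^-1. Proof. exact: Normc.normcV. Qed.

Lemma normcX z n : nc (z ^+ n) = nc z ^+ n.
Proof. by elim: n => [|n IH]; rewrite ?expr0 ?Normc.normc1// !exprS normcM IH. Qed.

Lemma normc0P z : (nc z == 0) = (z == 0).
Proof.
apply/eqP/eqP => [/Normc.eq0_normc//|->]; exact: Normc.normc0.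
Qed.

Lemma normc_gt0 z : (0 < nc z) = (z != 0).
Proof. by rewrite lt0r normc0P normc_ge0 andbT. Qed.

Lemma normc_triangle z w : nc (z + w) <= nc z + nc w.
Proof. by have := ler_normD z w; rewrite !normc_normE -rmorphD lecR. Qed.

Lemma normc_triangleB z w : nc (z - w) <= nc z + nc w.
Proof. by rewrite -(normcN w) normc_triangle. Qed.

Lemma normc_dist_triangle z w t : nc (z - t) <= nc (z - w) + nc (w - t).
Proof. by rewrite -[z - t](subrKA w) normc_triangle. Qed.

Lemma normc_lowerB z w : nc z - nc w <= nc (z - w).
Proof. by rewrite lerBlDr -{1}(subrK w z) normc_triangle. Qed.

Lemma normc_sum (I : Type) (s : seq I) (P : pred I) (F : I -> C) :
  nc (\sum_(i <- s | P i) F i) <= \sum_(i <- s | P i) nc (F i).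
Proof.
elim/big_ind2 : _ => [|a b c d h1 h2|//]; first by rewrite Normc.normc0.
exact: le_trans (normc_triangle _ _) (lerD h1 h2).
Qed.

Lemma normc_real x : nc x%:C%C = `|x|.
Proof. by rewrite /= expr0n /= addr0 sqrtr_sqr. Qed.

Lemma normc_conj z : nc z^* = nc z.
Proof. by case: z => a b /=; rewrite sqrrN. Qed.

Lemma Re_le_normc z : `|complex.Re z| <= nc z.
Proof.
case: z => a b /=; rewrite -[X in X <= _]sqrtr_sqr ler_wsqrtr// lerDl sqr_ge0//.
Qed.

Lemma Im_le_normc z : `|complex.Im z| <= nc z.
Proof.
case: z => a b /=; rewrite -[X in X <= _]sqrtr_sqr ler_wsqrtr// lerDr sqr_ge0//.
Qed.

Lemma normc_i : nc ('i%C : C) = 1.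
Proof. by rewrite /= expr0n expr1n/= add0r sqrtr1. Qed.

Lemma normc_le_ReIm (x y : R) : nc (x +i* y)%C <= `|x| + `|y|.
Proof.
have -> : (x +i* y)%C = x%:C%C + 'i%C * y%:C%C by rewrite [LHS]complexE.
by rewrite (le_trans (normc_triangle _ _))// normcM normc_i mul1r !normc_real.
Qed.

Lemma cReD z w : complex.Re (z + w) = complex.Re z + complex.Re w.
Proof. by case: z w => ? ? []. Qed.
Lemma cImD z w : complex.Im (z + w) = complex.Im z + complex.Im w.
Proof. by case: z w => ? ? []. Qed.
Lemma cReN z : complex.Re (- z) = - complex.Re z. Proof. by case: z. Qed.
Lemma cImN z : complex.Im (- z) = - complex.Im z. Proof. by case: z. Qed.
Lemma cReB z w : complex.Re (z - w) = complex.Re z - complex.Re w.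
Proof. by rewrite cReD cReN. Qed.
Lemma cImB z w : complex.Im (z - w) = complex.Im z - complex.Im w.
Proof. by rewrite cImD cImN. Qed.
Lemma cReM z w : complex.Re (z * w) =
  complex.Re z * complex.Re w - complex.Im z * complex.Im w.
Proof. by case: z w => ? ? []. Qed.
Lemma cImM z w : complex.Im (z * w) =
  complex.Re z * complex.Im w + complex.Im z * complex.Re w.
Proof. by case: z w => ? ? []. Qed.
Lemma cRe_conj z : complex.Re z^* = complex.Re z. Proof. by case: z. Qed.
Lemma cIm_conj z : complex.Im z^* = - complex.Im z. Proof. by case: z. Qed.

Lemma complex_eq z w :
  complex.Re z = complex.Re w -> complex.Im z = complex.Im w -> z = w.
Proof. by case: z w => ? ? [? ?] /= -> ->. Qed.

Lemma unit_diskE z : unit_disk z = (nc z < 1 : Prop).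
Proof. by rewrite /unit_disk/= -(normc_lt z 1). Qed.

Lemma unit_circleP z : unit_circle z <-> nc z = 1.
Proof.
rewrite /unit_circle/= normc_normE; split=> [|->//].
by case.
Qed.

End ComplexNorm.

(** * Continuity and complex differentiability in epsilon-delta form *)

Section Derivability.
Variable R : realType.
Local Notation C := R[i].
Implicit Types (f g : C -> C) (z w : C).

Definition ccont f z := {for z, continuous (f : C^o -> C^o)}.
Definition cdiff f z := derivable (f : C^o -> C^o) z 1.

Lemma nbhs_normc (z : C) (P : C -> Prop) :
  nbhs (z : C^o) P <->
  exists2 d : R, 0 < d & forall w, nc (w - z) < d -> P w.
Proof.
split=> [/nbhs_ballP [[d d'] /= d0 H]|[d d0 H]].
  move: d0; rewrite ltcE /= => /andP[/eqP e d0]; subst d'.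
  exists d => // w wz; apply: H; rewrite -ball_normE /=.
  by rewrite -normrN opprB normc_normE complexr0 ltcR.
apply/nbhs_ballP; exists d%:C%C => /=; first by rewrite ltcR.
move=> w; rewrite -ball_normE /= -normrN opprB normc_lt; exact: H.
Qed.

(** Radii and tolerances in the topology of [C] are elements of [C]; the order on [C] forces a
    positive one to be real. *)
Lemma cpos (e : C) : 0 < e -> exists2 r : R, 0 < r & e = r%:C%C.
Proof. by case: e => a b; rewrite ltcE /= => /andP[/eqP -> a0]; exists a. Qed.

Lemma ccontP f z : ccont f z <->
  forall e : R, 0 < e -> exists2 d : R, 0 < d &
    forall w, nc (w - z) < d -> nc (f w - f z) < e.
Proof.
split=> [H e e0|H].
  have e0' : 0 < e%:C%C by rewrite ltcR.
  have [d d0 K] := (nbhs_normc z (fun t => `|f z - f t| < e%:C%C)).1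
    ((@cvgrPdist_lt C C^o C^o (nbhs (z : C^o)) _ f (f z)).1 H _ e0').
  by exists d => // w /K; rewrite normc_lt normcB.
apply/(@cvgrPdist_lt C C^o C^o (nbhs (z : C^o)) _ f (f z)) => _ /cpos[e e0 ->].
apply/(nbhs_normc z (fun t => `|f z - f t| < e%:C%C)).
have [d d0 K] := H e e0; exists d => // w /K.
by rewrite normc_lt normcB.
Qed.

Lemma diff_quotient_error (c h X : C) :
  h != 0 -> c - h^-1 *: (X : C^o) = - ((X - c * h) / h).
Proof. by move=> h0; rewrite [_ *: _]mulrC [in RHS]mulrBl mulfK// opprB. Qed.

Lemma cdiffP f z : cdiff f z <->
  exists c : C, forall e : R, 0 < e -> exists2 d : R, 0 < d &
    forall w, nc (w - z) < d -> nc (f w - f z - c * (w - z)) <= e * nc (w - z).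
Proof.
split=> [/cvg_ex[/= c H]|[c H]].
  exists c => e e0; move/cvgrPdist_lt : H => /(_ e%:C%C).
  rewrite ltcR => /(_ e0) H.
  have [d d0 K] := (nbhs_normc 0 (fun h => h != 0 ->
      `|c - h^-1 *: ((f : C^o -> C^o) (h *: 1 + z) - f z)| < e%:C%C)).1 H; exists d => // w wz.
  have [->|neq] := eqVneq w z.
    by rewrite !subrr mulr0 subr0 Normc.normc0 mulr0.
  have h0 : w - z != 0 by rewrite subr_eq0.
  have := K (w - z); rewrite subr0 => /(_ wz h0).
  rewrite /= normc_lt [_ *: 1]mulr1 subrK.
  by rewrite diff_quotient_error// normcN normcM normcV ltr_pdivrMr ?normc_gt0// => /ltW.
apply/cvg_ex; exists c; apply/cvgrPdist_lt => _ /cpos[e e0 ->].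
apply/(nbhs_normc 0 (fun h => h != 0 ->
      `|c - h^-1 *: ((f : C^o -> C^o) (h *: 1 + z) - f z)| < e%:C%C)).
(* Half of [e] turns the non-strict estimate into the strict one that the limit requires. *)
have [d d0 K] := H (e / 2) (divr_gt0 e0 (ltr0Sn _ 1)).
exists d => // h; rewrite subr0 => hd h0.
have := K (h + z); rewrite addrK => /(_ hd).
rewrite /= normc_lt [_ *: 1]mulr1.
rewrite diff_quotient_error// normcN normcM normcV ltr_pdivrMr ?normc_gt0// => /le_lt_trans; apply.
by rewrite ltr_pM2r ?normc_gt0// ltr_pdivrMr// ltr_pMr// ltr1n.
Qed.

Lemma cdiff_cont f z : cdiff f z -> ccont f z.
Proof. by move=> /derivable1_diffP /differentiable_continuous. Qed.

Lemma ccont_cst c z : ccont (fun=> c) z. Proof. exact: (@cst_continuous C^o C^o c z). Qed.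
Lemma ccont_id z : ccont id z. Proof. by apply/ccontP => e e0; exists e. Qed.
Lemma ccontD f g z : ccont f z -> ccont g z -> ccont (fun w => f w + g w) z.
Proof. exact: (@continuousD C C^o C^o f g z). Qed.
Lemma ccontN f z : ccont f z -> ccont (fun w => - f w) z.
Proof. exact: (@continuousN C C^o C^o f z). Qed.
Lemma ccontB f g z : ccont f z -> ccont g z -> ccont (fun w => f w - g w) z.
Proof. by move=> h1 h2; exact: ccontD h1 (ccontN h2). Qed.
Lemma ccontM f g z : ccont f z -> ccont g z -> ccont (fun w => f w * g w) z.
Proof. exact: (@continuousM C C^o f g z). Qed.
Lemma ccontV f z : f z != 0 -> ccont f z -> ccont (fun w => (f w)^-1) z.
Proof. exact: (@continuousV C C^o f z). Qed.

Lemma cdiff_cst c z : cdiff (fun=> c) z.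
Proof. exact: (@derivable_cst C C^o C^o c). Qed.
Lemma cdiff_id z : cdiff id z.
Proof. exact: (@derivable_id C C^o z 1). Qed.
Lemma cdiffB f g z : cdiff f z -> cdiff g z -> cdiff (fun w => f w - g w) z.
Proof. exact: (@derivableB C C^o C^o). Qed.
Lemma cdiffM f g z : cdiff f z -> cdiff g z -> cdiff (fun w => f w * g w) z.
Proof. exact: (@derivableM C C^o). Qed.
Lemma cdiffV f z : f z != 0 -> cdiff f z -> cdiff (fun w => (f w)^-1) z.
Proof. exact: (@derivableV C C^o). Qed.

Lemma cdiff_near f g z (d : R) : 0 < d ->
  (forall w, nc (w - z) < d -> f w = g w) -> cdiff f z -> cdiff g z.
Proof.
move=> d0 fg /cdiffP[c H]; apply/cdiffP; exists c => e e0.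
have [d' d'0 K] := H e e0; exists (Num.min d d'); first by rewrite lt_min d0.
by move=> w; rewrite lt_min => /andP[w1 w2]; rewrite -!fg ?subrr ?Normc.normc0// K.
Qed.

End Derivability.

(** * Integrals of complex functions over segments *)

Section IntervalIntegral.
Variable R : realType.
Local Notation C := R[i].
Local Notation leb := (@lebesgue_measure R).
Implicit Types (F G : R -> C) (a b x y : R).

Definition rcont F x := forall e : R, 0 < e -> exists2 d : R, 0 < d &
  forall y, `|y - x| < d -> nc (F y - F x) < e.

Definition CI a b F : C :=
  ((\int[leb]_(t in `[a, b]) complex.Re (F t)) +i*
   (\int[leb]_(t in `[a, b]) complex.Im (F t)))%C.

Definition seg_cont a b F := forall t, a <= t <= b -> rcont F t.

(** Meant for [u] the real part, the imaginary part or the norm, all three 1-Lipschitz. *)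
Lemma lip_comp_continuous (u : C -> R) F a b :
  (forall z w, `|u z - u w| <= nc (z - w)) ->
  seg_cont a b F -> {within `[a, b], continuous (fun t => u (F t))}.
Proof.
move=> lip cF; apply: continuous_in_subspaceT => t /[!inE] /= /[!in_itv] /= tab.
apply/(@cvgrPdist_lt R R^o R _ _ (fun t => u (F t)) (u (F t))) => e e0.
have [d d0 H] := cF t tab e e0.
apply/nbhs_ballP; exists d => //= s; rewrite /ball /= distrC => /H.
by apply: le_lt_trans; rewrite normcB; exact: lip.
Qed.

Lemma seg_cont_integrable a b (u : C -> R) F :
  (forall z w, `|u z - u w| <= nc (z - w)) -> seg_cont a b F ->
  leb.-integrable `[a, b] (EFin \o (fun t => u (F t))).
Proof.
move=> lip cF; apply: continuous_compact_integrable; first exact: segment_compact.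
exact: lip_comp_continuous.
Qed.

Lemma Re_lip (z w : C) : `|complex.Re z - complex.Re w| <= nc (z - w).
Proof. by rewrite -cReB Re_le_normc. Qed.
Lemma Im_lip (z w : C) : `|complex.Im z - complex.Im w| <= nc (z - w).
Proof. by rewrite -cImB Im_le_normc. Qed.
Lemma normc_lip (z w : C) : `|nc z - nc w| <= nc (z - w).
Proof.
by rewrite ler_norml lerNl opprB [X in _ && X]normc_lowerB normcB normc_lowerB.
Qed.

Lemma seg_Re_integrable a b F : seg_cont a b F ->
  leb.-integrable `[a, b] (EFin \o (fun t => complex.Re (F t))).
Proof. by apply: seg_cont_integrable; exact: Re_lip. Qed.
Lemma seg_Im_integrable a b F : seg_cont a b F ->
  leb.-integrable `[a, b] (EFin \o (fun t => complex.Im (F t))).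
Proof. by apply: seg_cont_integrable; exact: Im_lip. Qed.

Lemma CID a b F G : seg_cont a b F -> seg_cont a b G ->
  CI a b (fun t => F t + G t) = CI a b F + CI a b G.
Proof.
move=> cF cG; rewrite /CI.
under eq_Rintegral do rewrite cReD.
under [X in (_ +i* X)%C]eq_Rintegral do rewrite cImD.
by rewrite !RintegralD//; (exact: seg_Re_integrable) || (exact: seg_Im_integrable).
Qed.

Lemma CIZ a b (c : C) F : seg_cont a b F ->
  CI a b (fun t => c * F t) = c * CI a b F.
Proof.
move=> cF; rewrite /CI.
have i1 := seg_Re_integrable cF; have i2 := seg_Im_integrable cF.
have iZ (k : R) (f : R -> R) : leb.-integrable `[a, b] (EFin \o f) ->
    leb.-integrable `[a, b] (EFin \o (fun t => k * f t)).
  move=> fi; rewrite (_ : _ \o _ = (fun t => k%:E * (EFin \o f) t)%E); last first.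
    by apply/funext => t /=; rewrite EFinM.
  exact: integrableZl.
apply: complex_eq; rewrite ?cReM ?cImM /=.
  under eq_Rintegral do rewrite cReM.
  by rewrite RintegralB ?RintegralZl//; exact: iZ.
under eq_Rintegral do rewrite cImM.
by rewrite RintegralD ?RintegralZl//; exact: iZ.
Qed.

Lemma Rint_split (f : R -> R) a b c : a <= c -> c <= b ->
  leb.-integrable `[a, b] (EFin \o f) ->
  \int[leb]_(t in `[a, b]) f t =
  \int[leb]_(t in `[a, c]) f t + \int[leb]_(t in `[c, b]) f t.
Proof.
move=> ac cb fi; apply/eqP; rewrite addrC -subr_eq; apply/eqP.
rewrite (Rintegral_itvB (x := c))//.
apply: Rintegral_itv_obnd_cbnd; apply: integrableS fi => //.
by move=> t /=; rewrite !in_itv /= => /andP[/ltW ct ->]; rewrite (le_trans ac).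
Qed.

Lemma CI_split F a b c : a <= c -> c <= b -> seg_cont a b F ->
  CI a b F = CI a c F + CI c b F.
Proof.
move=> ac cb cF; rewrite /CI (Rint_split ac cb (seg_Re_integrable cF)).
by rewrite (Rint_split ac cb (seg_Im_integrable cF)).
Qed.

(** The factor 2 comes from bounding the real and imaginary parts separately; no later argument
    depends on a sharp constant. *)
Lemma CI_le F (g : R -> R) a b : seg_cont a b F ->
  leb.-integrable `[a, b] (EFin \o g) ->
  (forall t, a <= t <= b -> nc (F t) <= g t) ->
  nc (CI a b F) <= 2 * \int[leb]_(t in `[a, b]) g t.
Proof.
move=> cF gi H; rewrite (le_trans (normc_le_ReIm _ _))// mulrDl mul1r.
have key (u : C -> R) : (forall z w, `|u z - u w| <= nc (z - w)) ->
   (forall z, `|u z| <= nc z) ->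
   `|\int[leb]_(t in `[a, b]) u (F t)| <= \int[leb]_(t in `[a, b]) g t.
  move=> lip bnd; have ui := seg_cont_integrable lip cF.
  rewrite (le_trans (le_normr_Rintegral _ _))//.
  apply: le_Rintegral => //.
    by apply: (integrable_norm ui).
  by move=> t /=; rewrite in_itv /= => /H; apply: le_trans; exact: bnd.
by rewrite lerD ?key//; [exact: Re_lip|exact: Re_le_normc|exact: Im_lip|
  exact: Im_le_normc].
Qed.

Lemma integrable_cst_itv a b (k : R) :
  leb.-integrable `[a, b] (EFin \o (fun=> k)).
Proof.
apply: continuous_compact_integrable; first exact: segment_compact.
by apply: continuous_in_subspaceT => t _; exact: cvg_cst.
Qed.

Lemma Rint_cst a b (k : R) : a <= b -> \int[leb]_(t in `[a, b]) k = k * (b - a).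
Proof.
move=> ab; rewrite Rintegral_cst//= lebesgue_measure_itv /= lte_fin.
case: ltgtP ab => [ab _|//|-> _]; first by rewrite -EFinD.
by rewrite subrr.
Qed.

Lemma CI_bound F (M : R) a b : a <= b -> seg_cont a b F ->
  (forall t, a <= t <= b -> nc (F t) <= M) ->
  nc (CI a b F) <= 2 * M * (b - a).
Proof.
move=> ab cF H; rewrite -mulrA -Rint_cst//.
apply: CI_le => //; exact: integrable_cst_itv.
Qed.

Lemma CI_cst a b (c : C) : a <= b -> CI a b (fun=> c) = c * (b - a)%:C%C.
Proof.
move=> ab; rewrite /CI !Rint_cst//; apply: complex_eq; rewrite ?cReM ?cImM /=.
  by rewrite mulr0 subr0.
by rewrite mulr0 add0r.
Qed.

Lemma Rint_id a b : a <= b ->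
  \int[leb]_(t in `[a, b]) t = (b ^+ 2 - a ^+ 2) / 2.
Proof.
rewrite le_eqVlt => /predU1P[->|ab].
  by rewrite set_itv1 Rintegral_set1 subrr mul0r.
have dF (x : R) : is_derive x 1 (fun t : R => 2^-1 *: t ^+ 2 : R^o) x.
  apply: is_derive_eq; rewrite /GRing.scale /= mulr1.
  by field.
have cF (x : R) : {for x, continuous (fun t : R => 2^-1 *: t ^+ 2 : R^o)}.
  by apply: differentiable_continuous; apply/derivable1_diffP.
rewrite /Rintegral (@continuous_FTC2 R (fun t : R => t) (fun t => 2^-1 *: t ^+ 2))//.
- by rewrite /= -scalerBr [_ *: _]mulrC.
- by apply: continuous_in_subspaceT => t _; exact: cvg_id.
- split.
  + by move=> x _; exact: (@ex_derive _ _ _ _ _ _ _ (dF x)).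
  + apply: cvg_at_right_filter; exact: cF.
  + apply: cvg_at_left_filter; exact: cF.
- by move=> x _; rewrite derive1E (@derive_val _ _ _ _ _ _ _ (dF x)).
Qed.

Lemma eq_CI a b F G : (forall t, a <= t <= b -> F t = G t) -> CI a b F = CI a b G.
Proof.
move=> FG; rewrite /CI; congr (_ +i* _)%C; apply: eq_Rintegral => t;
  by rewrite inE /= in_itv /= => /FG ->.
Qed.

End IntervalIntegral.

(** * Boundary integrals of rectangles and Goursat's theorem *)

Section Rectangles.
Variable R : realType.
Local Notation C := R[i].
Implicit Types (F G : C -> C) (a b x y : R).

Definition hseg F y : R -> C := fun t => F (t +i* y)%C.
Definition vseg F x : R -> C := fun t => F (x +i* t)%C.

(* The integral of F dz along the boundary of [x1, x2] x [y1, y2]. *)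
Definition bint x1 x2 y1 y2 F : C :=
  CI x1 x2 (hseg F y1) - CI x1 x2 (hseg F y2)
  + 'i%C * (CI y1 y2 (vseg F x2) - CI y1 y2 (vseg F x1)).

Definition rect x1 x2 y1 y2 (z : C) : Prop :=
  x1 <= complex.Re z <= x2 /\ y1 <= complex.Im z <= y2.

Definition bdry x1 x2 y1 y2 (z : C) : Prop :=
  rect x1 x2 y1 y2 z /\
  [\/ complex.Re z = x1, complex.Re z = x2, complex.Im z = y1 | complex.Im z = y2].

Lemma hseg_cont F y a b :
  (forall t, a <= t <= b -> ccont F (t +i* y)%C) -> seg_cont a b (hseg F y).
Proof.
move=> H t tab e e0; have [d d0 K] := (ccontP _ _).1 (H t tab) e e0.
exists d => // s st; apply: K; apply: le_lt_trans st.
have -> : (s +i* y - t +i* y)%C = (s - t)%:C%C.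
  by apply: complex_eq; rewrite /= ?subrr.
by rewrite normc_real.
Qed.

Lemma vseg_cont F x a b :
  (forall t, a <= t <= b -> ccont F (x +i* t)%C) -> seg_cont a b (vseg F x).
Proof.
move=> H t tab e e0; have [d d0 K] := (ccontP _ _).1 (H t tab) e e0.
exists d => // s st; apply: K; apply: le_lt_trans st.
have -> : (x +i* s - x +i* t)%C = 'i%C * (s - t)%:C%C.
  by apply: complex_eq; rewrite ?cReM ?cImM /=; ring.
by rewrite normcM normc_i mul1r normc_real.
Qed.

Definition bcont x1 x2 y1 y2 F := forall z, bdry x1 x2 y1 y2 z -> ccont F z.

Section sides.
Variables (x1 x2 y1 y2 : R).
Hypotheses (x12 : x1 <= x2) (y12 : y1 <= y2).

Lemma bcont_sides F : bcont x1 x2 y1 y2 F ->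
  [/\ seg_cont x1 x2 (hseg F y1), seg_cont x1 x2 (hseg F y2),
      seg_cont y1 y2 (vseg F x1) & seg_cont y1 y2 (vseg F x2)].
Proof.
move=> H; split; (apply: hseg_cont || apply: vseg_cont) => t tab; apply: H;
  split; rewrite /rect ?tab /= ?lexx ?x12 ?y12//;
  by [apply: Or41|apply: Or42|apply: Or43|apply: Or44].
Qed.

Lemma bintD F G : bcont x1 x2 y1 y2 F -> bcont x1 x2 y1 y2 G ->
  bint x1 x2 y1 y2 (fun z => F z + G z) = bint x1 x2 y1 y2 F + bint x1 x2 y1 y2 G.
Proof.
move=> /bcont_sides[f1 f2 f3 f4] /bcont_sides[g1 g2 g3 g4].
rewrite /bint (CID f1 g1) (CID f2 g2) (CID f3 g3) (CID f4 g4).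
by ring.
Qed.

Lemma bintZ (c : C) F : bcont x1 x2 y1 y2 F ->
  bint x1 x2 y1 y2 (fun z => c * F z) = c * bint x1 x2 y1 y2 F.
Proof.
move=> /bcont_sides[f1 f2 f3 f4].
rewrite /bint (CIZ c f1) (CIZ c f2) (CIZ c f3) (CIZ c f4).
by ring.
Qed.

Lemma eq_bint F G : (forall z, bdry x1 x2 y1 y2 z -> F z = G z) ->
  bint x1 x2 y1 y2 F = bint x1 x2 y1 y2 G.
Proof.
move=> H; rewrite /bint; congr (_ - _ + _ * (_ - _)); apply: eq_CI => t tab;
  apply: H; split; rewrite /rect ?tab /= ?lexx ?x12 ?y12//;
  by [apply: Or41|apply: Or42|apply: Or43|apply: Or44].
Qed.

Lemma bintN F : bcont x1 x2 y1 y2 F ->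
  bint x1 x2 y1 y2 (fun z => - F z) = - bint x1 x2 y1 y2 F.
Proof.
move=> H; rewrite -mulN1r -bintZ//; apply: eq_bint => z _; by rewrite mulN1r.
Qed.

Lemma bintB F G : bcont x1 x2 y1 y2 F -> bcont x1 x2 y1 y2 G ->
  bint x1 x2 y1 y2 (fun z => F z - G z) = bint x1 x2 y1 y2 F - bint x1 x2 y1 y2 G.
Proof.
move=> hF hG; have hN : bcont x1 x2 y1 y2 (fun z => - G z).
  by move=> z /hG; exact: ccontN.
by rewrite (bintD hF hN) (bintN hG).
Qed.

Lemma normc_bint F : nc (bint x1 x2 y1 y2 F) <=
  nc (CI x1 x2 (hseg F y1)) + nc (CI x1 x2 (hseg F y2)) +
  (nc (CI y1 y2 (vseg F x2)) + nc (CI y1 y2 (vseg F x1))).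
Proof.
rewrite (le_trans (normc_triangle _ _))// lerD ?normc_triangleB//.
by rewrite normcM normc_i mul1r normc_triangleB.
Qed.

Lemma bint_bound F (M : R) : bcont x1 x2 y1 y2 F ->
  (forall z, bdry x1 x2 y1 y2 z -> nc (F z) <= M) ->
  nc (bint x1 x2 y1 y2 F) <= 4 * M * (x2 - x1 + (y2 - y1)).
Proof.
move=> /bcont_sides[f1 f2 f3 f4] H.
have h t : x1 <= t <= x2 -> nc (hseg F y1 t) <= M /\ nc (hseg F y2 t) <= M.
  by move=> tab; split; apply: H; split; rewrite /rect ?tab /= ?lexx ?x12 ?y12//;
    by [apply: Or43|apply: Or44].
have v t : y1 <= t <= y2 -> nc (vseg F x1 t) <= M /\ nc (vseg F x2 t) <= M.
  by move=> tab; split; apply: H; split; rewrite /rect ?tab /= ?lexx ?x12 ?y12//;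
    by [apply: Or41|apply: Or42].
have := normc_bint F.
have := CI_bound x12 f1 (fun t k => (h t k).1).
have := CI_bound x12 f2 (fun t k => (h t k).2).
have := CI_bound y12 f3 (fun t k => (v t k).1).
have := CI_bound y12 f4 (fun t k => (v t k).2).
lra.
Qed.

(** The two integrals along the cut cancel algebraically, so continuity is required only on the two
    sides that are cut. *)
Lemma bint_splitx F c : x1 <= c -> c <= x2 ->
  seg_cont x1 x2 (hseg F y1) -> seg_cont x1 x2 (hseg F y2) ->
  bint x1 x2 y1 y2 F = bint x1 c y1 y2 F + bint c x2 y1 y2 F.
Proof.
move=> xc cx f1 f2; rewrite /bint (CI_split xc cx f1) (CI_split xc cx f2); ring.
Qed.

Lemma bint_splity F c : y1 <= c -> c <= y2 ->
  seg_cont y1 y2 (vseg F x1) -> seg_cont y1 y2 (vseg F x2) ->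
  bint x1 x2 y1 y2 F = bint x1 x2 y1 c F + bint x1 x2 c y2 F.
Proof.
move=> yc cy f1 f2; rewrite /bint (CI_split yc cy f1) (CI_split yc cy f2); ring.
Qed.

Lemma CI_affine (p q : C) a b : a <= b ->
  CI a b (fun t => p + q * t%:C%C) =
  p * (b - a)%:C%C + q * ((b ^+ 2 - a ^+ 2) / 2)%:C%C.
Proof.
have ct : seg_cont a b (fun t => t%:C%C).
  by move=> t _ e e0; exists e => // s st; rewrite -rmorphB normc_real.
move=> ab; rewrite CID ?CI_cst// ?CIZ//; first congr (_ + _ * _).
- apply: complex_eq => /=; first exact: Rint_id.
  by rewrite Rint_cst ?mul0r.
- by move=> t _ e e0; exists 1 => // s _; rewrite subrr Normc.normc0.
- move=> t _ e e0; have q0 : 0 < nc q + 1 by rewrite ltr_wpDl ?normc_ge0.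
  exists (e / (nc q + 1)); first by rewrite divr_gt0.
  move=> s; rewrite ltr_pdivlMr// => st.
  rewrite -mulrBr normcM -rmorphB normc_real mulrC.
  apply: le_lt_trans st; rewrite ler_wpM2l ?normr_ge0// lerDl//.
Qed.

(** Computed directly on the four sides; this is the only explicit contour integral on which
    Goursat's theorem rests. *)
Lemma bint_affine (p q : C) : bint x1 x2 y1 y2 (fun z => p + q * z) = 0.
Proof.
have E (y : R) : CI x1 x2 (hseg (fun z => p + q * z) y) =
    CI x1 x2 (fun t => (p + q * ('i%C * y%:C%C)) + q * t%:C%C).
  by apply: eq_CI => t _; rewrite /hseg [(t +i* y)%C]complexE /=; ring.
have E' (x : R) : CI y1 y2 (vseg (fun z => p + q * z) x) =
    CI y1 y2 (fun t => (p + q * x%:C%C) + (q * 'i%C) * t%:C%C).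
  by apply: eq_CI => t _; rewrite /vseg [(x +i* t)%C]complexE /=; ring.
by rewrite /bint !E !E' !CI_affine// !rmorphB; ring.
Qed.

End sides.

Lemma bint_bisect F x y w h : 0 <= w -> 0 <= h ->
  (forall s t, x <= s <= x + (w + w) -> y <= t <= y + (h + h) ->
     ccont F (s +i* t)%C) ->
  bint x (x + (w + w)) y (y + (h + h)) F =
  bint x (x + w) y (y + h) F + bint x (x + w) (y + h) (y + h + h) F +
  (bint (x + w) (x + w + w) y (y + h) F +
   bint (x + w) (x + w + w) (y + h) (y + h + h) F).
Proof.
rewrite (addrA x) (addrA y) => w0 h0 cF.
have [x0 x1] : x <= x + w /\ x + w <= x + w + w by split; lra.
have [y0 y1] : y <= y + h /\ y + h <= y + h + h by split; lra.
have x2 := le_trans x0 x1; have y2 := le_trans y0 y1.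
rewrite (bint_splitx x0 x1); first last.
- by apply: hseg_cont => t xt; apply: cF => //; rewrite y2 lexx.
- by apply: hseg_cont => t xt; apply: cF => //; rewrite lexx y2.
rewrite (bint_splity (x1 := x) y0 y1); first last.
- by apply: vseg_cont => t xt; apply: cF => //; rewrite x0 x1.
- by apply: vseg_cont => t xt; apply: cF => //; rewrite lexx x2.
rewrite (bint_splity (x1 := x + w) y0 y1)//.
- by apply: vseg_cont => t xt; apply: cF => //; rewrite x0 x1.
- by apply: vseg_cont => t xt; apply: cF => //; rewrite lexx x2.
Qed.

Lemma pigeon4 (K A a b c d : R) : 4 * K < A -> A <= a + b + (c + d) ->
  [\/ K < a, K < b, K < c | K < d].
Proof.
move=> KA Aabcd.
have [?|n1] := ltP K a; first exact: Or41.
have [?|n2] := ltP K b; first exact: Or42.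
have [?|n3] := ltP K c; first exact: Or43.
have [?|n4] := ltP K d; first exact: Or44.
by exfalso; lra.
Qed.

(** The intervals [[x n, x n + w / 2 ^ n]] are nested; the supremum of their left ends belongs to
    all of them. *)
Lemma nested_halves (w : R) (x : nat -> R) :
  (forall n, x n <= x n.+1 <= x n + w / 2 ^+ n.+1) ->
  exists p, forall n, x n <= p <= x n + w / 2 ^+ n.
Proof.
move=> H.
have inc n k : x n <= x (n + k)%N.
  elim: k => [|k IH]; rewrite ?addn0// addnS (le_trans IH)//.
  by case/andP: (H (n + k)%N).
have half n : w / 2 ^+ n = w / 2 ^+ n.+1 + w / 2 ^+ n.+1.
  by rewrite exprS invfM mulrCA -[in RHS]mulrDl -mulr2n -[2^-1 *+ 2]mulr_natr
     mulVf// mul1r.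
have dec n k : x (n + k)%N + w / 2 ^+ (n + k) <= x n + w / 2 ^+ n.
  elim: k => [|k IH]; rewrite ?addn0// addnS (le_trans _ IH)//.
  by rewrite (half (n + k)%N) addrA lerD2r; case/andP: (H (n + k)%N).
have w0 : 0 <= w.
  have /andP[h1 h2] := H 0%N.
  by have := le_trans h1 h2; rewrite lerDl pmulr_lge0// invr_gt0.
have up n k : x k <= x n + w / 2 ^+ n.
  have [nk|/ltnW kn] := leqP n k.
    have := dec n (k - n)%N; rewrite subnKC//; apply: le_trans.
    by rewrite lerDl divr_ge0// exprn_ge0.
  have := inc k (n - k)%N; rewrite subnKC// => /le_trans; apply.
  by rewrite lerDl divr_ge0// exprn_ge0.
exists (sup (range x)) => n; apply/andP; split.
  apply: ub_le_sup; last by exists n.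
  by exists (x 0%N + w / 2 ^+ 0) => _ [k _ <-]; exact: up.
apply: ge_sup; first by exists (x 0%N), 0%N.
by move=> _ [k _ <-]; exact: up.
Qed.

Lemma exp2_shrink (w d : R) : 0 < d -> exists n, w / 2 ^+ n < d.
Proof.
move=> d0; have [w0|w0] := leP w 0.
  by exists 0%N; rewrite expr0 divr1; exact: le_lt_trans d0.
have := archi_boundP (ltW (divr_gt0 w0 d0)); set n := Num.bound _ => H.
exists n; rewrite ltr_pdivrMr ?exprn_gt0// mulrC -ltr_pdivrMr//.
apply: (lt_trans H); rewrite -natrX ltr_nat; exact: ltn_expl.
Qed.

(** The affine approximation of [F] at [p] has integral zero, so only the remainder counts. It is at
    most [e / 8 * (w + h)] on the boundary, and [bint_bound] multiplies this by [4 * (w + h)]. *)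
Lemma bint_local_bound F x y w h (c : C) (e : R) (p : C) :
  0 <= w -> 0 <= h -> 0 < e -> rect x (x + w) y (y + h) p ->
  (forall z, rect x (x + w) y (y + h) z -> ccont F z) ->
  (forall z, nc (z - p) <= w + h ->
     nc (F z - F p - c * (z - p)) <= e / 8 * nc (z - p)) ->
  nc (bint x (x + w) y (y + h) F) <= e * (w + h) ^+ 2.
Proof.
move=> w0 h0 e0 [/andP[p1 p2] /andP[p3 p4]] cF K.
have [lx ly] : x <= x + w /\ y <= y + h by split; lra.
pose A z := (F p - c * p) + c * z.
have cA : bcont x (x + w) y (y + h) A.
  move=> z _; apply: ccontD; first exact: ccont_cst.
  by apply: ccontM; [exact: ccont_cst|exact: ccont_id].
have bF : bcont x (x + w) y (y + h) F by move=> z [? _]; exact: cF.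
have E : bint x (x + w) y (y + h) F = bint x (x + w) y (y + h) (fun z => F z - A z).
  by rewrite (bintB lx ly bF cA) [X in _ - X]bint_affine// subr0.
have cFA : bcont x (x + w) y (y + h) (fun z => F z - A z).
  by move=> z Bz; apply: ccontB; [exact: bF|exact: cA].
have b z : bdry x (x + w) y (y + h) z -> nc (F z - A z) <= e / 8 * (w + h).
  move=> [[/andP[z1 z2] /andP[z3 z4]] _].
  have zp : nc (z - p) <= w + h.
    clear -z1 z2 z3 z4 p1 p2 p3 p4 w0 h0.
    case: z p z1 z2 z3 z4 p1 p2 p3 p4 => zx zy [px py] /= z1 z2 z3 z4 p1 p2 p3 p4.
    apply: (le_trans (normc_le_ReIm _ _)).
    by apply: lerD; rewrite ler_norml; apply/andP; split; lra.
  have -> : F z - A z = F z - F p - c * (z - p) by rewrite /A; ring.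
  apply: (le_trans (K z zp)).
  by rewrite ler_wpM2l// divr_ge0 ?ltW.
have := bint_bound lx ly cFA b.
rewrite E ![_ + _ - x]addrC ![_ + _ - y]addrC !addKr => /le_trans; apply.
have : 0 <= e * (w + h) ^+ 2 by rewrite mulr_ge0 ?sqr_ge0// ltW.
clear; lra.
Qed.

Lemma goursat x1 x2 y1 y2 F : x1 <= x2 -> y1 <= y2 ->
  (forall z, rect x1 x2 y1 y2 z -> cdiff F z) -> bint x1 x2 y1 y2 F = 0.
Proof.
move=> x12 y12 dF; apply/eqP; rewrite -normc0P -[_ == _]negbK; apply/negP => I0.
set I := nc _ in I0; have {}I0 : 0 < I by rewrite lt0r I0 normc_ge0.
pose w := x2 - x1; pose h := y2 - y1.
have w0 : 0 <= w by rewrite subr_ge0.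
have h0 : 0 <= h by rewrite subr_ge0.
(* The added 1 makes the starting rectangle strictly bad and covers the degenerate case
   [w + h = 0]. *)
pose e := I / ((w + h) ^+ 2 + 1).
have D0 : 0 < (w + h) ^+ 2 + 1 by rewrite ltr_wpDl ?sqr_ge0.
have e0 : 0 < e by rewrite divr_gt0.
pose J (n : nat) (p : R * R) :=
  nc (bint p.1 (p.1 + w / 2 ^+ n) p.2 (p.2 + h / 2 ^+ n) F).
pose inside (n : nat) (p : R * R) :=
  [/\ x1 <= p.1, p.1 + w / 2 ^+ n <= x2, y1 <= p.2 & p.2 + h / 2 ^+ n <= y2].
(* A bad rectangle has a large integral compared with the square of its size. Halving both sides
   divides that square by 4, so one of the four quarters is bad again. *)
pose bad n p := inside n p /\ e * ((w + h) / 2 ^+ n) ^+ 2 < J n p.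
have half (v : R) n : v / 2 ^+ n = v / 2 ^+ n.+1 + v / 2 ^+ n.+1.
  by rewrite exprS invfM mulrCA -[in RHS]mulrDl -mulr2n -[2^-1 *+ 2]mulr_natr
     mulVf// mul1r.
have pos (v : R) n : 0 <= v -> 0 <= v / 2 ^+ n.
  by move=> v0; rewrite divr_ge0// exprn_ge0.
have step n p : bad n p -> exists q, bad n.+1 q /\
    (p.1 <= q.1 <= p.1 + w / 2 ^+ n.+1) /\ (p.2 <= q.2 <= p.2 + h / 2 ^+ n.+1).
  move=> [[i1 i2 i3 i4] b].
  move: (pos w n.+1 w0) (pos h n.+1 h0) => w2 h2.
  pose q00 := p; pose q10 := (p.1 + w / 2 ^+ n.+1, p.2).
  pose q01 := (p.1, p.2 + h / 2 ^+ n.+1).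
  pose q11 := (p.1 + w / 2 ^+ n.+1, p.2 + h / 2 ^+ n.+1).
  rewrite (half w n) in i2; rewrite (half h n) in i4.
  have ccF (x y : R) : x1 <= x <= x2 -> y1 <= y <= y2 -> ccont F (x +i* y)%C.
    by move=> ? ?; apply: cdiff_cont; apply: dF.
  have ev : bint p.1 (p.1 + w / 2 ^+ n) p.2 (p.2 + h / 2 ^+ n) F =
     bint q00.1 (q00.1 + w / 2 ^+ n.+1) q00.2 (q00.2 + h / 2 ^+ n.+1) F +
     bint q01.1 (q01.1 + w / 2 ^+ n.+1) q01.2 (q01.2 + h / 2 ^+ n.+1) F +
     (bint q10.1 (q10.1 + w / 2 ^+ n.+1) q10.2 (q10.2 + h / 2 ^+ n.+1) F +
     bint q11.1 (q11.1 + w / 2 ^+ n.+1) q11.2 (q11.2 + h / 2 ^+ n.+1) F).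
    rewrite (half w n) (half h n); apply: bint_bisect => // x y /andP[? ?] /andP[? ?].
    by apply: ccF; apply/andP; split; [exact: le_trans i1 _|exact: le_trans i2|exact: le_trans i3 _|exact: le_trans i4].
  have ineq : J n p <= J n.+1 q00 + J n.+1 q01 + (J n.+1 q10 + J n.+1 q11).
    by rewrite /J ev (le_trans (normc_triangle _ _))// lerD// normc_triangle.
  have four : ((w + h) / 2 ^+ n) ^+ 2 = 4 * ((w + h) / 2 ^+ n.+1) ^+ 2.
    by rewrite (half _ n); ring.
  rewrite four in b.
  set E := _ ^+ 2 in b.
  have : [\/ e * E < J n.+1 q00, e * E < J n.+1 q01, e * E < J n.+1 q10
           | e * E < J n.+1 q11].
    by apply: (pigeon4 _ ineq); rewrite mulrCA.
  rewrite addrA in i2; rewrite addrA in i4.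
  have i5 : p.1 + w / 2 ^+ n.+1 <= x2 by apply: le_trans i2; rewrite lerDl.
  have i6 : x1 <= p.1 + w / 2 ^+ n.+1 by apply: le_trans i1 _; rewrite lerDl.
  have i7 : p.2 + h / 2 ^+ n.+1 <= y2 by apply: le_trans i4; rewrite lerDl.
  have i8 : y1 <= p.2 + h / 2 ^+ n.+1 by apply: le_trans i3 _; rewrite lerDl.
  have r1 : p.1 <= p.1 <= p.1 + w / 2 ^+ n.+1 by rewrite lexx lerDl.
  have r2 : p.1 <= p.1 + w / 2 ^+ n.+1 <= p.1 + w / 2 ^+ n.+1 by rewrite lexx lerDl w2.
  have r3 : p.2 <= p.2 <= p.2 + h / 2 ^+ n.+1 by rewrite lexx lerDl.
  have r4 : p.2 <= p.2 + h / 2 ^+ n.+1 <= p.2 + h / 2 ^+ n.+1 by rewrite lexx lerDl h2.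
  by case=> bq; [exists q00|exists q01|exists q10|exists q11].
have addKC (a b : R) : a + (b - a) = b by rewrite addrC subrK.
have bad0 : bad 0%N (x1, y1).
  split; first by split=> //=; rewrite expr0 divr1 addKC.
  rewrite /J /= expr0 !divr1 !addKC -/I.
  by rewrite /e mulrAC ltr_pdivrMr// ltr_pM2l// ltrDl.
have [s [s0 sP]] : exists s : nat -> R * R, s 0%N = (x1, y1) /\
   forall n, bad n (s n) /\ (((s n).1 <= (s n.+1).1 <= (s n).1 + w / 2 ^+ n.+1) /\
      ((s n).2 <= (s n.+1).2 <= (s n).2 + h / 2 ^+ n.+1)).
  (* Dependent choice through a total function: on a rectangle that is not bad its value is
     irrelevant. *)
  have /choice[f fP] : forall np : nat * (R * R), exists q, bad np.1 np.2 ->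
     bad np.1.+1 q /\ ((np.2.1 <= q.1 <= np.2.1 + w / 2 ^+ np.1.+1) /\
      (np.2.2 <= q.2 <= np.2.2 + h / 2 ^+ np.1.+1)).
    move=> [n p]; have [/step[q qP]|nb] := pselect (bad n p); first by exists q.
    by exists p.
  pose s := fix s n := if n is k.+1 then f (k, s k) else (x1, y1).
  have sb n : bad n (s n).
    by elim: n => [//|n IH] /=; have [] := fP (n, s n) IH.
  by exists s; split=> // n; split=> //; have [] := fP (n, s n) (sb n).
have [px pxP] := nested_halves (fun n => (sP n).2.1).
have [py pyP] := nested_halves (fun n => (sP n).2.2).
have Rp : rect x1 x2 y1 y2 (px +i* py)%C.
  have := pxP 0%N; have := pyP 0%N; rewrite s0 /= expr0 !divr1.
  by rewrite !addKC; split.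
have [c cP] := (cdiffP _ _).1 (dF _ Rp).
have [d d0 K] := cP (e / 8) ltac:(by rewrite divr_gt0).
pose p := (px +i* py)%C; rewrite -/p in Rp cP K.
have [n nd] := exp2_shrink (w + h) d0.
have [[i1 i2 i3 i4] b] := (sP n).1.
have pP : rect (s n).1 ((s n).1 + w / 2 ^+ n) (s n).2 ((s n).2 + h / 2 ^+ n) p.
  by split; [exact: pxP|exact: pyP].
(* For large [n] the bad rectangle lies where [F] is nearly affine, and [bint_local_bound]
   contradicts its badness. *)
move: b; rewrite ltNge => /negP; apply.
rewrite /J; rewrite mulrDl in nd *.
apply: (@bint_local_bound _ _ _ _ _ c e p) => //; [exact: pos|exact: pos| |].
- by move=> z [/andP[? ?] /andP[? ?]]; apply/cdiff_cont/dF; split; apply/andP; split;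
    [exact: le_trans i1 _|exact: le_trans i2|exact: le_trans i3 _|exact: le_trans i4].
- by move=> z /le_lt_trans/(_ nd); exact: K.
Qed.

End Rectangles.

(** * Cauchy's formula *)

Section Cauchy.
Variable R : realType.
Local Notation C := R[i].
Implicit Types (f g h F : C -> C) (z w : C).
Variables (x1 x2 y1 y2 : R).

Definition inter x1 x2 y1 y2 (z : C) : Prop :=
  x1 < complex.Re z < x2 /\ y1 < complex.Im z < y2.

Local Notation B := (bint x1 x2 y1 y2).
Local Notation Rect := (rect x1 x2 y1 y2).
Local Notation Bd := (bdry x1 x2 y1 y2).
Local Notation In := (inter x1 x2 y1 y2).

Lemma inter_le z : In z -> x1 <= x2 /\ y1 <= y2.
Proof. by move=> [/andP[/ltW a /ltW b] /andP[/ltW c /ltW d]]; split; lra. Qed.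

Definition bdist z := Num.min (Num.min (complex.Re z - x1) (x2 - complex.Re z))
  (Num.min (complex.Im z - y1) (y2 - complex.Im z)).

Lemma bdist_gt0 z : In z -> 0 < bdist z.
Proof.
by move=> [/andP[a b] /andP[c d]]; rewrite /bdist !lt_min !subr_gt0 a b c d.
Qed.

Lemma bdist_le z w : Bd w -> bdist z <= nc (w - z).
Proof.
move=> [_ h]; rewrite /bdist !ge_min.
have := Re_le_normc (w - z); have := Im_le_normc (w - z).
rewrite cReB cImB !ler_norml => /andP[i1 i2] /andP[r1 r2].
by case: h => h; rewrite h in i1 i2 r1 r2; apply/orP;
  [left; apply/orP; left|left; apply/orP; right|right; apply/orP; left
  |right; apply/orP; right]; lra.
Qed.

Lemma bdry_neq z w : In z -> Bd w -> w - z != 0.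
Proof.
by move=> /bdist_gt0 h /bdist_le k; rewrite -normc_gt0 (lt_le_trans h).
Qed.

Lemma inter_near z w : nc (w - z) < bdist z -> In w.
Proof.
rewrite /bdist !lt_min => /andP[/andP[a b] /andP[c d]].
have := Re_le_normc (w - z); have := Im_le_normc (w - z).
rewrite cReB cImB !ler_norml => /andP[i1 i2] /andP[r1 r2].
by split; apply/andP; split; lra.
Qed.

(** The form in which limits are taken below: a norm bounded by a fixed multiple of every small [s]
    vanishes. *)
Lemma le0_small (a K s0 : R) : 0 < s0 ->
  (forall s, 0 < s -> s <= s0 -> a <= K * s) -> a <= 0.
Proof.
move=> s00 H; rewrite leNgt; apply/negP => a0.
have D0 : 0 < 2 * (`|K| + 1) by rewrite mulr_gt0// ltr_wpDl.
pose s := Num.min s0 (a / (2 * (`|K| + 1))).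
have s1 : 0 < s by rewrite lt_min s00 divr_gt0.
have s2 : s <= a / (2 * (`|K| + 1)) by rewrite ge_min lexx orbT.
have : a <= K * s by apply: H => //; rewrite ge_min lexx.
apply/negP; rewrite -ltNge; move: s2; rewrite ler_pdivlMr// => s2.
have : K * s <= `|K| * s by rewrite ler_pM2r// ler_norm.
move: s2 s1 a0; move: `|K| s (K * s) => L t u; rewrite mulrDr mulr1 mulrDr mulrCA.
rewrite (mulrC t) => h1 h2 h3 h4; lra.
Qed.

(** Goursat's theorem removes four rectangles to the left, right, below and above [z]. There remains
    a square of half-side [s] around [z], whose boundary integral is at most [16 * M * s]. The
    condition [s <= d / 4] keeps its boundary in the region where [F] is bounded. *)
Lemma bint_punctured F z (d M : R) : In z -> 0 < d ->
  (forall w, Rect w -> w != z -> cdiff F w) ->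
  (forall w, w != z -> nc (w - z) < d -> nc (F w) <= M) -> B F = 0.
Proof.
move=> Inz d0 dF bF.
have b0 := bdist_gt0 Inz.
apply/eqP; rewrite -normc0P eq_le normc_ge0 andbT.
apply: (@le0_small _ (16 * M) (Num.min (d / 4) (bdist z / 2))).
  by rewrite lt_min !divr_gt0.
move=> s s0; rewrite le_min => /andP[sd sb].
have : s < bdist z.
  by apply: (le_lt_trans sb); rewrite ltr_pdivrMr// ltr_pMr// ltr1n.
rewrite /bdist !lt_min => /andP[/andP[b1 b2] /andP[b3 b4]].
move: Inz => _ {b0 sb}.
have dF' (x y : R) : x1 <= x <= x2 -> y1 <= y <= y2 ->
    (x != complex.Re z) || (y != complex.Im z) -> cdiff F (x +i* y)%C.
  move=> hx hy ne; apply: dF; first by split.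
  by apply: contraL ne => /eqP <- /=; rewrite !eqxx.
have {}bF (x y : R) : `|x - complex.Re z| <= s -> `|y - complex.Im z| <= s ->
    (x != complex.Re z) || (y != complex.Im z) -> nc (F (x +i* y)%C) <= M.
  move=> hx hy ne; apply: bF; first by apply: contraL ne => /eqP <- /=; rewrite !eqxx.
  have -> : (x +i* y)%C - z = ((x - complex.Re z) +i* (y - complex.Im z))%C.
    by apply: complex_eq; rewrite ?cReB ?cImB.
  apply: le_lt_trans (normc_le_ReIm _ _) _; apply: le_lt_trans (lerD hx hy) _.
  by clear -s0 sd d0; lra.
move: {dF} (complex.Re z) (complex.Im z) b1 b2 b3 b4 dF' bF => a b b1 b2 b3 b4 dF bF.
have [l1 l2 l3] : [/\ x1 <= a - s, a - s <= a + s & a + s <= x2].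
  by clear -s0 b1 b2; split; lra.
have [m1 m2 m3] : [/\ y1 <= b - s, b - s <= b + s & b + s <= y2].
  by clear -s0 b3 b4; split; lra.
have neL x : x <= a - s -> x != a.
  by clear -s0 => h; apply/eqP; lra.
have neR x : a + s <= x -> x != a.
  by clear -s0 => h; apply/eqP; lra.
have neD y : y <= b - s -> y != b.
  by clear -s0 => h; apply/eqP; lra.
have neU y : b + s <= y -> y != b.
  by clear -s0 => h; apply/eqP; lra.
have l4 := le_trans l2 l3; have l5 := le_trans l1 l2; have l6 := le_trans l1 l4.
have m4 := le_trans m2 m3; have m5 := le_trans m1 m2; have m6 := le_trans m1 m4.
have cF x y : x1 <= x <= x2 -> y1 <= y <= y2 -> (x != a) || (y != b) ->
  ccont F (x +i* y)%C by move=> *; exact/cdiff_cont/dF.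
have z1 : bint x1 (a - s) y1 y2 F = 0.
  apply: goursat => // -[x y] [/= /andP[hx1 hx2] hy]; apply: dF => //.
    by rewrite hx1 (le_trans hx2).
  by rewrite neL.
have z2 : bint (a + s) x2 y1 y2 F = 0.
  apply: goursat => // -[x y] [/= /andP[hx1 hx2] hy]; apply: dF => //.
    by rewrite hx2 (le_trans _ hx1).
  by rewrite neR.
have z3 : bint (a - s) (a + s) y1 (b - s) F = 0.
  apply: goursat => // -[x y] [/= /andP[hx1 hx2] /andP[hy1 hy2]]; apply: dF => //.
  - by rewrite (le_trans l1)// (le_trans hx2).
  - by rewrite hy1 (le_trans hy2).
  - by rewrite neD ?orbT.
have z4 : bint (a - s) (a + s) (b + s) y2 F = 0.
  apply: goursat => // -[x y] [/= /andP[hx1 hx2] /andP[hy1 hy2]]; apply: dF => //.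
  - by rewrite (le_trans l1)// (le_trans hx2).
  - by rewrite hy2 (le_trans _ hy1).
  - by rewrite neU ?orbT.
rewrite (bint_splitx l1 l4); first last.
- apply: hseg_cont => t ht; apply: cF; rewrite ?m6 ?lexx//.
  by rewrite (neU y2) ?orbT.
- apply: hseg_cont => t ht; apply: cF; rewrite ?m6 ?lexx//.
  by rewrite (neD y1) ?orbT.
rewrite z1 add0r (bint_splitx l2 l3); first last.
- apply: hseg_cont => t /andP[t1 t2]; apply: cF; rewrite ?m6 ?lexx// ?t2 ?(le_trans l1)//.
  by rewrite (neU y2) ?orbT.
- apply: hseg_cont => t /andP[t1 t2]; apply: cF; rewrite ?m6 ?lexx// ?t2 ?(le_trans l1)//.
  by rewrite (neD y1) ?orbT.
rewrite z2 addr0 (bint_splity m1 m4); first last.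
- by apply: vseg_cont => t ht; apply: cF; rewrite ?l3 ?l5// neR.
- by apply: vseg_cont => t ht; apply: cF; rewrite ?l1 ?l4// neL.
rewrite z3 add0r (bint_splity m2 m3); first last.
- by apply: vseg_cont => t /andP[t1 t2]; apply: cF;
    rewrite ?l3 ?l5 ?t2 ?(le_trans m1)// neR.
- by apply: vseg_cont => t /andP[t1 t2]; apply: cF;
    rewrite ?l1 ?l4 ?t2 ?(le_trans m1)// neL.
rewrite z4 addr0.
have neB u : bdry (a - s) (a + s) (b - s) (b + s) u ->
    (complex.Re u != a) || (complex.Im u != b).
  by move=> [_ [->|->|->|->]]; rewrite ?(neL (a - s)) ?(neR (a + s)) ?(neD (b - s))
    ?(neU (b + s)) ?orbT.
apply: (@le_trans _ _ (4 * M * (a + s - (a - s) + (b + s - (b - s))))); last first.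
  by clear; lra.
apply: bint_bound => //.
- move=> -[x y] zB; have := neB _ zB; case: zB => -[/= /andP[? ?] /andP[? ?]] _ ne.
  apply: cF => //; first by rewrite (le_trans l1)// (le_trans _ l3).
  by rewrite (le_trans m1)// (le_trans _ m3).
- move=> -[x y] zB; have := neB _ zB; case: zB => -[/= /andP[? ?] /andP[? ?]] _ ne.
  by apply: bF => //; rewrite ler_distl; apply/andP.
Qed.

(** The quotient [(f w - f z) / (w - z)] is bounded near [z], so its integral vanishes by
    [bint_punctured]. The integral of the kernel is left unevaluated instead of being replaced by
    [2 * pi * i]: a lower bound for it is enough. *)
Lemma cauchy_formula f z : In z -> (forall w, Rect w -> cdiff f w) ->
  B (fun w => (w - z)^-1) * f z = B (fun w => f w / (w - z)).
Proof.
move=> Inz df; have [x12 y12] := inter_le Inz.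
have cinv : bcont x1 x2 y1 y2 (fun w => (w - z)^-1).
  move=> w Bw; apply: ccontV; first exact: bdry_neq Bw.
  by apply: ccontB; [exact: ccont_id|exact: ccont_cst].
have cfinv : bcont x1 x2 y1 y2 (fun w => f w / (w - z)).
  by move=> w Bw; apply: ccontM; [apply/cdiff_cont/df; case: Bw|exact: cinv].
have Rz : Rect z by case: Inz => /andP[/ltW ? /ltW ?] /andP[/ltW ? /ltW ?]; split; apply/andP.
have [c cP] := (cdiffP _ _).1 (df z Rz).
have [d d0 K] := cP 1 ltr01.
have : B (fun w => (f w - f z) / (w - z)) = 0.
  (* Here [c] is the derivative at [z], and 1 is the tolerance in its definition. *)
  apply: (bint_punctured (M := nc c + 1) Inz d0).
    move=> w Rw wz; apply: cdiffM.
      by apply: cdiffB; [exact: df|exact: cdiff_cst].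
    apply: cdiffV; first by rewrite subr_eq0.
    by apply: cdiffB; [exact: cdiff_id|exact: cdiff_cst].
  move=> w wz wd; rewrite normcM normcV ler_pdivrMr ?normc_gt0 ?subr_eq0//.
  have := K w wd; rewrite mul1r mulrDl mul1r => k.
  rewrite -(subrK (c * (w - z)) (f w - f z)) addrC.
  by apply: (le_trans (normc_triangle _ _)); rewrite normcM lerD.
rewrite (@eq_bint _ _ _ _ _ x12 y12 _ (fun w => f w / (w - z) - f z * (w - z)^-1)); last first.
  by move=> w _; rewrite mulrBl.
have cz : bcont x1 x2 y1 y2 (fun w => f z * (w - z)^-1).
  by move=> w Bw; apply: ccontM; [exact: ccont_cst|exact: cinv].
rewrite (bintB x12 y12 cfinv cz) (bintZ x12 y12 _ cinv) => /eqP.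
by rewrite subr_eq0 mulrC => /eqP.
Qed.

End Cauchy.

Lemma itvccP (R : realType) (a b t : R) : `[a, b]%classic t -> a <= t <= b.
Proof. by rewrite /= in_itv. Qed.

Lemma Re_CI (R : realType) (a b : R) (F : R -> R[i]) : complex.Re (CI a b F) =
  \int[@lebesgue_measure R]_(t in `[a, b]) complex.Re (F t).
Proof. by []. Qed.

Lemma Im_CI (R : realType) (a b : R) (F : R -> R[i]) : complex.Im (CI a b F) =
  \int[@lebesgue_measure R]_(t in `[a, b]) complex.Im (F t).
Proof. by []. Qed.

(** * The integral of the Cauchy kernel and functions represented by it *)

Section CauchyIntegral.
Variable R : realType.
Local Notation C := R[i].
Implicit Types (f g h F : C -> C) (z w : C).
Variables (x1 x2 y1 y2 : R).
Local Notation B := (bint x1 x2 y1 y2).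
Local Notation Rect := (rect x1 x2 y1 y2).
Local Notation Bd := (bdry x1 x2 y1 y2).
Local Notation In := (inter x1 x2 y1 y2).

Definition kappa z := B (fun w => (w - z)^-1).

Lemma cauchy_kernel_cont z : In z -> bcont x1 x2 y1 y2 (fun w => (w - z)^-1).
Proof.
move=> Inz w Bw; apply: ccontV; first exact: bdry_neq Bw.
by apply: ccontB; [exact: ccont_id|exact: ccont_cst].
Qed.

(** All four sides contribute nonnegatively to the imaginary part. Only the right side is kept,
    where the distance to [z] is at most half the perimeter. *)
Lemma kappa_lower z : In z ->
  (y2 - y1) * ((x2 - complex.Re z) / (x2 - x1 + (y2 - y1)) ^+ 2) <= complex.Im (kappa z).
Proof.
move=> Inz; have [x12 y12] := inter_le Inz.
have [s1 s2 s3 s4] := bcont_sides x12 y12 (cauchy_kernel_cont Inz).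
have D0 : 0 < x2 - x1 + (y2 - y1).
  by move: Inz => [/andP[? ?] /andP[? ?]]; lra.
rewrite /kappa /bint; set D := x2 - x1 + (y2 - y1) in D0 *.
have ReV (a b : R) : complex.Re ((a +i* b)%C)^-1 = a / (a ^+ 2 + b ^+ 2) by [].
have ImV (a b : R) : complex.Im ((a +i* b)%C)^-1 = - (b / (a ^+ 2 + b ^+ 2)) by [].
have sub (a b : R) : (a +i* b)%C - z = ((a - complex.Re z) +i* (b - complex.Im z))%C.
  by apply: complex_eq; rewrite ?cReB ?cImB.
have nn (a b : R) : 0 <= a ^+ 2 + b ^+ 2 by rewrite addr_ge0 ?sqr_ge0.
have Imi (u : C) : complex.Im ('i%C * u) = complex.Re u.
  by rewrite cImM /= mul0r add0r mul1r.
rewrite cImD cImB Imi cReB /hseg /vseg.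
case: z Inz ReV ImV sub s1 s2 s3 s4 => zx zy [/andP[a1 a2] /andP[b1 b2]] ReV ImV sub s1 s2 s3 s4.
rewrite /= in a1 a2 b1 b2; rewrite [complex.Re (zx +i* zy)%C]/=.
have i1 : 0 <= complex.Im (CI x1 x2 (fun t => ((t +i* y1)%C - (zx +i* zy)%C)^-1)).
  rewrite Im_CI; apply: Rintegral_ge0 => t /itvccP/andP[t1 t2].
  by rewrite sub ImV -mulNr divr_ge0//= opprB subr_ge0 ltW.
have i2 : complex.Im (CI x1 x2 (fun t => ((t +i* y2)%C - (zx +i* zy)%C)^-1)) <= 0.
  rewrite ?Im_CI ?Re_CI -oppr_ge0 -mulN1r -RintegralZl//; last exact: seg_Im_integrable.
  apply: Rintegral_ge0 => t /itvccP/andP[t1 t2].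
  by rewrite sub ImV mulN1r opprK divr_ge0//= subr_ge0 ltW.
have i3 : complex.Re (CI y1 y2 (fun t => ((x1 +i* t)%C - (zx +i* zy)%C)^-1)) <= 0.
  rewrite ?Im_CI ?Re_CI -oppr_ge0 -mulN1r -RintegralZl//; last exact: seg_Re_integrable.
  apply: Rintegral_ge0 => t /itvccP/andP[t1 t2].
  by rewrite sub ReV mulN1r -mulNr divr_ge0//= opprB subr_ge0 ltW.
have i4 : (y2 - y1) * ((x2 - zx) / D ^+ 2) <=
    complex.Re (CI y1 y2 (fun t => ((x2 +i* t)%C - (zx +i* zy)%C)^-1)).
  rewrite mulrC -Rint_cst// Re_CI; apply: le_Rintegral => //.
  - exact: integrable_cst_itv.
  - exact: seg_Re_integrable.
  - move=> t /itvccP/andP[t1 t2].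
    rewrite sub ReV /= ler_pM2l ?subr_gt0// lef_pV2 ?posrE//.
    + rewrite /D; nra.
    + by rewrite exprn_gt0.
    + by rewrite ltr_pwDl ?sqr_ge0// exprn_gt0// subr_gt0.
lra.
Qed.

Lemma kappa_neq0 z : In z -> kappa z != 0.
Proof.
move=> Inz; have := kappa_lower Inz; move: Inz => [/andP[? ?] /andP[? ?]].
move=> h; apply/eqP => k; move: h; rewrite k /= leNgt => /negP; apply.
by rewrite mulr_gt0 ?divr_gt0 ?exprn_gt0//; lra.
Qed.

Lemma seg_cont_bounded (F : R -> C) a b : a <= b -> seg_cont a b F ->
  exists M : R, forall t, a <= t <= b -> nc (F t) <= M.
Proof.
move=> ab cF.
have cn : {within `[a, b], continuous (fun t => nc (F t))}.
  by apply: lip_comp_continuous => //; exact: normc_lip.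
have [c _ H] := EVT_max ab cn.
by exists (nc (F c)) => t tab; apply: H; rewrite in_itv.
Qed.

Lemma bcont_bounded h : x1 <= x2 -> y1 <= y2 -> bcont x1 x2 y1 y2 h ->
  exists2 M : R, 0 <= M & forall w, Bd w -> nc (h w) <= M.
Proof.
move=> x12 y12 /(bcont_sides x12 y12)[].
move=> /(seg_cont_bounded x12)[M1 H1] /(seg_cont_bounded x12)[M2 H2].
move=> /(seg_cont_bounded y12)[M3 H3] /(seg_cont_bounded y12)[M4 H4].
exists (Num.max 0 (Num.max (Num.max M1 M2) (Num.max M3 M4))).
  by rewrite le_max lexx.
move=> [a b] [[/= ha hb] h']; rewrite !le_max.
case: h' => /= h'; rewrite h'.
- by rewrite (H3 b hb) !orbT.
- by rewrite (H4 b hb) !orbT.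
- by rewrite (H1 a ha) !orbT.
- by rewrite (H2 a ha) !orbT.
Qed.

(** Differentiation under the integral sign, done on the difference quotient: the remainder of the
    kernel is [(u - z)^2 / ((w - u) (w - z)^2)]. With [b] the distance from [z] to the boundary and
    [|u - z| < b / 2], the denominator is at least [b^3 / 2]. *)
Lemma cauchy_integral_cdiff h z : bcont x1 x2 y1 y2 h -> In z ->
  cdiff (fun z => B (fun w => h w / (w - z))) z.
Proof.
move=> hc Inz; have [x12 y12] := inter_le Inz.
have [M M0 HM] := bcont_bounded x12 y12 hc.
have b0 := bdist_gt0 Inz; set b := bdist _ _ _ _ z in b0.
have ck u : In u -> bcont x1 x2 y1 y2 (fun w => h w / (w - u)).
  by move=> Iu w Bw; apply: ccontM; [exact: hc|exact: (cauchy_kernel_cont Iu)].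
apply/cdiffP; exists (B (fun w => h w / (w - z) / (w - z))) => e e0.
pose K := 4 * (M * (2 / b ^+ 3)) * (x2 - x1 + (y2 - y1)).
have K0 : 0 <= K.
  have b3 : 0 <= 2 / b ^+ 3 by rewrite divr_ge0// exprn_ge0// ltW.
  have xy0 : 0 <= x2 - x1 + (y2 - y1) by rewrite addr_ge0// subr_ge0.
  exact: mulr_ge0 (mulr_ge0 (ler0n _ 4) (mulr_ge0 M0 b3)) xy0.
have K1 : 0 < K + 1 by rewrite ltr_wpDl.
exists (Num.min (b / 2) (e / (K + 1))); first by rewrite lt_min !divr_gt0.
move=> u; rewrite lt_min => /andP[ub ue].
have Iu : In u by apply: inter_near; apply: (lt_trans ub); rewrite ltr_pdivrMr// ltr_pMr// ltr1n.
have ckk : bcont x1 x2 y1 y2 (fun w => h w / (w - z) / (w - z)).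
  by move=> w Bw; apply: ccontM; [exact: ck|exact: cauchy_kernel_cont].
have cs : bcont x1 x2 y1 y2 (fun w => (u - z) * (h w / (w - z) / (w - z))).
  by move=> w Bw; apply: ccontM; [exact: ccont_cst|exact: ckk].
have cd : bcont x1 x2 y1 y2 (fun w => h w / (w - u) - h w / (w - z)).
  by move=> w Bw; apply: ccontB; apply: ck.
rewrite [X in _ - X]mulrC -(bintZ x12 y12 _ ckk) -(bintB x12 y12 (ck u Iu) (ck z Inz)).
rewrite -(bintB x12 y12 cd cs).
apply: (@le_trans _ _ (4 * (M * (2 / b ^+ 3) * nc (u - z) ^+ 2) * (x2 - x1 + (y2 - y1)))).
  apply: (bint_bound x12 y12).
    by move=> w Bw; apply: ccontB; [exact: cd|exact: cs].
  move=> w Bw; have wz := bdry_neq Inz Bw; have wu := bdry_neq Iu Bw.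
  have -> : h w / (w - u) - h w / (w - z) - (u - z) * (h w / (w - z) / (w - z)) =
     h w * ((u - z) ^+ 2 / ((w - u) * (w - z) ^+ 2)).
    by field; rewrite wz wu.
  rewrite -mulrA normcM ler_pM ?normc_ge0// ?HM//.
  have bz : b <= nc (w - z) by exact: bdist_le Bw.
  have bu : b / 2 <= nc (w - u).
    have := normc_dist_triangle w u z; lra.
  rewrite normcM normcV !(normcM, normcX) mulrC ler_wpM2r ?exprn_ge0 ?normc_ge0//.
  have -> : 2 / b ^+ 3 = (b / 2 * b ^+ 2)^-1.
    by rewrite exprS !invfM invrK; ring.
  rewrite lef_pV2 ?posrE ?mulr_gt0 ?divr_gt0 ?exprn_gt0 ?normc_gt0//.
  rewrite ler_pM ?exprn_ge0 ?divr_ge0 ?(ltW b0)//.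
  by rewrite ler_pXn2r ?nnegrE ?normc_ge0// ltW.
have -> : 4 * (M * (2 / b ^+ 3) * nc (u - z) ^+ 2) * (x2 - x1 + (y2 - y1)) =
   K * nc (u - z) * nc (u - z) by rewrite /K; ring.
rewrite ler_wpM2r ?normc_ge0//.
move: ue; rewrite ltr_pdivlMr// => /ltW; apply: le_trans.
by rewrite mulrC ler_wpM2l ?normc_ge0// lerDl.
Qed.

(** [h] need only be continuous and need not be the boundary values of [f]; this produces new
    analytic functions, both quotients and limits. The factor [kappa] is itself the Cauchy integral
    of the constant 1. *)
Lemma cauchy_rep_cdiff f h : bcont x1 x2 y1 y2 h ->
  (forall z, In z -> kappa z * f z = B (fun w => h w / (w - z))) ->
  forall z, In z -> cdiff f z.
Proof.
move=> hc H z Inz; have b0 := bdist_gt0 Inz.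
apply: (@cdiff_near _ (fun z => (kappa z)^-1 * B (fun w => h w / (w - z)))); first exact: b0.
  move=> u /inter_near Iu; rewrite -H// mulKf//; exact: kappa_neq0.
apply: cdiffM; last exact: cauchy_integral_cdiff.
apply: cdiffV; first exact: kappa_neq0.
have c1 : bcont x1 x2 y1 y2 (fun=> 1) by move=> w _; exact: ccont_cst.
have [x12 y12] := inter_le Inz.
have := cauchy_integral_cdiff c1 Inz; apply: cdiff_near b0 _ => u /inter_near Iu.
by apply: (eq_bint x12 y12) => w _; rewrite mul1r.
Qed.

(** Division by [z - w] without power series: the quotient is the Cauchy integral of
    [f u / (u - w)], which is continuous on the boundary. *)
Lemma cdiff_factor f w : In w -> (forall z, Rect z -> cdiff f z) -> f w = 0 ->
  exists g, (forall z, In z -> cdiff g z) /\ (forall z, In z -> f z = (z - w) * g z).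
Proof.
move=> Inw df fw0; have [x12 y12] := inter_le Inw.
have cf : bcont x1 x2 y1 y2 f by move=> u [Ru _]; exact/cdiff_cont/df.
pose h u := f u / (u - w).
have ch : bcont x1 x2 y1 y2 h.
  by move=> u Bu; apply: ccontM; [exact: cf|exact: (cauchy_kernel_cont Inw)].
pose g z := (kappa z)^-1 * B (fun u => h u / (u - z)).
exists g; split.
  apply: (cauchy_rep_cdiff ch) => z Inz; rewrite /g mulVKf//; exact: kappa_neq0.
move=> z Inz; have kz := kappa_neq0 Inz.
apply: (mulfI kz); rewrite /g mulrCA mulVKf// cauchy_formula//.
(* Since [f w = 0], the integral of [f u / (u - w)] vanishes. Subtracting it from that of
   [f u / (u - z)] brings out the factor [z - w]. *)
have := cauchy_formula Inw df; rewrite fw0 mulr0 => fw.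
have c1 : bcont x1 x2 y1 y2 (fun u => f u / (u - z)).
  by move=> u Bu; apply: ccontM; [exact: cf|exact: (cauchy_kernel_cont Inz)].
have c2 : bcont x1 x2 y1 y2 (fun u => h u / (u - z)).
  by move=> u Bu; apply: ccontM; [exact: ch|exact: (cauchy_kernel_cont Inz)].
rewrite -[LHS]subr0 [X in _ - X]fw -(bintB x12 y12 c1 ch) -(bintZ x12 y12 _ c2).
apply: (eq_bint x12 y12) => u Bu; rewrite /h.
have uz := bdry_neq Inz Bu; have uw := bdry_neq Inw Bu.
by field; rewrite uz uw.
Qed.

End CauchyIntegral.

(** * Area estimates *)

Section AreaEstimate.
Variable R : realType.
Local Notation C := R[i].
Local Notation leb := (@lebesgue_measure R).
Local Notation mR := (measurableTypeR R).
Implicit Types (k : C -> C) (z w : C).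

(** Markov's inequality: were [A] at least [K / (b - a)] on the whole segment, its integral would be
    at least [K]. *)
Lemma good_point (A : mR -> \bar R) (a b K : R) : a < b ->
  measurable_fun setT A -> (forall x, 0 <= A x)%E ->
  (\int[leb]_x A x < K%:E)%E ->
  exists2 x, a <= x <= b & (A x < (K / (b - a))%:E)%E.
Proof.
move=> ab mA A0 AK; apply: contrapT => H.
have ba : 0 < b - a by rewrite subr_gt0.
have {}H x : `[a, b]%classic x -> ((K / (b - a))%:E <= A x)%E.
  by move=> /itvccP xab; rewrite leNgt; apply/negP => ?; apply: H; exists x.
move: AK; rewrite ltNge => /negP; apply.
have [K0|/ltW K0] := leP 0 K; last first.
  by apply: (@le_trans _ _ 0%E); rewrite ?lee_fin// integral_ge0.
apply: (@le_trans _ _ (\int[leb]_(x in `[a, b]) A x)%E); last first.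
  by apply: ge0_subset_integral => //; exact: measurable_itv.
apply: (@le_trans _ _ (\int[leb]_(x in `[a, b]) (K / (b - a))%:E)%E); last first.
  apply: ge0_le_integral => //; last exact: measurable_funTS.
  by move=> x _; rewrite lee_fin divr_ge0// ltW.
rewrite integral_cst//=.
rewrite lebesgue_measure_itv /= lte_fin ab -EFinD -EFinM.
by rewrite divfK// gt_eqF.
Qed.

Local Notation mu2 := (@lebesgue_measure R \x @lebesgue_measure R)%E.

Lemma good_vslice (f : mR * mR -> \bar R) (a b K : R) : a < b ->
  measurable_fun setT f -> (forall p, 0 <= f p)%E ->
  (\int[mu2]_p f p < K%:E)%E ->
  exists2 x, a <= x <= b & (\int[leb]_y f (x, y) < (K / (b - a))%:E)%E.
Proof.
move=> ab mf f0; rewrite fubini_tonelli1// => fK.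
apply: (good_point ab _ _ fK); first exact: measurable_fun_fubini_tonelli_F.
by move=> x; apply: integral_ge0.
Qed.

Lemma good_hslice (f : mR * mR -> \bar R) (a b K : R) : a < b ->
  measurable_fun setT f -> (forall p, 0 <= f p)%E ->
  (\int[mu2]_p f p < K%:E)%E ->
  exists2 y, a <= y <= b & (\int[leb]_x f (x, y) < (K / (b - a))%:E)%E.
Proof.
move=> ab mf f0; rewrite fubini_tonelli2// => fK.
apply: (good_point ab _ _ fK); first exact: measurable_fun_fubini_tonelli_G.
by move=> x; apply: integral_ge0.
Qed.

Lemma CI_le_integral (F : R -> C) (u : mR -> \bar R) (a b K r : R) :
  0 <= r -> seg_cont a b F -> measurable_fun setT u -> (forall x, 0 <= u x)%E ->
  (forall t, a <= t <= b -> ((nc (F t))%:E <= r%:E * u t)%E) ->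
  (\int[leb]_t u t < K%:E)%E -> nc (CI a b F) <= 2 * (r * K).
Proof.
move=> r0 cF mu0 u0 H uK.
have ni := seg_cont_integrable (@normc_lip R) cF.
apply: (le_trans (CI_le cF ni (fun t _ => lexx _))).
rewrite ler_pM2l// -lee_fin /Rintegral fineK; last exact: integrable_fin_num.
have mI : measurable (`[a, b]%classic : set mR) by exact: measurable_itv.
apply: (@le_trans _ _ (\int[leb]_(t in `[a, b]) (r%:E * u t))%E).
  apply: ge0_le_integral => //.
  - by move=> x _; rewrite lee_fin normc_ge0.
  - exact: (measurable_int leb).
  - by apply: measurable_funeM; exact: measurable_funTS.
rewrite ge0_integralZl_EFin//; last exact: measurable_funTS.
rewrite EFinM lee_wpmul2l ?lee_fin// (le_trans _ (ltW uK))//.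
by apply: ge0_subset_integral.
Qed.

(** With the weight [|z - w|^2], the estimates below bound [k] by the norm of [(z - w) k]. On a
    contour around [w] the weight stays away from zero. *)
Definition wsq w k (p : mR * mR) : R := nc (cplx p - w) ^+ 2 * nc (k (cplx p)) ^+ 2.

Lemma measurable_wsq w k (D : set (mR * mR)) :
  measurable_fun D (fun p => complex.Re (k (cplx p))) ->
  measurable_fun D (fun p => complex.Im (k (cplx p))) ->
  measurable_fun D (fun p => (wsq w k p)%:E).
Proof.
move=> m1 m2; apply/measurable_EFinP.
have -> : wsq w k = (fun p : mR * mR => ((p.1 - complex.Re w) ^+ 2 + (p.2 - complex.Im w) ^+ 2) *
    (complex.Re (k (cplx p)) ^+ 2 + complex.Im (k (cplx p)) ^+ 2)).
  by apply/funext => p; rewrite /wsq !normc_sqr cReB cImB.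
apply: measurable_funM.
  apply: measurable_funD; apply: measurable_funX; apply: measurable_funB => //;
  apply: measurable_funTS; [exact: measurable_fst|exact: measurable_snd].
by apply: measurable_funD; exact: measurable_funX.
Qed.

Lemma wsq_ge0 w k p : 0 <= wsq w k p.
Proof. by rewrite mulr_ge0 ?sqr_ge0. Qed.

(** The norm of [z - w] is bounded by the sum of two coordinates of size at most [3 * rho], whence
    [6 * rho]. *)
Lemma square_in_disk w (rho : R) z : nc w + 6 * rho < 1 ->
  rect (complex.Re w - 3 * rho) (complex.Re w + 3 * rho)
       (complex.Im w - 3 * rho) (complex.Im w + 3 * rho) z -> unit_disk z.
Proof.
move=> wr [h1 h2]; rewrite unit_diskE.
rewrite -[z](subrK w) (le_lt_trans (normc_triangle _ _))//.
have -> : z - w = ((complex.Re z - complex.Re w) +i* (complex.Im z - complex.Im w))%C.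
  by apply: complex_eq; rewrite ?cReB ?cImB.
have : `|complex.Re z - complex.Re w| <= 3 * rho by rewrite ler_distl.
have : `|complex.Im z - complex.Im w| <= 3 * rho by rewrite ler_distl.
have := normc_le_ReIm (complex.Re z - complex.Re w) (complex.Im z - complex.Im w).
lra.
Qed.

(** The constant is [1 / (rho * (2 * rho)^2)]: one factor [rho] for the Cauchy kernel, the square
    for the weight. *)
Lemma weighted_kernel_bound w z k (rho : R) zeta : 0 < rho ->
  2 * rho <= nc (zeta - w) -> rho <= nc (zeta - z) ->
  nc (k zeta * k zeta / (zeta - z)) <=
    (4 * rho ^+ 3)^-1 * (nc (zeta - w) ^+ 2 * nc (k zeta) ^+ 2).
Proof.
move=> r0 h1 h2; rewrite normcM normcV normcM -expr2.
have z0 : 0 < nc (zeta - z) by apply: lt_le_trans h2.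
rewrite ler_pdivrMr// mulrC mulrA mulrA ler_peMl ?sqr_ge0//.
have -> : nc (zeta - z) * (4 * rho ^+ 3)^-1 * nc (zeta - w) ^+ 2 =
   (nc (zeta - z) / rho) * (nc (zeta - w) / (2 * rho)) ^+ 2.
  by field; rewrite gt_eqF.
rewrite -[1]mulr1 ler_pM// ?mulr1 ?ler_pdivlMr ?mul1r//.
by rewrite exprn_ege1// ler_pdivlMr ?mul1r// mulr_gt0.
Qed.

(* By Tonelli, each side of the contour can be moved to a position where |k|^2 has
   small integral; Cauchy's formula is then applied to k^2. *)
Theorem weighted_point_bound w k (rho K : R) z : 0 < rho -> nc w + 6 * rho < 1 ->
  analytic_disk k ->
  measurable_fun (@disk2 R) (fun p => complex.Re (k (cplx p))) ->
  measurable_fun (@disk2 R) (fun p => complex.Im (k (cplx p))) ->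
  (\int[mu2]_(p in @disk2 R) (wsq w k p)%:E < K%:E)%E ->
  rect (complex.Re w - rho) (complex.Re w + rho)
       (complex.Im w - rho) (complex.Im w + rho) z ->
  nc (k z) ^+ 2 <= 72 / rho ^+ 4 * K.
Proof.
move=> r0 wr ak m1 m2; rewrite integral_mkcond; set f := _ \_ _ => fK.
have mf : measurable_fun setT f.
  apply/(measurable_restrictT _ (@measurable_disk2 R)).
  exact: measurable_wsq.
have f0 p : (0 <= f p)%E.
  by rewrite /f patchE; case: ifP => // _; rewrite lee_fin wsq_ge0.
have fE x y : unit_disk (x +i* y)%C -> f (x, y) = (wsq w k (x, y))%:E.
  by move=> Dxy; rewrite /f patchE mem_set.
set a := complex.Re w; set b := complex.Im w => Rz.
have inD := square_in_disk wr; rewrite -/a -/b in inD.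
(* Each side is sought at distance between [2 * rho] and [3 * rho] from [w]. The contour then stays
   at distance [2 * rho] from [w], and [rho] from every [z] of the small square. *)
have lt23 c : c + 2 * rho < c + 3 * rho by rewrite ltrD2l ltr_pM2r// ltr_nat.
have ltN32 c : c - 3 * rho < c - 2 * rho by rewrite ltrD2l ltrN2 ltr_pM2r// ltr_nat.
have [x2 x2P f2] := good_vslice (lt23 a) mf f0 fK.
have [x1 x1P f1] := good_vslice (ltN32 a) mf f0 fK.
have [y2 y2P g2] := good_hslice (lt23 b) mf f0 fK.
have [y1 y1P g1] := good_hslice (ltN32 b) mf f0 fK.
have e1 c : c + 3 * rho - (c + 2 * rho) = rho by ring.
have e2 c : c - 2 * rho - (c - 3 * rho) = rho by ring.
rewrite !e1 in f2 g2; rewrite !e2 in f1 g1.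
have subD u : rect x1 x2 y1 y2 u -> unit_disk u.
  move=> [/andP[h1 h2] /andP[h3 h4]]; apply: inD; clear -r0 x1P x2P y1P y2P h1 h2 h3 h4.
  move: x1P x2P y1P y2P => /andP[? ?] /andP[? ?] /andP[? ?] /andP[? ?].
  by split; apply/andP; split; lra.
have Inz : inter x1 x2 y1 y2 z.
  clear -r0 Rz x1P x2P y1P y2P.
  move: Rz x1P x2P y1P y2P => [/andP[? ?] /andP[? ?]] /andP[? ?] /andP[? ?] /andP[? ?] /andP[? ?].
  by split; apply/andP; split; lra.
have [x12 y12] := inter_le Inz.
have bz : rho <= bdist x1 x2 y1 y2 z.
  rewrite /bdist !le_min.
  clear -r0 Rz x1P x2P y1P y2P.
  move: Rz x1P x2P y1P y2P => [/andP[? ?] /andP[? ?]] /andP[? ?] /andP[? ?] /andP[? ?] /andP[? ?].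
  by rewrite -!andbA; apply/and4P; split; lra.
have bw : 2 * rho <= bdist x1 x2 y1 y2 w.
  rewrite /bdist !le_min -/a -/b.
  clear -r0 x1P x2P y1P y2P.
  move: x1P x2P y1P y2P => /andP[? ?] /andP[? ?] /andP[? ?] /andP[? ?].
  by rewrite -!andbA; apply/and4P; split; lra.
pose F u := k u * k u / (u - z).
have dk u : rect x1 x2 y1 y2 u -> cdiff (fun u => k u * k u) u.
  by move=> /subD Du; apply: cdiffM; exact: ak.
have cF : bcont x1 x2 y1 y2 F.
  move=> u Bu; apply: ccontM; last exact: (cauchy_kernel_cont Inz).
  by apply/cdiff_cont/dk; case: Bu.
have [s1 s2 s3 s4] := bcont_sides x12 y12 cF.
pose r := (4 * rho ^+ 3)^-1.
have rr : 0 <= r by rewrite invr_ge0 mulr_ge0// exprn_ge0// ltW.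
have FE u : bdry x1 x2 y1 y2 u ->
    ((nc (F u))%:E <= r%:E * f (complex.Re u, complex.Im u))%E.
  move=> Bu; rewrite fE; last by have := subD _ Bu.1; case: (u).
  rewrite -EFinM lee_fin /wsq /cplx /=.
  have -> : (complex.Re u +i* complex.Im u)%C = u by case: (u).
  apply: weighted_kernel_bound => //.
    by apply: (le_trans bw); exact: bdist_le Bu.
  by apply: (le_trans bz); exact: bdist_le Bu.
have mv x : measurable_fun setT (fun y : mR => f (x, y)).
  by apply: measurableT_comp => //; exact: measurable_pair1.
have mh y : measurable_fun setT (fun x : mR => f (x, y)).
  by apply: measurableT_comp => //; exact: measurable_pair2.
have b1 : nc (CI y1 y2 (vseg F x1)) <= 2 * (r * (K / rho)).
  apply: (CI_le_integral rr s3 (mv x1) _ _ f1) => // t ht.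
  by apply: (FE (x1 +i* t)%C); split; [rewrite /rect/= lexx x12 ht|apply: Or41].
have b2 : nc (CI y1 y2 (vseg F x2)) <= 2 * (r * (K / rho)).
  apply: (CI_le_integral rr s4 (mv x2) _ _ f2) => // t ht.
  by apply: (FE (x2 +i* t)%C); split; [rewrite /rect/= lexx x12 ht|apply: Or42].
have b3 : nc (CI x1 x2 (hseg F y1)) <= 2 * (r * (K / rho)).
  apply: (CI_le_integral rr s1 (mh y1) _ _ g1) => // t ht.
  by apply: (FE (t +i* y1)%C); split; [rewrite /rect/= lexx y12 ht|apply: Or43].
have b4 : nc (CI x1 x2 (hseg F y2)) <= 2 * (r * (K / rho)).
  apply: (CI_le_integral rr s2 (mh y2) _ _ g2) => // t ht.
  by apply: (FE (t +i* y2)%C); split; [rewrite /rect/= lexx y12 ht|apply: Or44].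
have := cauchy_formula Inz dk; rewrite -/(kappa x1 x2 y1 y2 z) => cf.
(* In [kappa_lower] the height is at least [4 * rho], the distance to the right side at least [rho],
   and half the perimeter at most [12 * rho]: [4 / 144 = 1 / 36]. *)
have ka : 36^-1 <= nc (kappa x1 x2 y1 y2 z).
  apply: le_trans (Im_le_normc _); apply: le_trans (ler_norm _).
  apply: le_trans (kappa_lower Inz).
  move: Inz => _; clear -r0 Rz x1P x2P y1P y2P.
  move: Rz x1P x2P y1P y2P => [/andP[? ?] /andP[? ?]] /andP[? ?] /andP[? ?] /andP[? ?] /andP[? ?].
  have D0 : 0 < x2 - x1 + (y2 - y1) by lra.
  rewrite mulrA ler_pdivlMr ?exprn_gt0//.
  have h1 : x2 - x1 + (y2 - y1) <= 12 * rho by lra.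
  have h2 : 4 * rho <= y2 - y1 by lra.
  have h3 : rho <= x2 - complex.Re z by lra.
  apply: (@le_trans _ _ (36^-1 * (12 * rho) ^+ 2)).
    by rewrite ler_pM2l ?invr_gt0// ler_pXn2r ?nnegrE ?(ltW D0)// mulr_ge0// ltW.
  apply: (@le_trans _ _ (4 * rho * rho)); first by rewrite le_eqVlt; apply/orP; left; apply/eqP; field.
  by rewrite ler_pM// ?mulr_ge0// ltW.
have := normc_bint x1 x2 y1 y2 F.
rewrite -[bint _ _ _ _ F]cf normcM normcM -expr2 => hB.
(* Four sides, each with the factor 2 of [CI_le_integral]. *)
have : 36^-1 * nc (k z) ^+ 2 <= 8 * (r * (K / rho)).
  apply: (@le_trans _ _ (nc (kappa x1 x2 y1 y2 z) * nc (k z) ^+ 2)).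
    by rewrite ler_wpM2r// sqr_ge0.
  by move: hB b1 b2 b3 b4; clear; lra.
have -> : 8 * (r * (K / rho)) = 36^-1 * (72 / rho ^+ 4 * K).
  by rewrite /r; field; rewrite gt_eqF.
by rewrite ler_pM2l ?invr_gt0.
Qed.

End AreaEstimate.

(** * Hilbert spaces *)

Section Hilbert.
Variables (R : realType) (V : lmodType R[i]) (dot : V -> V -> R[i]).
Local Notation C := R[i].
Local Notation nrm := (hnorm dot).
Implicit Types (x y z : V) (a : C) (t : R).

Record hilbert : Prop := Hilbert {
  dotDl : forall a x y z, dot (a *: x + y) z = a * dot x z + dot y z;
  dotC : forall x y, dot y x = (dot x y)^*;
  dot_ge0 : forall x, 0 <= complex.Re (dot x x);
  dot_eq0 : forall x, complex.Re (dot x x) = 0 -> x = 0;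
  dot_complete : forall u : nat -> V,
    (forall e : R, 0 < e -> exists N, forall i j, (N <= i)%N -> (N <= j)%N ->
       nrm (u i - u j) < e) ->
    exists l, forall e : R, 0 < e -> exists N, forall i, (N <= i)%N ->
       nrm (u i - l) < e }.

Hypothesis H : hilbert.

Definition nsq x : R := complex.Re (dot x x).

Lemma nrm_sqr x : nrm x ^+ 2 = nsq x.
Proof. by rewrite sqr_sqrtr ?(dot_ge0 H). Qed.
Lemma nrm_ge0 x : 0 <= nrm x. Proof. exact: sqrtr_ge0. Qed.
Lemma nsq_ge0 x : 0 <= nsq x. Proof. exact: dot_ge0. Qed.
Lemma nrm_eq0 x : nrm x = 0 -> x = 0.
Proof. by move=> h; apply: (dot_eq0 H); rewrite -[LHS]nrm_sqr h expr0n. Qed.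

Lemma dot0l z : dot 0 z = 0.
Proof.
by have := dotDl H (-1) 0 0 z; rewrite scaleN1r addr0 oppr0 mulN1r addNr.
Qed.
Lemma dotZl a x z : dot (a *: x) z = a * dot x z.
Proof. by have := dotDl H a x 0 z; rewrite addr0 dot0l addr0. Qed.
Lemma dotAl x y z : dot (x + y) z = dot x z + dot y z.
Proof. by rewrite -{1}[x]scale1r (dotDl H) mul1r. Qed.
Lemma dotNl x z : dot (- x) z = - dot x z.
Proof. by rewrite -scaleN1r dotZl mulN1r. Qed.
Lemma dotBl x y z : dot (x - y) z = dot x z - dot y z.
Proof. by rewrite dotAl dotNl. Qed.
Lemma dotAr x y z : dot z (x + y) = dot z x + dot z y.
Proof. by rewrite (dotC H (x + y)) dotAl rmorphD/= (dotC H x z) (dotC H y z). Qed.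
Lemma dotZr a x z : dot z (a *: x) = a^* * dot z x.
Proof. by rewrite (dotC H (a *: x)) dotZl rmorphM/= (dotC H x z). Qed.
Lemma dotNr x z : dot z (- x) = - dot z x.
Proof. by rewrite -scaleN1r dotZr rmorphN1 mulN1r. Qed.
Lemma dotBr x y z : dot z (x - y) = dot z x - dot z y.
Proof. by rewrite dotAr dotNr. Qed.
Lemma dot0r z : dot z 0 = 0.
Proof. by rewrite (dotC H) dot0l rmorph0. Qed.

Lemma Re_dotC x y : complex.Re (dot y x) = complex.Re (dot x y).
Proof. by rewrite (dotC H) cRe_conj. Qed.

Lemma nsqD x y : nsq (x + y) = nsq x + nsq y + 2 * complex.Re (dot x y).
Proof.
rewrite /nsq !(dotAl, dotAr) !cReD [complex.Re (dot y x)]Re_dotC; ring.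
Qed.
Lemma nsqN x : nsq (- x) = nsq x.
Proof. by rewrite /nsq dotNl dotNr opprK. Qed.
Lemma nsqB x y : nsq (x - y) = nsq x + nsq y - 2 * complex.Re (dot x y).
Proof. by rewrite nsqD nsqN dotNr cReN mulrN. Qed.
Lemma nsqZ a x : nsq (a *: x) = nc a ^+ 2 * nsq x.
Proof.
rewrite /nsq dotZl dotZr mulrA normc_sqr.
have -> : a * a^* = (complex.Re a ^+ 2 + complex.Im a ^+ 2)%:C%C.
  by case: (a) => u v; apply: complex_eq; rewrite ?cReM ?cImM /=; ring.
by rewrite cReM /= mul0r subr0.
Qed.
Lemma nrmZ a x : nrm (a *: x) = nc a * nrm x.
Proof.
rewrite /hnorm -/(nsq _) nsqZ sqrtrM ?sqr_ge0// sqrtr_sqr ger0_norm//.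
exact: normc_ge0.
Qed.
Lemma Re_cauchy_schwarz x y : complex.Re (dot x y) ^+ 2 <= nsq x * nsq y.
Proof.
have K t : 0 <= nsq x + 2 * t * complex.Re (dot x y) + t ^+ 2 * nsq y.
  have := nsq_ge0 (x + t%:C%C *: y).
  rewrite nsqD nsqZ normc_real -normrX ger0_norm ?sqr_ge0// dotZr cReM /=.
  by rewrite oppr0 mul0r subr0 => h; lra.
set b := complex.Re _ in K *; have := nsq_ge0 y; rewrite le_eqVlt => /predU1P[y0|y0].
  rewrite -y0 mulr0; have [->|b0] := eqVneq b 0; first by rewrite expr0n.
  (* If [nsq y = 0] the expression is affine in [t], and this [t] gives it the value [-1]. *)
  have := K (- (nsq x + 1) / (2 * b)); rewrite -y0 mulr0 addr0.
  have -> : nsq x + 2 * (- (nsq x + 1) / (2 * b)) * b = -1 by field.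
  by rewrite ler0N1.
have := K (- b / nsq y).
have -> : nsq x + 2 * (- b / nsq y) * b + (- b / nsq y) ^+ 2 * nsq y =
   (nsq x * nsq y - b ^+ 2) / nsq y by field; rewrite gt_eqF.
by rewrite pmulr_lge0 ?invr_gt0// subr_ge0.
Qed.

(** A unimodular factor [u] rotates [dot x y] onto the positive axis, where the inequality for real
    parts applies. *)
Lemma cauchy_schwarz x y : nc (dot x y) <= nrm x * nrm y.
Proof.
have [->|d0] := eqVneq (dot x y) 0.
  by rewrite Normc.normc0 mulr_ge0 ?nrm_ge0.
set d := dot x y in d0 *; pose u : C := d^* / (nc d)%:C%C.
have nd : 0 < nc d by rewrite normc_gt0.
have nd0 : (nc d)%:C%C != 0 :> C by rewrite -normc0P normc_real normr_eq0 gt_eqF.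
have nu : nc u = 1 by rewrite /u normcM normcV normc_conj normc_real gtr0_norm// divff// gt_eqF.
have ud : dot (u *: x) y = (nc d)%:C%C.
  rewrite dotZl -/d /u mulrAC; apply: (mulIf nd0); rewrite divfK//.
  rewrite -rmorphM -expr2 normc_sqr.
  by case: (d) => p q; apply: complex_eq; rewrite ?cReM ?cImM /=; ring.
have := Re_cauchy_schwarz (u *: x) y; rewrite ud nsqZ nu expr1n mul1r /=.
rewrite -!nrm_sqr -exprMn ler_pXn2r// nnegrE ?normc_ge0// mulr_ge0 ?nrm_ge0//.
Qed.

Lemma nrmD x y : nrm (x + y) <= nrm x + nrm y.
Proof.
rewrite -(@ler_pXn2r _ 2)// ?nnegrE ?addr_ge0 ?nrm_ge0//.
have h : complex.Re (dot x y) <= nrm x * nrm y.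
  by apply: le_trans (cauchy_schwarz x y); apply: le_trans (ler_norm _) (Re_le_normc _).
by rewrite nrm_sqr nsqD -!nrm_sqr sqrrD; lra.
Qed.

Lemma dot_ext x y : (forall k, dot k x = dot k y) -> x = y.
Proof.
move=> h; apply/eqP; rewrite -subr_eq0; apply/eqP; apply: (dot_eq0 H).
by rewrite dotBr h subrr.
Qed.

Section Riesz.
Variables (B : V -> V) (M c : R).
Hypotheses (linB : linear B) (c0 : 0 < c)
  (ubB : forall x, nrm (B x) <= M * nrm x) (lbB : forall x, c * nrm x <= nrm (B x)).

Lemma linear_op0 : B 0 = 0.
Proof. by have := linB (-1) 0 0; rewrite !scaleN1r oppr0 addr0 addNr. Qed.
Lemma linear_opD x y : B (x + y) = B x + B y.
Proof. by have := linB 1 x y; rewrite !scale1r. Qed.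
Lemma linear_opZ a x : B (a *: x) = a *: B x.
Proof. by have := linB a x 0; rewrite linear_op0 !addr0. Qed.
Lemma linear_opN x : B (- x) = - B x.
Proof. by rewrite -scaleN1r linear_opZ scaleN1r. Qed.

(* For B = id this is the representation theorem; in general <B x, B y> is an
   equivalent inner product. *)
Theorem riesz (l : V -> C) (L : R) :
  (forall a x y, l (a *: x + y) = a * l x + l y) ->
  (forall x, nc (l x) <= L * nrm x) ->
  exists x, forall k, l k = dot (B k) (B x).
Proof.
move=> linl bl.
have lZ a x : l (a *: x) = a * l x.
  have l0 : l 0 = 0 by have := linl (-1) 0 0; rewrite scaleN1r oppr0 addr0 mulN1r addNr.
  by have := linl a x 0; rewrite addr0 l0 addr0.
have lD x y : l (x + y) = l x + l y by have := linl 1 x y; rewrite scale1r mul1r.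
(* The variational functional: the representing vector is its minimizer. *)
pose J f := nsq (B f) - 2 * complex.Re (l f).
have Jlb f : - (L / c) ^+ 2 <= J f.
  have h1 : c ^+ 2 * nrm f ^+ 2 <= nsq (B f).
    by rewrite -nrm_sqr -exprMn ler_pXn2r ?nnegrE ?mulr_ge0 ?nrm_ge0// ltW.
  have h2 : complex.Re (l f) <= L * nrm f.
    by apply: le_trans (bl f); apply: le_trans (ler_norm _) (Re_le_normc _).
  have h3 : 0 <= (c * nrm f - L / c) ^+ 2 by rewrite sqr_ge0.
  have h4 : (c * nrm f - L / c) ^+ 2 =
      c ^+ 2 * nrm f ^+ 2 - 2 * (L * nrm f) + (L / c) ^+ 2.
    by field; rewrite gt_eqF.
  by rewrite /J; lra.
have hinf : has_inf (range J).
  by split; [exists (J 0), 0|exists (- (L / c) ^+ 2) => _ [f _ <-]].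
set j := inf (range J).
have jle f : j <= J f by apply: ge_inf; [exact: hinf.2|exists f].
have /choice[f fP] : forall n : nat, exists f, J f < j + n.+1%:R^-1.
  move=> n; have n0 : 0 < n.+1%:R^-1 :> R by rewrite invr_gt0.
  by have [_ [f _ <-] ?] := inf_adherent n0 hinf; exists f.
(* The parallelogram identity: the midpoint of [x] and [y] cannot go below the infimum [j], so
   near-minimizers are close to each other. *)
have par x y : nsq (B (x - y)) <= 2 * (J x - j) + 2 * (J y - j).
  have := jle (2^-1%:C%C *: (x + y)).
  rewrite /J linear_opZ lZ nsqZ normc_real cReM /= mul0r subr0.
  rewrite (linear_opD x y) (linear_opD x (- y)) linear_opN lD cReD nsqB nsqD.
  rewrite ger0_norm ?invr_ge0// => h.
  by lra.
have invn (e : R) : 0 < e -> exists N, forall n, (N <= n)%N -> n.+1%:R^-1 < e.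
  move=> e0; exists (Num.bound e^-1) => n Nn.
  have e1 : 0 <= e^-1 by rewrite invr_ge0 ltW.
  by rewrite invf_plt ?posrE//; apply: (lt_le_trans (archi_boundP e1)); rewrite ler_nat leqW.
have [x xP] : exists l, forall e : R, 0 < e -> exists N, forall i, (N <= i)%N ->
    nrm (f i - l) < e.
  apply: (dot_complete H) => e e0.
  have [N NP] := invn (c ^+ 2 * e ^+ 2 / 4) ltac:(by rewrite divr_gt0 ?mulr_gt0 ?exprn_gt0).
  exists N => a b Na Nb; rewrite -(@ltr_pXn2r _ 2)// ?nnegrE ?nrm_ge0 ?(ltW e0)//.
  rewrite -(@ltr_pM2l _ (c ^+ 2)) ?exprn_gt0//.
  apply: (@le_lt_trans _ _ (nsq (B (f a - f b)))).
    by rewrite -nrm_sqr -exprMn ler_pXn2r ?nnegrE ?mulr_ge0 ?nrm_ge0// ltW.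
  apply: (le_lt_trans (par _ _)).
  move: (fP a) (fP b) (NP a Na) (NP b Nb).
  move: (c ^+ 2 * e ^+ 2) (J (f a)) (J (f b)) a.+1%:R^-1 b.+1%:R^-1 => E u v p q.
  by lra.
exists x => k.
(* The imaginary part is obtained from the real part at ['i *: k]. *)
suff key k' : complex.Re (l k') = complex.Re (dot (B k') (B x)).
  apply: complex_eq; first exact: key.
  have := key ('i%C *: k); rewrite lZ linear_opZ dotZl !cReM /=.
  by rewrite !mul0r !mul1r !sub0r => /oppr_inj.
move: k' => {}k.
set D := complex.Re (dot (B k) (B x)) - complex.Re (l k).
(* Stationarity at the minimizer. The value [t = - D / (A + 1)], with [A = nsq (B k)], would make
   the expression negative unless [D = 0]; the 1 covers [A = 0]. *)
suff h t : 0 <= t ^+ 2 * nsq (B k) + 2 * t * D.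
  apply/eqP; rewrite eq_sym -subr_eq0 -/D; apply/negPn/negP => D0.
  have A0 := nsq_ge0 (B k); set A := nsq _ in A0 h.
  have := h (- D / (A + 1)).
  have -> : (- D / (A + 1)) ^+ 2 * A + 2 * (- D / (A + 1)) * D =
     - (D ^+ 2 * (A + 2) / (A + 1) ^+ 2).
    by field; rewrite gt_eqF// ltr_wpDl.
  rewrite oppr_ge0 leNgt => /negP; apply.
  have D2 : 0 < D ^+ 2 by rewrite exprn_even_gt0.
  have [A1 A2] : 0 < A + 1 /\ 0 < A + 2 by split; rewrite ltr_wpDl.
  exact: divr_gt0 (mulr_gt0 D2 A2) (exprn_gt0 2 A1).
(* [J] is not evaluated at the limit [x]: the inequality [j <= J (f n + t k)] is expanded for one
   large [n]. Half of [e] pays for [J (f n) - j], the other half for replacing [f n] by [x]. *)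
apply/ler_addgt0Pl => e e0.
pose d := e / 2 / (2 * `|t| * (nrm (B k) * `|M|) + 1).
have P0 : 0 <= 2 * `|t| * (nrm (B k) * `|M|) by rewrite !mulr_ge0 ?nrm_ge0.
have P1 : 0 < 2 * `|t| * (nrm (B k) * `|M|) + 1 by rewrite ltr_wpDl.
have d0 : 0 < d by rewrite !divr_gt0.
have [N1 NP1] := xP d d0.
have [N2 NP2] := invn (e / 2) ltac:(by rewrite divr_gt0).
pose n := maxn N1 N2.
have {}NP1 : nrm (f n - x) < d by apply: NP1; rewrite leq_maxl.
have {}NP2 : n.+1%:R^-1 < e / 2 by apply: NP2; rewrite leq_maxr.
have h1 : j <= J (f n + t%:C%C *: k) by exact: jle.
have h2 := fP n.
rewrite /J linear_opD linear_opZ nsqD nsqZ lD lZ normc_real dotZr !cReD !cReM /= in h1 h2.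
rewrite mul0r subr0 oppr0 mul0r subr0 -normrX ger0_norm ?sqr_ge0// in h1.
have E : complex.Re (dot (B (f n)) (B k)) =
   complex.Re (dot (B k) (B x)) + complex.Re (dot (B k) (B (f n - x))).
  by rewrite Re_dotC linear_opD linear_opN dotBr cReB addrC subrK.
rewrite E in h1.
have cs : `|complex.Re (dot (B k) (B (f n - x)))| <= nrm (B k) * `|M| * nrm (f n - x).
  apply: le_trans (Re_le_normc _) _; apply: le_trans (cauchy_schwarz _ _) _.
  rewrite -mulrA ler_wpM2l ?nrm_ge0//; apply: le_trans (ubB _) _.
  by rewrite ler_wpM2r ?nrm_ge0// ler_norm.
have q : 2 * t * complex.Re (dot (B k) (B (f n - x))) <= e / 2.
  apply: le_trans (ler_norm _) _; rewrite !normrM (ger0_norm (ler0n _ 2)).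
  apply: (@le_trans _ _ (2 * `|t| * (nrm (B k) * `|M|) * d)).
    rewrite -[X in _ <= X]mulrA ler_wpM2l ?mulr_ge0// (le_trans cs)//.
    by rewrite ler_wpM2l ?mulr_ge0 ?nrm_ge0// ltW.
  rewrite /d mulrCA -[X in _ <= X]mulr1 ler_pM2l ?divr_gt0//.
  by rewrite ler_pdivrMr// mul1r lerDl.
move: h1 h2 q NP2; rewrite /D.
move: (complex.Re (dot (B k) (B (f n - x)))) (complex.Re (dot (B k) (B x))) => X Y.
move: (nsq _) (nsq _) (complex.Re _) (complex.Re _) => u1 u2 u3 u4.
by move: n.+1%:R^-1 (j) => v j'; lra.
Qed.

(** Riesz' theorem for the form [<B k, B x>] finds the projection of [y] on the range of [B] as a
    vector [B x]. The difference [y - B x] is orthogonal to the range, hence zero. *)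
Lemma bounded_below_surj :
  (forall y, (forall x, dot (B x) y = 0) -> y = 0) -> forall y, exists x, B x = y.
Proof.
move=> dense y.
have [x xP] := @riesz (fun k => dot (B k) y) (M * nrm y) ltac:(by move=> a u v;
  rewrite /= linB (dotDl H)) ltac:(by move=> u; rewrite /= mulrAC;
  apply: (le_trans (cauchy_schwarz _ _)); rewrite ler_wpM2r ?nrm_ge0).
exists x; apply/eqP; rewrite eq_sym -subr_eq0; apply/eqP; apply: dense => k.
by rewrite dotBr xP subrr.
Qed.

(** Already [S] composed with [B] is onto: solving [<k, y> = <B k, B x>] for [x] means
    [y = S (B x)]. *)
Lemma adjoint_surj (S : V -> V) :
  (forall x y, dot (B x) y = dot x (S y)) -> forall y, exists x, S x = y.
Proof.
move=> adj y.
have [x xP] := @riesz (fun k => dot k y) (nrm y) ltac:(by move=> a u v;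
  rewrite /= (dotDl H)) ltac:(by move=> u; rewrite /= mulrC; exact: cauchy_schwarz).
exists (B x); apply: dot_ext => k; by rewrite -adj xP.
Qed.

Lemma invertible_of_surj : (forall y, exists x, B x = y) -> invertible_op dot B.
Proof.
move=> /choice[S SP].
have inj x y : B x = B y -> x = y.
  move=> e; apply/eqP; rewrite -subr_eq0; apply/eqP; apply: nrm_eq0.
  have := lbB (x - y); rewrite linear_opD linear_opN e subrr.
  have -> : nrm 0 = 0 by rewrite /hnorm dot0l sqrtr0.
  rewrite pmulr_rle0// => h; apply/eqP; by rewrite eq_le h nrm_ge0.
exists S; split.
- split; first by move=> a x y; apply: inj; rewrite linB !SP.
  exists c^-1 => x; rewrite ler_pdivlMl//; apply: le_trans (lbB _) _.
  by rewrite SP.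
- by move=> x; apply: inj; rewrite SP.
- exact: SP.
Qed.

End Riesz.

Lemma invertible_bounded_below (B : V -> V) : invertible_op dot B ->
  exists2 c : R, 0 < c & forall x, c * nrm x <= nrm (B x).
Proof.
move=> [S [[_ [M MP]] BS _]].
have M0 : 0 < `|M| + 1 by rewrite ltr_wpDl.
exists (`|M| + 1)^-1; first by rewrite invr_gt0.
move=> x; rewrite ler_pdivrMl// -{1}[x]BS; apply: (le_trans (MP _)).
rewrite ler_wpM2r ?nrm_ge0//.
by apply: (le_trans (ler_norm _)); rewrite lerDl.
Qed.

End Hilbert.

(** * The Bergman space *)

Section DiskIntegral.
Variable R : realType.
Local Notation C := R[i].
Local Notation mR := (measurableTypeR R).
Local Notation D2 := (@disk2 R).
Local Notation mu2 := (@lebesgue_measure R \x @lebesgue_measure R)%E.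
Local Notation area := (@area R).
Implicit Types (f g h F G : C -> C) (z w a : C).

Definition dint_ok F :=
  area.-integrable D2 (fun p => (complex.Re (F (cplx p)))%:E) /\
  area.-integrable D2 (fun p => (complex.Im (F (cplx p)))%:E).

Lemma dintD F G : dint_ok F -> dint_ok G ->
  disk_integral (fun z => F z + G z) = disk_integral F + disk_integral G.
Proof.
move=> [F1 F2] [G1 G2]; rewrite /disk_integral.
under eq_Rintegral do rewrite cReD.
under [X in (_ +i* X)%C]eq_Rintegral do rewrite cImD.
by rewrite !RintegralD//; exact: measurable_disk2.
Qed.

Lemma dintZ a F : dint_ok F ->
  disk_integral (fun z => a * F z) = a * disk_integral F.
Proof.
move=> [F1 F2]; rewrite /disk_integral.
have mD := @measurable_disk2 R.
have iZ (k : R) (f : mR * mR -> R) : area.-integrable D2 (EFin \o f) ->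
    area.-integrable D2 (EFin \o (fun t => k * f t)).
  move=> fi; rewrite (_ : _ \o _ = (fun t => k%:E * (EFin \o f) t)%E); last first.
    by apply/funext => t /=; rewrite EFinM.
  exact: integrableZl.
apply: complex_eq; rewrite ?cReM ?cImM /=.
  under eq_Rintegral do rewrite cReM.
  by rewrite RintegralB ?RintegralZl//; exact: iZ.
under eq_Rintegral do rewrite cImM.
by rewrite RintegralD ?RintegralZl//; exact: iZ.
Qed.

Lemma eq_dint F G : (forall z, unit_disk z -> F z = G z) ->
  disk_integral F = disk_integral G.
Proof.
move=> FG; rewrite /disk_integral; congr (_ +i* _)%C;
  by apply: eq_Rintegral => p /set_mem Dp; rewrite FG.
Qed.

Lemma measurable_normc2 f :
  measurable_fun D2 (fun p => complex.Re (f (cplx p))) ->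
  measurable_fun D2 (fun p => complex.Im (f (cplx p))) ->
  measurable_fun D2 (fun p => (nc (f (cplx p)) ^+ 2)%:E).
Proof.
move=> h1 h2; apply/measurable_EFinP; under eq_fun do rewrite normc_sqr.
by apply: measurable_funD; exact: measurable_funX.
Qed.

Lemma L2_integrable f : L2_disk f ->
  area.-integrable D2 (fun p => (nc (f (cplx p)) ^+ 2)%:E).
Proof.
move=> [m1 m2 fi]; apply/integrableP; split; first exact: measurable_normc2.
by under eq_integral do rewrite gee0_abs ?lee_fin ?sqr_ge0//.
Qed.

Lemma measurable_mulconj f g : L2_disk f -> L2_disk g ->
  measurable_fun D2 (fun p => (complex.Re (f (cplx p) * (g (cplx p))^*))%:E) /\
  measurable_fun D2 (fun p => (complex.Im (f (cplx p) * (g (cplx p))^*))%:E).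
Proof.
move=> [f1 f2 _] [g1 g2 _]; split; apply/measurable_EFinP.
  under eq_fun do rewrite cReM cRe_conj cIm_conj mulrN opprK.
  by apply: measurable_funD; exact: measurable_funM.
under eq_fun do rewrite cImM cRe_conj cIm_conj mulrN.
rewrite (_ : (fun x => _) = (fun p => complex.Im (f (cplx p)) * complex.Re (g (cplx p))
   - complex.Re (f (cplx p)) * complex.Im (g (cplx p)))); last first.
  by apply/funext => p; rewrite addrC.
by apply: measurable_funB; exact: measurable_funM.
Qed.

Lemma normc_mulconj_le z w : nc (z * w^*) <= nc z ^+ 2 + nc w ^+ 2.
Proof.
rewrite normcM normc_conj.
have := sqr_ge0 (nc z - nc w); have := sqr_ge0 (nc z); have := sqr_ge0 (nc w).
rewrite sqrrB; lra.
Qed.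

Lemma L2_dint_ok f g : L2_disk f -> L2_disk g -> dint_ok (fun z => f z * (g z)^*).
Proof.
move=> Lf Lg; have [m1 m2] := measurable_mulconj Lf Lg.
have mD := @measurable_disk2 R.
have iS : area.-integrable D2
    (fun p => ((nc (f (cplx p)) ^+ 2)%:E + (nc (g (cplx p)) ^+ 2)%:E))%E.
  by apply: integrableD => //; exact: L2_integrable.
split; apply: (le_integrable mD) iS => // p _; rewrite -EFinD !abse_EFin lee_fin;
  rewrite [leRHS]ger0_norm ?addr_ge0 ?sqr_ge0//; apply: le_trans (normc_mulconj_le _ _).
- exact: Re_le_normc.
- exact: Im_le_normc.
Qed.

Lemma L2_dotDl a f g h : L2_disk f -> L2_disk g -> L2_disk h ->
  L2_dot (a *: f + g) h = a * L2_dot f h + L2_dot g h.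
Proof.
move=> Lf Lg Lh; rewrite /L2_dot.
have ok1 := L2_dint_ok Lf Lh; have ok2 := L2_dint_ok Lg Lh.
have ok3 : dint_ok (fun z => a * (f z * (h z)^*)).
  have L0 : L2_disk (0 : C -> C) by have [] := bergman_submod_closed R; rewrite inE => -[].
  have := L2_dint_ok (L2_disk_lin a Lf L0) Lh; rewrite addr0.
  rewrite (_ : (fun z => (a *: f) z * (h z)^*) = (fun z => a * (f z * (h z)^*)))//.
  by apply/funext => z; rewrite mulrA.
rewrite -(dintZ a ok1) -(dintD ok3 ok2); apply: eq_dint => z _.
by rewrite -[(a *: f + g) z]/(a * f z + g z) mulrDl mulrA.
Qed.

Lemma L2_dotC f g : L2_disk f -> L2_disk g -> L2_dot g f = (L2_dot f g)^*.
Proof.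
move=> Lf Lg; have [i1 i2] := L2_dint_ok Lf Lg.
apply: complex_eq; rewrite ?cRe_conj ?cIm_conj /=; last first.
  rewrite -mulN1r -RintegralZl//; last exact: measurable_disk2.
  apply: eq_Rintegral => p _.
  by rewrite !cImM !cRe_conj !cIm_conj; ring.
by apply: eq_Rintegral => p _; rewrite !cReM !cRe_conj !cIm_conj; ring.
Qed.

Lemma L2_sqE f : L2_disk f ->
  (complex.Re (L2_dot f f))%:E = (\int[area]_(p in D2) (nc (f (cplx p)) ^+ 2)%:E)%E.
Proof.
move=> Lf; rewrite -[RHS]fineK; last first.
  by apply: integrable_fin_num; [exact: measurable_disk2|exact: L2_integrable].
rewrite /L2_dot /disk_integral /= /Rintegral; congr ((fine _)%:E).
apply: eq_integral => p _.
by rewrite cReM cRe_conj cIm_conj normc_sqr; congr (_%:E); ring.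
Qed.

Lemma L2_sq_ge0 f : L2_disk f -> 0 <= complex.Re (L2_dot f f).
Proof.
by move=> Lf; rewrite -lee_fin L2_sqE// integral_ge0// => p _; rewrite lee_fin sqr_ge0.
Qed.

(** A substitute for Cauchy-Schwarz on all of L2, where functions vanishing almost everywhere
    prevent [dot_eq0]. The additive form is enough, since a linear functional can be tested on unit
    vectors. *)
Lemma L2_dot_bound f g : L2_disk f -> L2_disk g ->
  nc (L2_dot f g) <= 2 * (complex.Re (L2_dot f f) + complex.Re (L2_dot g g)).
Proof.
move=> Lf Lg; have [i1 i2] := L2_dint_ok Lf Lg.
have mD := @measurable_disk2 R.
have iS : area.-integrable D2
    (EFin \o (fun p => (nc (f (cplx p)) ^+ 2) + (nc (g (cplx p)) ^+ 2))).
  by rewrite (_ : _ \o _ = ((fun p => (nc (f (cplx p)) ^+ 2)%:E) \+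
     (fun p => (nc (g (cplx p)) ^+ 2)%:E))%E)//; apply: integrableD => //;
    exact: L2_integrable.
have E : \int[area]_(p in D2) ((nc (f (cplx p)) ^+ 2) + (nc (g (cplx p)) ^+ 2)) =
   complex.Re (L2_dot f f) + complex.Re (L2_dot g g).
  rewrite RintegralD//; [|exact: L2_integrable|exact: L2_integrable].
  by congr (_ + _); apply: EFin_inj; rewrite L2_sqE// /Rintegral fineK//;
    apply: integrable_fin_num => //; exact: L2_integrable.
rewrite -E mulrDl mul1r.
rewrite {1}/L2_dot /disk_integral; apply: (le_trans (normc_le_ReIm _ _)).
apply: lerD; apply: le_trans (le_normr_Rintegral _ _) _ => //;
  apply: le_Rintegral => //.
- exact: integrable_norm i1.
- by move=> p _; apply: le_trans (normc_mulconj_le _ _); exact: Re_le_normc.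
- exact: integrable_norm i2.
- by move=> p _; apply: le_trans (normc_mulconj_le _ _); exact: Im_le_normc.
Qed.

Lemma L2_disk_mul f g (M : R) : (forall z, unit_disk z -> nc (g z) <= M) ->
  measurable_fun D2 (fun p => complex.Re (g (cplx p))) ->
  measurable_fun D2 (fun p => complex.Im (g (cplx p))) ->
  L2_disk f -> L2_disk (fun z => g z * f z) /\
   complex.Re (L2_dot (fun z => g z * f z) (fun z => g z * f z)) <=
     M ^+ 2 * complex.Re (L2_dot f f).
Proof.
move=> gM g1 g2 Lf; have [f1 f2 fi] := Lf; have mD := @measurable_disk2 R.
have m1 : measurable_fun D2 (fun p => complex.Re (g (cplx p) * f (cplx p))).
  under eq_fun do rewrite cReM.
  by apply: measurable_funB; exact: measurable_funM.
have m2 : measurable_fun D2 (fun p => complex.Im (g (cplx p) * f (cplx p))).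
  under eq_fun do rewrite cImM.
  by apply: measurable_funD; exact: measurable_funM.
have le : (\int[area]_(p in D2) (nc (g (cplx p) * f (cplx p)) ^+ 2)%:E <=
   (M ^+ 2)%:E * \int[area]_(p in D2) (nc (f (cplx p)) ^+ 2)%:E)%E.
  rewrite -ge0_integralZl_EFin ?sqr_ge0//; [|by move=> p _; rewrite lee_fin sqr_ge0
    |exact: measurable_normc2].
  apply: ge0_le_integral => //.
  - by move=> p _; rewrite lee_fin sqr_ge0.
  - exact: (@measurable_normc2 (fun z => g z * f z)).
  - by apply: measurable_funeM; exact: measurable_normc2.
  move=> p Dp; rewrite -EFinM lee_fin normcM exprMn ler_wpM2r ?sqr_ge0//.
  by rewrite ler_pXn2r ?nnegrE ?normc_ge0 ?gM// (le_trans (normc_ge0 _) (gM _ Dp)).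
have L : L2_disk (fun z => g z * f z).
  split=> //; apply: (le_lt_trans le).
  by rewrite lte_mul_pinfty// lee_fin sqr_ge0.
by split=> //; rewrite -lee_fin EFinM !L2_sqE.
Qed.

Lemma measurable_cplx_Re (X : set (mR * mR)) :
  measurable_fun X (fun p => complex.Re (cplx p)).
Proof. by apply: measurable_funTS; exact: measurable_fst. Qed.
Lemma measurable_cplx_Im (X : set (mR * mR)) :
  measurable_fun X (fun p => complex.Im (cplx p)).
Proof. by apply: measurable_funTS; exact: measurable_snd. Qed.

Lemma area_scale (F : mR * mR -> \bar R) : measurable_fun D2 F ->
  (forall p, D2 p -> (0 <= F p)%E) ->
  (\int[area]_(p in D2) F p = (pi^-1)%:E * \int[mu2]_(p in D2) F p)%E.
Proof.
move=> mF F0; rewrite /area ge0_integral_mscale//; exact: measurable_disk2.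
Qed.

(** Only finiteness is needed, and the square [[-1, 1]^2] provides it. *)
Lemma area_disk_fin : (area D2 < +oo)%E.
Proof.
rewrite /Defs.area /mscale /= lte_mul_pinfty ?lee_fin ?invr_ge0 ?pi_ge0//.
have mI : measurable (`[(-1 : R), 1]%classic : set mR) by exact: measurable_itv.
apply: (@le_lt_trans _ _ (mu2 (`[(-1 : R), 1]%classic `*` `[(-1 : R), 1]%classic))).
  apply: le_measure; rewrite ?inE; [exact: measurable_disk2|exact: measurableX|].
  move=> p; rewrite /disk2 /= unit_diskE => pD; split; rewrite /= in_itv /=.
    by have := le_lt_trans (Re_le_normc _) pD; rewrite ltr_norml /= => /andP[/ltW -> /ltW].
  by have := le_lt_trans (Im_le_normc _) pD; rewrite ltr_norml /= => /andP[/ltW -> /ltW].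
have lI : (@lebesgue_measure R (`[(-1 : R), 1]%classic)%R < +oo)%E.
  by rewrite lebesgue_measure_itv /= lte_fin; case: ifP => _; rewrite ?ltry// -EFinD ltry.
rewrite product_measure1E//; apply: lte_mul_pinfty => //.
by rewrite ge0_fin_numE.
Qed.

Lemma L2_bounded f (M : R) : (forall z, unit_disk z -> nc (f z) <= M) ->
  measurable_fun D2 (fun p => complex.Re (f (cplx p))) ->
  measurable_fun D2 (fun p => complex.Im (f (cplx p))) -> L2_disk f.
Proof.
move=> fM m1 m2; split=> //; have mD := @measurable_disk2 R.
apply: (@le_lt_trans _ _ (\int[area]_(p in D2) (M ^+ 2)%:E)%E).
  apply: ge0_le_integral => //.
  - by move=> p _; rewrite lee_fin sqr_ge0.
  - exact: measurable_normc2.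
  move=> p Dp; rewrite lee_fin ler_pXn2r ?nnegrE ?normc_ge0 ?fM//.
  by rewrite (le_trans (normc_ge0 _) (fM _ Dp)).
by rewrite integral_cst// lte_mul_pinfty ?lee_fin ?sqr_ge0//; exact: area_disk_fin.
Qed.

End DiskIntegral.

(** * Local bounds for analytic functions and locally uniform limits *)

Section Bergman.
Variable R : realType.
Local Notation C := R[i].
Local Notation mR := (measurableTypeR R).
Local Notation D2 := (@disk2 R).
Local Notation mu2 := (@lebesgue_measure R \x @lebesgue_measure R)%E.
Local Notation area := (@area R).
Implicit Types (f g h F G : C -> C) (z w a : C).
Local Notation dot := (@bergman_dot R).
Local Notation nrm := (hnorm dot).

Definition square w (rho : R) : C -> Prop :=
  rect (complex.Re w - rho) (complex.Re w + rho) (complex.Im w - rho) (complex.Im w + rho).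

Definition L2sq f : R := complex.Re (L2_dot f f).

Definition mulsub w f : C -> C := fun z => (z - w) * f z.

Lemma mulsub_L2 w f : L2_disk f ->
  L2_disk (mulsub w f) /\ L2sq (mulsub w f) <= (1 + nc w) ^+ 2 * L2sq f.
Proof.
move=> Lf.
apply: (@L2_disk_mul _ f (fun z => z - w) (1 + nc w)) => //.
- move=> z; rewrite unit_diskE => z1; have := normc_triangleB z w; lra.
- under eq_fun do rewrite cReB.
  by apply: measurable_funB => //; exact: measurable_cplx_Re.
- under eq_fun do rewrite cImB.
  by apply: measurable_funB => //; exact: measurable_cplx_Im.
Qed.

(** Only [(z - w) f] is assumed square integrable, not [f], so that quotients by [z - w] are
    covered. The pointwise bound yields bounded evaluations; the last bound says that multiplication
    by [z - w] is bounded below. *)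
Lemma point_bound w : unit_disk w -> exists rho c : R,
  [/\ 0 < rho, 0 <= c, (forall z, square w rho z -> unit_disk z) &
   forall f, analytic_disk f ->
     measurable_fun D2 (fun p => complex.Re (f (cplx p))) ->
     measurable_fun D2 (fun p => complex.Im (f (cplx p))) ->
     L2_disk (mulsub w f) ->
     [/\ L2_disk f,
         (forall z, square w rho z -> nc (f z) ^+ 2 <= c * L2sq (mulsub w f)) &
         L2sq f <= c * L2sq (mulsub w f)]].
Proof.
move=> Dw; have := Dw; rewrite unit_diskE => w1.
(* This makes [6 * rho] half the distance from [w] to the circle. *)
pose rho := (1 - nc w) / 12.
have r0 : 0 < rho by rewrite divr_gt0 ?subr_gt0.
have wr : nc w + 6 * rho < 1.
  have -> : 6 * rho = (1 - nc w) / 2 by rewrite /rho; field.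
  by rewrite -ltrBrDl ltr_pdivrMr// ltr_pMr ?subr_gt0// ltr1n.
pose A := fine (area D2).
have AE : area D2 = A%:E.
  by rewrite fineK// ge0_fin_numE//; exact: area_disk_fin.
have A0 : 0 <= A by rewrite fine_ge0.
pose c1 := 72 / rho ^+ 4 * pi.
have c10 : 0 <= c1.
  by rewrite mulr_ge0 ?pi_ge0// divr_ge0// exprn_ge0// ltW.
pose c2 := c1 * A + (rho ^+ 2)^-1.
have ir0 : 0 <= (rho ^+ 2)^-1 by rewrite invr_ge0 sqr_ge0.
have c20 : 0 <= c2 by exact: addr_ge0 (mulr_ge0 c10 A0) ir0.
exists rho, (c1 + c2); split => //; first by rewrite addr_ge0.
  move=> z [/andP[h1 h2] /andP[h3 h4]]; apply: (square_in_disk wr).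
  by split; apply/andP; split; lra.
move=> f af f1 f2 Lm.
set r := L2sq (mulsub w f).
have r_ge0 : 0 <= r by exact: L2_sq_ge0.
have mD := @measurable_disk2 R.
have sqE p : nc (mulsub w f (cplx p)) ^+ 2 = wsq w f p.
  by rewrite /mulsub normcM exprMn.
have rE : (r%:E = \int[area]_(p in D2) (wsq w f p)%:E)%E.
  by rewrite L2_sqE//; apply: eq_integral => p _; rewrite sqE.
have mw : measurable_fun D2 (fun p => (wsq w f p)%:E) by exact: measurable_wsq.
have b1 z : square w rho z -> nc (f z) ^+ 2 <= c1 * r.
  move=> sz.
  have I : (\int[mu2]_(p in D2) (wsq w f p)%:E = (pi * r)%:E)%E.
    rewrite EFinM rE area_scale//; last by move=> p _; rewrite lee_fin wsq_ge0.
    by rewrite muleA -EFinM divff ?gt_eqF ?pi_gt0// mul1e.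
  rewrite /c1 -mulrA; set c := 72 / rho ^+ 4.
  have c0 : 0 < c by rewrite divr_gt0// exprn_gt0.
  rewrite -ler_pdivrMl//; apply/ler_addgt0Pr => e e0.
  rewrite ler_pdivrMl//; apply: (weighted_point_bound r0 wr) sz => //.
  by rewrite I lte_fin ltrDl.
suff b2 : (\int[area]_(p in D2) (nc (f (cplx p)) ^+ 2)%:E <= (c2 * r)%:E)%E.
  have Lf : L2_disk f by split=> //; apply: le_lt_trans b2 _; exact: ltry.
  split=> //; first by move=> z /b1 /le_trans; apply; rewrite ler_wpM2r// lerDl.
  apply: (@le_trans _ _ (c2 * r)); last by rewrite ler_wpM2r// lerDr.
  by rewrite -lee_fin L2_sqE.
apply: (@le_trans _ _ (\int[area]_(p in D2)
   ((c1 * r)%:E + ((rho ^+ 2)^-1)%:E * (wsq w f p)%:E))%E).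
  apply: ge0_le_integral => //.
  - by move=> p _; rewrite lee_fin sqr_ge0.
  - exact: measurable_normc2.
  - by apply: emeasurable_funD => //; exact: measurable_funeM.
  move=> p Dp; rewrite -EFinM -EFinD lee_fin.
  have [sp|sp] := pselect (square w rho (cplx p)).
    by rewrite (le_trans (b1 _ sp))// lerDl mulr_ge0 ?wsq_ge0//.
  have pw : rho <= nc (cplx p - w).
    rewrite leNgt; apply/negP => h; apply: sp.
    have := le_lt_trans (Re_le_normc _) h; have := le_lt_trans (Im_le_normc _) h.
    rewrite cReB cImB !ltr_distl => /andP[/ltW i1 /ltW i2] /andP[/ltW i3 /ltW i4].
    by split; apply/andP.
  apply: (@le_trans _ _ ((rho ^+ 2)^-1 * wsq w f p)); last by rewrite lerDr mulr_ge0.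
  rewrite /wsq mulrA ler_peMl ?sqr_ge0// ler_pdivlMl ?exprn_gt0// mulr1.
  by rewrite ler_pXn2r ?nnegrE ?normc_ge0// ltW.
rewrite ge0_integralD//; first last.
- exact: measurable_funeM.
- by move=> p _; rewrite -EFinM lee_fin mulr_ge0 ?wsq_ge0//.
- by move=> p _; rewrite lee_fin mulr_ge0.
rewrite integral_cst// ge0_integralZl_EFin//; first last.
- by move=> p _; rewrite lee_fin wsq_ge0.
by rewrite -rE AE -!EFinM -EFinD lee_fin /c2; lra.
Qed.

Lemma bergmanP (k : bergman R) :
  [/\ analytic_disk k, L2_disk k & forall z, ~ unit_disk z -> k z = 0].
Proof. by case: k => f /=; rewrite inE. Qed.

Lemma bergman_L2 (k : bergman R) : L2_disk k. Proof. by case: (bergmanP k). Qed.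
Lemma bergman_analytic (k : bergman R) : analytic_disk k.
Proof. by case: (bergmanP k). Qed.

Lemma bergman_ext (k l : bergman R) : (forall z, unit_disk z -> k z = l z) -> k = l.
Proof.
move=> kl; apply: val_inj; apply/funext => z.
have [/kl//|nz] := pselect (unit_disk z).
have [_ _ k0] := bergmanP k; have [_ _ l0] := bergmanP l.
by transitivity (0 : C); [exact: k0|apply/esym; exact: l0].
Qed.

Lemma ccont_disk f z : analytic_disk f -> unit_disk z -> ccont f z.
Proof. by move=> af Dz; apply: cdiff_cont; exact: af. Qed.

Lemma unit_disk_near z : unit_disk z ->
  exists2 d : R, 0 < d & forall w, nc (w - z) < d -> unit_disk w.
Proof.
rewrite unit_diskE => z1; exists (1 - nc z); first by rewrite subr_gt0.
move=> w wz; rewrite unit_diskE -(subrK z w) (le_lt_trans (normc_triangle _ _))//.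
by rewrite -ltrBrDr.
Qed.

Lemma mk_bergman f : analytic_disk f -> L2_disk f ->
  exists k : bergman R, forall z, unit_disk z -> k z = f z.
Proof.
move=> af [f1 f2 f3]; pose g z := if nc z < 1 then f z else 0.
have gE z : unit_disk z -> g z = f z by rewrite unit_diskE /g => ->.
have kP : g \in @bergman_pred R.
  rewrite inE /=; split.
  - move=> z Dz; have [d d0 dP] := unit_disk_near Dz.
    by apply: (@cdiff_near _ f) (af z Dz); [exact: d0|move=> w /dP /gE].
  - split.
    + by apply: eq_measurable_fun f1 => p /set_mem Dp; rewrite gE.
    + by apply: eq_measurable_fun f2 => p /set_mem Dp; rewrite gE.
    + by under eq_integral => p /set_mem Dp do rewrite gE//.
  - by move=> z; rewrite unit_diskE /g => /negP/negbTE ->.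
by exists (Bergman kP).
Qed.

Lemma real_cauchy_cvg (u : nat -> R) :
  (forall e : R, 0 < e -> exists N, forall i j, (N <= i)%N -> (N <= j)%N ->
     `|u i - u j| < e) ->
  exists l, forall e : R, 0 < e -> exists N, forall i, (N <= i)%N -> `|u i - l| < e.
Proof.
move=> H; have /cauchy_cvgP/cvg_ex[l ul] : cauchy (u @ \oo).
  apply/cauchyP => e e0; have [N NP] := H e e0.
  exists (u N); exists N => // i /= Ni; rewrite /ball /= distrC.
  exact: NP.
exists l => e e0; have /cvgrPdist_lt/(_ e e0)[N _ NP] := ul.
by exists N => i Ni; rewrite distrC; exact: NP.
Qed.

Lemma complex_cauchy_cvg (u : nat -> C) :
  (forall e : R, 0 < e -> exists N, forall i j, (N <= i)%N -> (N <= j)%N ->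
     nc (u i - u j) < e) ->
  exists l, forall e : R, 0 < e -> exists N, forall i, (N <= i)%N -> nc (u i - l) < e.
Proof.
move=> H.
have [a aP] := @real_cauchy_cvg (fun n => complex.Re (u n)) ltac:(by move=> e e0;
  have [N NP] := H e e0; exists N => i j Ni Nj; apply: le_lt_trans (NP i j Ni Nj);
  exact: Re_lip).
have [b bP] := @real_cauchy_cvg (fun n => complex.Im (u n)) ltac:(by move=> e e0;
  have [N NP] := H e e0; exists N => i j Ni Nj; apply: le_lt_trans (NP i j Ni Nj);
  exact: Im_lip).
exists (a +i* b)%C => e e0.
have [N NP] := aP (e / 2) ltac:(by rewrite divr_gt0).
have [M MP] := bP (e / 2) ltac:(by rewrite divr_gt0).
exists (maxn N M) => i; rewrite geq_max => /andP[Ni Mi].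
have -> : u i - (a +i* b)%C = ((complex.Re (u i) - a) +i* (complex.Im (u i) - b))%C.
  by apply: complex_eq; rewrite ?cReB ?cImB.
apply: le_lt_trans (normc_le_ReIm _ _) _.
by rewrite [e]splitr ltrD// ?NP ?MP.
Qed.

(* Weierstrass' theorem, through the Cauchy formula on small squares. *)
Lemma locally_uniform_limit (u : nat -> C -> C) f :
  (forall n, analytic_disk (u n)) ->
  (forall w, unit_disk w -> exists2 rho : R, 0 < rho &
     forall e : R, 0 < e -> exists N, forall i z, (N <= i)%N -> square w rho z ->
       nc (u i z - f z) < e) ->
  analytic_disk f.
Proof.
move=> au lu.
have cf w : unit_disk w -> ccont f w.
  move=> Dw; have [rho r0 H] := lu w Dw; apply/ccontP => e e0.
  have [N NP] := H (e / 3) ltac:(by rewrite divr_gt0).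
  have [d d0 dP] := (ccontP _ _).1 (ccont_disk (au N) Dw) (e / 3) ltac:(by rewrite divr_gt0).
  exists (Num.min d rho); first by rewrite lt_min d0.
  move=> z; rewrite lt_min => /andP[zd zr].
  have sq t : nc (t - w) < rho -> square w rho t.
    move=> h; have := le_lt_trans (Re_le_normc _) h; have := le_lt_trans (Im_le_normc _) h.
    rewrite cReB cImB !ltr_distl => /andP[/ltW i1 /ltW i2] /andP[/ltW i3 /ltW i4].
    by split; apply/andP.
  have h1 := NP N z (leqnn _) (sq z zr).
  have h2 : nc (u N w - f w) < e / 3.
    by apply: NP => //; apply: sq; rewrite subrr Normc.normc0.
  have h3 := dP z zd; rewrite normcB in h1.
  have -> : f z - f w = (f z - u N z) + (u N z - u N w) + (u N w - f w) by ring.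
  have := normc_triangle (f z - u N z + (u N z - u N w)) (u N w - f w).
  have := normc_triangle (f z - u N z) (u N z - u N w).
  lra.
move=> w Dw; have [rho r0 H] := lu w Dw; have [d d0 dP] := unit_disk_near Dw.
pose s := Num.min (rho) (d / 3).
have s0 : 0 < s by rewrite lt_min r0 divr_gt0.
have sr : s <= rho by rewrite ge_min lexx.
have sd : s <= d / 3 by rewrite ge_min lexx orbT.
set x1 := complex.Re w - s; set x2 := complex.Re w + s.
set y1 := complex.Im w - s; set y2 := complex.Im w + s.
have sqw z : rect x1 x2 y1 y2 z -> square w rho z /\ unit_disk z.
  move=> [/andP[h1 h2] /andP[h3 h4]]; split.
    by split; apply/andP; split; rewrite /x1 /x2 /y1 /y2 in h1 h2 h3 h4; lra.
  apply: dP.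
  have -> : z - w = ((complex.Re z - complex.Re w) +i* (complex.Im z - complex.Im w))%C.
    by apply: complex_eq; rewrite ?cReB ?cImB.
  apply: le_lt_trans (normc_le_ReIm _ _) _.
  have : `|complex.Re z - complex.Re w| <= s by rewrite ler_distl; apply/andP.
  have : `|complex.Im z - complex.Im w| <= s by rewrite ler_distl; apply/andP.
  by move: s0 sd d0; clear; lra.
have Iw : inter x1 x2 y1 y2 w.
  by split; rewrite /x1 /x2 /y1 /y2 ltrBlDr ltrDl s0.
have [x12 y12] := inter_le Iw.
have bf : bcont x1 x2 y1 y2 f by move=> z [/sqw[_ Dz] _]; exact: cf.
apply: (cauchy_rep_cdiff bf) Iw => z Iz.
have b0 := bdist_gt0 Iz; set b := bdist _ _ _ _ z in b0.
have cinv := cauchy_kernel_cont Iz.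
have Rz : rect x1 x2 y1 y2 z.
  by case: Iz => /andP[/ltW ? /ltW ?] /andP[/ltW ? /ltW ?]; split; apply/andP.
apply/eqP; rewrite -subr_eq0 -normc0P eq_le normc_ge0 andbT.
pose K := nc (kappa x1 x2 y1 y2 z) + 4 * b^-1 * (x2 - x1 + (y2 - y1)).
apply: (@le0_small _ _ K 1) => // e e0 _.
have [N NP] := H e e0.
have cfr i : bcont x1 x2 y1 y2 (fun t => u i t / (t - z)).
  move=> t Bt; apply: ccontM; last exact: cinv.
  exact: (ccont_disk (au i) (sqw t Bt.1).2).
have cfz : bcont x1 x2 y1 y2 (fun t => f t / (t - z)).
  by move=> t Bt; apply: ccontM; [exact: bf|exact: cinv].
have CF := cauchy_formula Iz (fun t Rt => au N t (sqw t Rt).2).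
rewrite -/(kappa _ _ _ _ _) in CF.
have -> : kappa x1 x2 y1 y2 z * f z - bint x1 x2 y1 y2 (fun t => f t / (t - z)) =
   (bint x1 x2 y1 y2 (fun t => u N t / (t - z) - f t / (t - z)))
   - kappa x1 x2 y1 y2 z * (u N z - f z).
  by rewrite (bintB x12 y12 (cfr N) cfz) -CF; ring.
apply: (le_trans (normc_triangleB _ _)).
rewrite normcM /K mulrDl addrC lerD//.
  by rewrite ler_wpM2l ?normc_ge0// ltW// NP//; exact: (sqw _ Rz).1.
have -> : 4 * b^-1 * (x2 - x1 + (y2 - y1)) * e = 4 * (e / b) * (x2 - x1 + (y2 - y1)).
  by ring.
apply: (bint_bound x12 y12).
  by move=> t Bt; apply: ccontB; [exact: cfr|exact: cfz].
move=> t Bt; rewrite -mulrBl normcM normcV ler_pM ?normc_ge0 ?invr_ge0 ?normc_ge0//.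
  by rewrite ltW// NP//; exact: (sqw _ Bt.1).1.
have bt : b <= nc (t - z) by exact: bdist_le Bt.
by rewrite lef_pV2 ?posrE// (lt_le_trans b0).
Qed.

End Bergman.

Section BergmanHilbert.
Variable R : realType.
Local Notation C := R[i].
Local Notation D2 := (@disk2 R).
Local Notation area := (@area R).
Implicit Types (f g h F G : C -> C) (z w a : C) (k : bergman R).
Local Notation dot := (@bergman_dot R).
Local Notation nrm := (hnorm dot).

Lemma nrm_L2sq k : nrm k ^+ 2 = L2sq k.
Proof. by rewrite sqr_sqrtr// L2_sq_ge0//; exact: bergman_L2. Qed.

Lemma bergman_nrm_ge0 k : 0 <= nrm k. Proof. exact: sqrtr_ge0. Qed.

Lemma eval_bound w : unit_disk w -> exists rho c : R,
  [/\ 0 < rho, 0 <= c & forall k z, square w rho z -> nc (k z) <= c * nrm k].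
Proof.
move=> Dw; have [rho [c [r0 c0 _ H]]] := point_bound Dw.
pose M := c * (1 + nc w) ^+ 2.
have M0 : 0 <= M by rewrite mulr_ge0 ?sqr_ge0.
exists rho, (Num.sqrt M); split=> // k z sz.
have [k1 k2 _] := bergman_L2 k; have [L h2] := mulsub_L2 w (bergman_L2 k).
have [_ /(_ z sz) h1 _] := H k (@bergman_analytic R k) k1 k2 L.
rewrite -(@ler_pXn2r _ 2) ?nnegrE ?normc_ge0 ?mulr_ge0 ?sqrtr_ge0 ?bergman_nrm_ge0//.
rewrite exprMn sqr_sqrtr// nrm_L2sq -mulrA.
by apply: (le_trans h1); rewrite ler_wpM2l.
Qed.

Lemma square_center w rho : 0 <= rho -> square w rho w.
Proof. by move=> r0; split; rewrite lerBlDr lerDl r0. Qed.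

Lemma bergman_complete (u : nat -> bergman R) :
    (forall e : R, 0 < e -> exists N, forall i j, (N <= i)%N -> (N <= j)%N ->
       nrm (u i - u j) < e) ->
    exists l, forall e : R, 0 < e -> exists N, forall i, (N <= i)%N ->
       nrm (u i - l) < e.
Proof.
move=> cu.
have ucauchy w : unit_disk w -> exists2 rho : R, 0 < rho &
    forall e : R, 0 < e -> exists N, forall i j z, (N <= i)%N -> (N <= j)%N ->
      square w rho z -> nc (u i z - u j z) < e.
  move=> Dw; have [rho [c [r0 c0 H]]] := eval_bound Dw; exists rho => // e e0.
  have c1 : 0 < c + 1 by rewrite ltr_wpDl.
  have [N NP] := cu (e / (c + 1)) ltac:(by rewrite divr_gt0).
  exists N => i j z Ni Nj sz.
  apply: (le_lt_trans (H (u i - u j) z sz)).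
  apply: (@le_lt_trans _ _ ((c + 1) * nrm (u i - u j))).
    by rewrite ler_wpM2r ?bergman_nrm_ge0// lerDl.
  by rewrite mulrC -ltr_pdivlMr//; exact: NP.
have /choice[f fP] : forall z, exists l, unit_disk z -> forall e : R, 0 < e ->
    exists N, forall i, (N <= i)%N -> nc (u i z - l) < e.
  move=> z; have [Dz|?] := pselect (unit_disk z); last by exists 0.
  have [rho r0 H] := ucauchy z Dz.
  have [|l lP] := @complex_cauchy_cvg _ (fun n => u n z).
    move=> e e0; have [N NP] := H e e0; exists N => i j Ni Nj.
    by apply: NP => //; apply: square_center; exact: ltW.
  by exists l.
have af : analytic_disk f.
  apply: (@locally_uniform_limit _ (fun n => u n : C -> C)).
    by move=> n; exact: bergman_analytic.
  move=> w Dw; have [rho r0 H] := ucauchy w Dw.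
  have [d d0 dP] := unit_disk_near Dw.
  exists (Num.min rho (d / 3)); first by rewrite lt_min r0 divr_gt0.
  move=> e e0; have [N NP] := H (e / 2) ltac:(by rewrite divr_gt0).
  exists N => i z Ni [/andP[s1 s2] /andP[s3 s4]].
  have sr : Num.min rho (d / 3) <= rho by rewrite ge_min lexx.
  have sd : Num.min rho (d / 3) <= d / 3 by rewrite ge_min lexx orbT.
  have sz : square w rho z by split; apply/andP; split; lra.
  have Dz : unit_disk z.
    apply: dP.
    have -> : z - w = ((complex.Re z - complex.Re w) +i* (complex.Im z - complex.Im w))%C.
      by apply: complex_eq; rewrite ?cReB ?cImB.
    apply: le_lt_trans (normc_le_ReIm _ _) _.
    have : `|complex.Re z - complex.Re w| <= d / 3 by rewrite ler_distl; apply/andP; split; lra.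
    have : `|complex.Im z - complex.Im w| <= d / 3 by rewrite ler_distl; apply/andP; split; lra.
    by move: d0; clear; lra.
  have [M MP] := fP z Dz (e / 2) ltac:(by rewrite divr_gt0).
  apply: le_lt_trans (normc_dist_triangle _ (u (maxn N M) z) _) _.
  by rewrite [e]splitr ltrD// ?NP ?MP ?leq_maxl ?leq_maxr.
have cvR p : D2 p -> forall e : R, 0 < e -> exists N, forall i, (N <= i)%N ->
    nc (u i (cplx p) - f (cplx p)) < e by exact: fP.
have mf1 : measurable_fun D2 (fun p => complex.Re (f (cplx p))).
  apply: (@measurable_fun_cvg _ _ _ _ (fun n p => complex.Re (u n (cplx p)))).
    by move=> n; case: (bergman_L2 (u n)).
  move=> p Dp; apply/(@cvgrPdist_lt R R^o) => e e0.
  have [N NP] := cvR p Dp e e0; exists N => // i /= Ni.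
  by rewrite distrC; apply: le_lt_trans (Re_lip _ _) _; exact: NP.
have mf2 : measurable_fun D2 (fun p => complex.Im (f (cplx p))).
  apply: (@measurable_fun_cvg _ _ _ _ (fun n p => complex.Im (u n (cplx p)))).
    by move=> n; case: (bergman_L2 (u n)).
  move=> p Dp; apply/(@cvgrPdist_lt R R^o) => e e0.
  have [N NP] := cvR p Dp e e0; exists N => // i /= Ni.
  by rewrite distrC; apply: le_lt_trans (Im_lip _ _) _; exact: NP.
have key (e : R) : 0 < e -> exists N, forall i, (N <= i)%N ->
    (\int[area]_(p in D2) (nc (u i (cplx p) - f (cplx p)) ^+ 2)%:E <= (e ^+ 2)%:E)%E.
  move=> e0; have [N NP] := cu e e0; exists N => i Ni.
  pose F n p : \bar R := (nc ((u i - u (N + n)%N : bergman R) (cplx p)) ^+ 2)%:E.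
  have FE p : D2 p -> limn_einf (F^~ p) = (nc (u i (cplx p) - f (cplx p)) ^+ 2)%:E.
    move=> Dp; apply: (cvg_limn_einf_sup _).1.
    apply: cvg_EFin; first exact: nearW.
    pose G n := nc (u i (cplx p) - u (N + n)%N (cplx p)).
    suff cG : G @ \oo --> nc (u i (cplx p) - f (cplx p)).
      rewrite (_ : _ \o _ = (fun n => G n * G n)).
        by rewrite expr2; apply: cvgM.
      by apply/funext => n /=; rewrite expr2.
    apply/(@cvgrPdist_lt R R^o) => d d0; have [M MP] := cvR p Dp d d0.
    exists M => // j /= Mj.
    apply: le_lt_trans (normc_lip _ _) _.
    have -> : u i (cplx p) - f (cplx p) - (u i (cplx p) - u (N + j)%N (cplx p)) =
       u (N + j)%N (cplx p) - f (cplx p) by ring.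
    by apply: MP; rewrite (leq_trans Mj)// leq_addl.
  have mD := @measurable_disk2 R.
  apply: (@le_trans _ _ (\int[area]_(p in D2) limn_einf (F^~ p))%E).
    rewrite le_eqVlt; apply/orP; left; apply/eqP; apply: eq_integral => p /set_mem Dp.
    by rewrite FE.
  have mF n : measurable_fun D2 (F n).
    by have [h1 h2 _] := bergman_L2 (u i - u (N + n)%N); exact: measurable_normc2.
  have F0 n p : D2 p -> (0 <= F n p)%E by move=> _; rewrite lee_fin sqr_ge0.
  apply: (le_trans (fatou area mD mF F0)).
  rewrite limn_einf_lim; apply: lime_le; first exact: is_cvg_einfs.
  apply: nearW => n; apply: (@le_trans _ _ (\int[area]_(p in D2) F n p)%E).
    by apply: ereal_inf_lbound; exists n => //=.
  rewrite -L2_sqE; last exact: bergman_L2.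
  rewrite lee_fin -/(L2sq _) -nrm_L2sq ler_pXn2r ?nnegrE ?bergman_nrm_ge0 ?ltW//.
  by rewrite NP// leq_addr.
have subm i : measurable_fun D2 (fun p => complex.Re (u i (cplx p) - f (cplx p))) /\
   measurable_fun D2 (fun p => complex.Im (u i (cplx p) - f (cplx p))).
  have [h1 h2 _] := bergman_L2 (u i).
  split; [under eq_fun do rewrite cReB|under eq_fun do rewrite cImB];
    exact: measurable_funB.
have Lf : L2_disk f.
  have [N NP] := key 1 ltr01.
  have LN : L2_disk (bergman_fun (u N) - f).
    by split; [exact: (subm N).1|exact: (subm N).2|
      apply: (le_lt_trans (NP N (leqnn _))); rewrite ltry].
  rewrite (_ : f = (-1) *: (bergman_fun (u N) - f) + bergman_fun (u N)); last first.
    by rewrite scaleN1r opprB subrK.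
  apply: L2_disk_lin => //; exact: bergman_L2.
have [l lE] := mk_bergman af Lf.
exists l => e e0; have [N NP] := key (e / 2) ltac:(by rewrite divr_gt0).
exists N => i /NP; set I := (X in (X <= _)%E) => h.
have : nrm (u i - l) ^+ 2 <= (e / 2) ^+ 2.
  rewrite nrm_L2sq -lee_fin L2_sqE; last exact: bergman_L2.
  apply: le_trans h; rewrite /I le_eqVlt; apply/orP; left; apply/eqP.
  apply: eq_integral => p /set_mem Dp.
  by rewrite -[(u i - l : bergman R) (cplx p)]/(u i (cplx p) - l (cplx p)) lE.
rewrite ler_pXn2r ?nnegrE ?bergman_nrm_ge0 ?divr_ge0 ?(ltW e0)// => /le_lt_trans; apply.
by rewrite ltr_pdivrMr// ltr_pMr// ltr1n.
Qed.

Theorem bergman_hilbert : hilbert dot.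
Proof.
split.
- by move=> a x y z; apply: L2_dotDl; exact: bergman_L2.
- by move=> x y; apply: L2_dotC; exact: bergman_L2.
- by move=> x; apply: L2_sq_ge0; exact: bergman_L2.
- move=> k k0; apply: bergman_ext => z Dz.
  have [rho [c [r0 c0 H]]] := eval_bound Dz.
  have := H k z (square_center z (ltW r0)).
  have -> : nrm k = 0 by rewrite /hnorm k0 sqrtr0.
  rewrite mulr0 => h; apply/eqP; rewrite -normc0P eq_le h; exact: normc_ge0.
- exact: bergman_complete.
Qed.

End BergmanHilbert.

(** * Toeplitz operators *)

Section Toeplitz.
Variable R : realType.
Local Notation C := R[i].
Local Notation D2 := (@disk2 R).
Local Notation area := (@area R).
Implicit Types (f g h : C -> C) (z w a b lambda : C) (k x y : bergman R).
Local Notation dot := (@bergman_dot R).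
Local Notation nrm := (hnorm dot).
Let H := bergman_hilbert R.

Lemma dot_L2sq k : nsq dot k = L2sq k. Proof. by []. Qed.

Lemma id_linear : linear (id : bergman R -> bergman R). Proof. by []. Qed.

Lemma bergman_riesz (l : bergman R -> C) (L : R) :
  (forall a x y, l (a *: x + y) = a * l x + l y) ->
  (forall x, nc (l x) <= L * nrm x) -> exists x, forall k, l k = dot k x.
Proof.
move=> l1 l2.
by apply: (riesz H id_linear ltr01 (M := 1) _ _ l1 l2) => x; rewrite mul1r.
Qed.

Lemma L2_projection g : L2_disk g -> exists h : bergman R,
  forall k, L2_dot g k = dot h k.
Proof.
move=> Lg.
have lin a x y : L2_dot (a *: x + y : bergman R) g = a * L2_dot x g + L2_dot y g.
  by apply: L2_dotDl => //; exact: bergman_L2.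
have [|h hP] := @bergman_riesz (fun k => L2_dot k g) (2 * (1 + L2sq g)) lin.
  move=> x; have l0 : L2_dot (0 : bergman R) g = 0.
    by have := lin (-1) 0 0; rewrite scaleN1r addr0 oppr0 mulN1r addNr.
  have lZ a : L2_dot (a *: x : bergman R) g = a * L2_dot x g.
    by have := lin a x 0; rewrite addr0 l0 addr0.
  have [x0|x0] := eqVneq (nrm x) 0.
    by rewrite (nrm_eq0 H x0) l0 Normc.normc0 mulr_ge0// ?nrm_ge0// mulr_ge0// addr_ge0// L2_sq_ge0.
  have xp : 0 < nrm x by rewrite lt0r x0 nrm_ge0.
  have := L2_dot_bound (bergman_L2 ((nrm x)^-1%:C%C *: x)) Lg.
  rewrite lZ normcM normc_real -/(L2sq _) -/(L2sq g) -dot_L2sq (nsqZ H) normc_real.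
  rewrite ger0_norm ?invr_ge0 ?nrm_ge0// -(nrm_sqr H) -exprMn mulVf// expr1n.
  by rewrite ler_pdivrMl// mulrC.
exists h => k; rewrite (L2_dotC (bergman_L2 k) Lg) hP.
by rewrite -(dotC H).
Qed.

Lemma bergman_projP g k : L2_disk g -> L2_dot g k = dot (bergman_proj g) k.
Proof.
move=> Lg; have [h0 h0P] := L2_projection Lg.
have sub (h l : bergman R) : L2_dot (g - h) l = L2_dot g l - dot h l.
  rewrite (_ : (g - h : C -> C) = (-1) *: (h : C -> C) + g); last first.
    by rewrite scaleN1r addrC.
  rewrite L2_dotDl //; [|exact: bergman_L2|exact: bergman_L2].
  by rewrite mulN1r addrC.
rewrite /bergman_proj; case: xgetP => [h _ /= /(_ k)|/(_ h0)/=].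
  by rewrite sub => /eqP; rewrite subr_eq0 => /eqP.
by case=> l; rewrite sub h0P subrr.
Qed.

Record bounded_symbol (phi : C -> C) (M : R) : Prop := BoundedSymbol {
  bsym_le : forall z, unit_disk z -> nc (phi z) <= M;
  bsym_Re : measurable_fun D2 (fun p => complex.Re (phi (cplx p)));
  bsym_Im : measurable_fun D2 (fun p => complex.Im (phi (cplx p))) }.

Lemma bsym_L2 phi M f : bounded_symbol phi M -> L2_disk f ->
  L2_disk (fun z => phi z * f z).
Proof. by move=> [p1 p2 p3] Lf; have [] := L2_disk_mul p1 p2 p3 Lf. Qed.

Lemma bsym_conj phi M : bounded_symbol phi M -> bounded_symbol (fun z => (phi z)^*) M.
Proof.
move=> [p1 p2 p3]; split.
- by move=> z /p1; rewrite normc_conj.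
- by under eq_fun do rewrite cRe_conj.
- under eq_fun do rewrite cIm_conj; exact: measurable_funN.
Qed.

Lemma bsym_sub phi M lambda : bounded_symbol phi M ->
  bounded_symbol (fun z => phi z - lambda) (M + nc lambda).
Proof.
move=> [p1 p2 p3]; split.
- by move=> z /p1 h; apply: le_trans (normc_triangleB _ _) _; rewrite lerD2r.
- by under eq_fun do rewrite cReB; exact: measurable_funB.
- by under eq_fun do rewrite cImB; exact: measurable_funB.
Qed.

Section OneSymbol.
Variables (phi : C -> C) (M : R).
Hypothesis bphi : bounded_symbol phi M.

Lemma toeplitzP x y : dot (toeplitz phi x) y = L2_dot (fun z => phi z * x z) y.
Proof. by rewrite -bergman_projP//; apply: bsym_L2 bphi _; exact: bergman_L2. Qed.

Lemma shiftP lambda x y :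
  dot (shift_op (toeplitz phi) lambda x) y = L2_dot (fun z => (phi z - lambda) * x z) y.
Proof.
rewrite /shift_op (dotBl H) (dotZl H) toeplitzP.
have Lx := bsym_L2 bphi (bergman_L2 x).
rewrite (_ : (fun z => (phi z - lambda) * x z) =
   (- lambda) *: (x : C -> C) + (fun z => phi z * x z)); last first.
  apply/funext => z; rewrite -[RHS]/(- lambda * x z + phi z * x z).
  by rewrite mulrBl mulNr addrC.
rewrite L2_dotDl//; [|exact: bergman_L2|exact: bergman_L2].
by rewrite mulNr addrC.
Qed.

Lemma dot_extl x y : (forall k, dot x k = dot y k) -> x = y.
Proof.
move=> h; apply: (dot_ext H) => k; by rewrite (dotC H x) (dotC H y) h.
Qed.

Lemma shift_linear lambda : linear (shift_op (toeplitz phi) lambda).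
Proof.
move=> a x y; apply: dot_extl => k; rewrite (dotDl H) !shiftP.
have L u := bsym_L2 (bsym_sub lambda bphi) (bergman_L2 u).
rewrite -L2_dotDl//; last exact: bergman_L2.
congr (L2_dot _ k); apply/funext => z.
rewrite -[RHS]/(a * ((phi z - lambda) * x z) + (phi z - lambda) * y z).
by rewrite -[(a *: x + y : bergman R) z]/(a * x z + y z); ring.
Qed.

Lemma L2sq_proj g (h : bergman R) : L2_disk g -> (forall k, L2_dot g k = dot h k) ->
  L2sq h <= L2sq g.
Proof.
move=> Lg gh; have Lh := bergman_L2 h.
have Lgh : L2_disk (g - h : C -> C).
  by rewrite addrC -scaleN1r; exact: L2_disk_lin.
have := L2_sq_ge0 Lgh.
have E u : L2_disk u -> L2_dot (g - h) u = L2_dot g u - L2_dot h u.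
  move=> Lu; rewrite (_ : (g - h : C -> C) = (-1) *: (h : C -> C) + g); last first.
    by rewrite scaleN1r addrC.
  by rewrite L2_dotDl// mulN1r addrC.
rewrite E// (L2_dotC Lgh Lg) (L2_dotC Lgh Lh) !E// gh subrr rmorph0 subr0.
by rewrite cRe_conj cReB (L2_dotC Lg Lh) gh cRe_conj subr_ge0.
Qed.

Lemma shift_bounded lambda x :
  nrm (shift_op (toeplitz phi) lambda x) <= `|M + nc lambda| * nrm x.
Proof.
have [p1 p2 p3] := bsym_sub lambda bphi.
have [L le] := L2_disk_mul p1 p2 p3 (bergman_L2 x).
rewrite -(@ler_pXn2r _ 2) ?nnegrE ?mulr_ge0 ?nrm_ge0//.
rewrite exprMn !nrm_L2sq real_normK ?num_real//.
by apply: le_trans le; apply: L2sq_proj => // k; rewrite -shiftP.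
Qed.

Lemma L2_dot_mulconj g f h :
  L2_dot (fun z => g z * f z) h = L2_dot f (fun z => (g z)^* * h z).
Proof.
congr disk_integral; apply/funext => z.
by rewrite rmorphM /= conjCK; ring.
Qed.

Lemma shift_adjoint lambda : exists S : bergman R -> bergman R,
  forall x y, dot (shift_op (toeplitz phi) lambda x) y = dot x (S y).
Proof.
pose psi z := (phi z - lambda)^*.
have bpsi : bounded_symbol psi (M + nc lambda) by apply/bsym_conj/bsym_sub.
have L y := bsym_L2 bpsi (bergman_L2 y).
have /choice[S SP] : forall y, exists h : bergman R, forall k,
    L2_dot (fun z => psi z * y z) k = dot h k by move=> y; exact: L2_projection.
exists S => x y; rewrite shiftP L2_dot_mulconj//.
by rewrite (L2_dotC (L y) (bergman_L2 x)) SP -(dotC H).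
Qed.

Lemma adjointP lambda x y : dot (shift_op (toeplitz phi) lambda x) y =
  dot x (adjoint dot (shift_op (toeplitz phi) lambda) y).
Proof.
have [S SP] := shift_adjoint lambda.
rewrite /adjoint; case: xgetP => [S' _ /=|/(_ S)/=]; [exact|by case].
Qed.

Lemma op_ker_adjoint lambda :
  (forall y, exists x, shift_op (toeplitz phi) lambda x = y) ->
  op_ker (adjoint dot (shift_op (toeplitz phi) lambda)) = [set 0].
Proof.
move=> surj; apply/seteqP; split=> y; rewrite /op_ker /= => hy.
  apply: (dot_ext H) => k; have [x <-] := surj k.
  by rewrite adjointP hy !(dot0r H).
apply: (dot_ext H) => k; rewrite -adjointP hy (dot0r H) (dot0r H) //.
Qed.

End OneSymbol.

Lemma has_dim0 : has_dim [set 0 : bergman R] 0.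
Proof.
exists (fun=> 0); split; first by move=> c _ [].
apply/seteqP; split=> x /=; first by move=> ->; exists (fun=> 0); rewrite big_ord0.
by move=> [c ->]; rewrite big_ord0.
Qed.

Lemma has_dim_set0 d : has_dim [set 0 : bergman R] d -> d = 0%N.
Proof.
case: d => // d [e [free E]].
have e0 : e ord0 = 0.
  have : [set 0 : bergman R] (e ord0); last by [].
  rewrite E /=; exists (fun i => (i == ord0)%:R).
  rewrite (bigD1 ord0)//= ?eqxx scale1r big1 ?addr0// => i /negbTE ->.
  by rewrite scale0r.
have := free (fun i => (i == ord0)%:R); rewrite (bigD1 ord0)//= ?eqxx scale1r e0 add0r.
rewrite big1 => [/(_ erefl ord0)/eqP|i /negbTE ->]; last by rewrite scale0r.
by rewrite eqxx oner_eq0.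
Qed.

Lemma has_dim0_set (W : set (bergman R)) : has_dim W 0 -> W = [set 0].
Proof.
move=> [e [_ ->]]; apply/seteqP; split=> x /=; first by move=> [c ->]; rewrite big_ord0.
by move=> ->; exists (fun=> 0); rewrite big_ord0.
Qed.

Lemma dim_set0 : Defs.dim [set 0 : bergman R] = 0%N.
Proof.
rewrite /Defs.dim; case: xgetP => [d _ /= /has_dim_set0//|//].
Qed.

Lemma dim_gt0 (W : set (bergman R)) x : finite_dim W -> W x -> x != 0 -> Defs.dim W != 0%N.
Proof.
move=> [d hd] Wx x0; rewrite /Defs.dim; case: xgetP => [d' _ /= h|/(_ d)//].
apply/eqP => d0; move: h; rewrite d0 => /has_dim0_set E; move: Wx x0.
by rewrite E /= => ->; rewrite eqxx.
Qed.

Lemma coercive_lower phi M lambda u (delta : R) : bounded_symbol phi M ->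
  (forall z, unit_disk z -> delta <= complex.Re (u * (phi z - lambda))) ->
  forall x, delta * nsq dot x <=
    complex.Re (u * dot (shift_op (toeplitz phi) lambda x) x).
Proof.
move=> bphi pos x; have Lx := bergman_L2 x.
rewrite (shiftP bphi) -[X in complex.Re (_ * X)]/(disk_integral _) -dintZ; last first.
  exact: L2_dint_ok (bsym_L2 (bsym_sub lambda bphi) Lx) Lx.
have bs : bounded_symbol (fun z => u * (phi z - lambda)) (nc u * (M + nc lambda)).
  have [p1 p2 p3] := bsym_sub lambda bphi; split.
  - by move=> z Dz; rewrite normcM ler_wpM2l ?normc_ge0// p1.
  - under eq_fun do rewrite cReM; apply: measurable_funB; exact: measurable_funM.
  - under eq_fun do rewrite cImM; apply: measurable_funD; exact: measurable_funM.
have [i1 _] := L2_dint_ok (bsym_L2 bs Lx) Lx.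
have mD := @measurable_disk2 R.
have iL := L2_integrable Lx.
have -> : delta * nsq dot x = \int[area]_(p in D2) (delta * nc (x (cplx p)) ^+ 2).
  rewrite RintegralZl//; congr (_ * _); apply: EFin_inj.
  by rewrite [LHS]L2_sqE// /Rintegral fineK//; exact: integrable_fin_num.
apply: le_Rintegral => //.
- rewrite (_ : _ \o _ = (fun p => delta%:E * (nc (x (cplx p)) ^+ 2)%:E)%E).
    exact: integrableZl.
  by apply/funext => p /=; rewrite EFinM.
- apply: eq_integrable i1 => // p _ /=.
  by rewrite !mulrA.
move=> p Dp; rewrite mulrA mulrA.
have -> : complex.Re (u * (phi (cplx p) - lambda) * x (cplx p) * (x (cplx p))^*) =
   complex.Re (u * (phi (cplx p) - lambda)) * nc (x (cplx p)) ^+ 2.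
  rewrite normc_sqr; move: (u * _) (x _) => s t.
  by rewrite !cReM !cImM cRe_conj cIm_conj; ring.
by rewrite ler_wpM2r ?sqr_ge0// pos.
Qed.

Lemma coercive_invertible phi M lambda u (delta : R) : bounded_symbol phi M -> 0 < delta ->
  (forall z, unit_disk z -> delta <= complex.Re (u * (phi z - lambda))) ->
  invertible_op dot (shift_op (toeplitz phi) lambda) /\
  (forall y, exists x, shift_op (toeplitz phi) lambda x = y).
Proof.
move=> bphi d0 pos; have low := coercive_lower bphi pos.
set A := shift_op _ _ in low *.
have c0 : 0 < delta / (nc u + 1) by rewrite divr_gt0// ltr_wpDl ?normc_ge0.
have lbA x : delta / (nc u + 1) * nrm x <= nrm (A x).
  have u1 : 0 < nc u + 1 by rewrite ltr_wpDl ?normc_ge0.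
  have [x0|x0] := eqVneq (nrm x) 0; first by rewrite x0 mulr0 nrm_ge0.
  have xp : 0 < nrm x by rewrite lt0r x0 nrm_ge0.
  rewrite mulrAC ler_pdivrMr// -(ler_pM2r xp) -mulrA -expr2 (nrm_sqr H).
  apply: le_trans (low x) _; apply: le_trans (ler_norm _) _.
  apply: le_trans (Re_le_normc _) _; rewrite normcM.
  apply: (@le_trans _ _ (nc u * (nrm (A x) * nrm x))).
    by rewrite ler_wpM2l ?normc_ge0// (cauchy_schwarz H).
  rewrite mulrA ler_wpM2r ?nrm_ge0// mulrC ler_wpM2l ?nrm_ge0// lerDl//.
have linA := shift_linear bphi lambda.
have surj : forall y, exists x, A x = y.
  apply: (bounded_below_surj H linA c0 (shift_bounded bphi lambda) lbA) => y hy.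
  have := low y; rewrite hy mulr0 /= pmulr_rle0// => h.
  by apply: (dot_eq0 H); apply/eqP; rewrite eq_le h (dot_ge0 H).
by split=> //; exact: (invertible_of_surj H linA c0 lbA surj).
Qed.

Lemma surj_closed_range (A : bergman R -> bergman R) :
  (forall y, exists x, A x = y) -> closed_range dot A.
Proof. by move=> s y _; exact: s. Qed.

Lemma invertible_index0 phi M lambda : bounded_symbol phi M ->
  invertible_op dot (shift_op (toeplitz phi) lambda) ->
  (forall y, exists x, shift_op (toeplitz phi) lambda x = y) ->
  fredholm_index dot (shift_op (toeplitz phi) lambda) = 0.
Proof.
move=> bphi [S [_ AS _]] surj; rewrite /fredholm_index (op_ker_adjoint bphi surj) dim_set0.
rewrite (_ : op_ker _ = [set 0]) ?dim_set0//; apply/seteqP; split=> x; rewrite /op_ker /=.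
  move=> Ax; have A0 := linear_op0 (shift_linear bphi lambda).
  by rewrite -[LHS]AS Ax -A0 AS.
by move=> ->; exact: linear_op0 (shift_linear bphi lambda).
Qed.

End Toeplitz.

Section LinearSymbol.
Variable R : realType.
Local Notation C := R[i].
Local Notation D2 := (@disk2 R).
Local Notation area := (@area R).
Implicit Types (f g h : C -> C) (z w a b lambda zeta : C) (k x y : bergman R).
Local Notation dot := (@bergman_dot R).
Local Notation nrm := (hnorm dot).
Let H := bergman_hilbert R.

Definition lin_symbol a b : C -> C := fun z => z^* + a + b * z.

Lemma lin_symbol_bounded a b : bounded_symbol (lin_symbol a b) (1 + nc a + nc b).
Proof.
split.
- move=> z; rewrite unit_diskE => /ltW z1.
  apply: le_trans (normc_triangle _ _) _; rewrite lerD//.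
    by apply: le_trans (normc_triangle _ _) _; rewrite lerD2r normc_conj.
  by rewrite normcM ler_piMr ?normc_ge0.
- under eq_fun do rewrite !cReD cRe_conj cReM.
  apply: measurable_funD; first by apply: measurable_funD => //; exact: measurable_cplx_Re.
  by apply: measurable_funB; apply: measurable_funM => //;
    [exact: measurable_cplx_Re|exact: measurable_cplx_Im].
- under eq_fun do rewrite !cImD cIm_conj cImM.
  apply: measurable_funD.
    by apply: measurable_funD => //; apply: measurable_funN; exact: measurable_cplx_Im.
  by apply: measurable_funD; apply: measurable_funM => //;
    [exact: measurable_cplx_Im|exact: measurable_cplx_Re].
Qed.

Lemma mul_op w : exists B : bergman R -> bergman R,
  forall k z, unit_disk z -> B k z = (z - w) * k z.
Proof.
suff /choice[B BP] : forall k, exists l : bergman R,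
    forall z, unit_disk z -> l z = (z - w) * k z by exists B.
move=> k; apply: (@mk_bergman _ (mulsub w k)); last first.
  by have [] := mulsub_L2 w (bergman_L2 k).
move=> z Dz; apply: cdiffM; last exact: bergman_analytic.
by apply: cdiffB; [exact: cdiff_id|exact: cdiff_cst].
Qed.

Lemma eq_L2_dot f f' g g' : (forall z, unit_disk z -> f z = f' z) ->
  (forall z, unit_disk z -> g z = g' z) -> L2_dot f g = L2_dot f' g'.
Proof. by move=> ff gg; apply: eq_dint => z Dz; rewrite ff// gg. Qed.

Section MulOp.
Variables (w : C) (B : bergman R -> bergman R).
Hypothesis BE : forall k z, unit_disk z -> B k z = (z - w) * k z.

Lemma mul_op_linear : linear B.
Proof.
move=> a x y; apply: bergman_ext => z Dz.
rewrite BE// -[RHS]/(a * B x z + B y z) !BE//.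
by rewrite -[(a *: x + y : bergman R) z]/(a * x z + y z); ring.
Qed.

Lemma mul_op_L2sq k : L2sq (B k) = L2sq (mulsub w k).
Proof. by congr complex.Re; apply: eq_L2_dot => z Dz; exact: BE. Qed.

Lemma mul_op_bounded k : nrm (B k) <= (1 + nc w) * nrm k.
Proof.
rewrite -(@ler_pXn2r _ 2) ?nnegrE ?mulr_ge0 ?addr_ge0 ?normc_ge0 ?nrm_ge0//.
rewrite exprMn !nrm_L2sq mul_op_L2sq.
by have [] := mulsub_L2 w (bergman_L2 k).
Qed.

Lemma mul_op_bounded_below : unit_disk w ->
  exists2 c : R, 0 < c & forall k, c * nrm k <= nrm (B k).
Proof.
move=> Dw; have [rho [c [_ c0 _ P]]] := point_bound Dw.
have s0 : 0 < Num.sqrt (c + 1) by rewrite sqrtr_gt0 ltr_wpDl.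
exists (Num.sqrt (c + 1))^-1; first by rewrite invr_gt0.
move=> k; rewrite ler_pdivrMl//.
rewrite -(@ler_pXn2r _ 2) ?nnegrE ?mulr_ge0 ?sqrtr_ge0 ?nrm_ge0//.
rewrite exprMn !nrm_L2sq mul_op_L2sq sqr_sqrtr ?addr_ge0//.
have [k1 k2 _] := bergman_L2 k; have [Lm _] := mulsub_L2 w (bergman_L2 k).
have [_ _ le] := P k (@bergman_analytic R k) k1 k2 Lm.
by apply: (le_trans le); rewrite ler_wpM2r ?lerDl// L2_sq_ge0.
Qed.

Lemma dot_mul_op x y : dot x (B y) = L2_dot (fun z => (z - w)^* * x z) y.
Proof.
rewrite L2_dot_mulconj; apply: eq_L2_dot => z Dz //.
by rewrite BE// conjCK.
Qed.

End MulOp.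

Lemma one_bergman : exists e : bergman R, forall z, unit_disk z -> e z = 1.
Proof.
apply: (@mk_bergman _ (fun=> 1)); first by move=> z _; exact: cdiff_cst.
apply: (@L2_bounded _ _ 1); [|exact: measurable_cst|exact: measurable_cst].
by move=> z _; rewrite Normc.normc1.
Qed.

Lemma reproducing_kernel w : unit_disk w -> exists f : bergman R, forall k, dot k f = k w.
Proof.
move=> Dw; have [rho [c [r0 c0 P]]] := eval_bound Dw.
have [|f fP] := @bergman_riesz R (fun k => k w) c (fun _ _ _ => erefl).
  by move=> k; apply: P; apply: square_center; exact: ltW.
by exists f => k; rewrite fP.
Qed.

Lemma kernel_neq0 w (f : bergman R) : unit_disk w -> (forall k, dot k f = k w) -> f != 0.
Proof.
move=> Dw fP; apply/eqP => f0; have [e eP] := one_bergman.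
have := fP e; rewrite f0 (dot0r H) eP// => /eqP.
by rewrite eq_sym oner_eq0.
Qed.

Lemma measurable_disk_minus_pt w (u : measurableTypeR R * measurableTypeR R -> R) :
  measurable_fun (D2 `\ (complex.Re w, complex.Im w)) u -> measurable_fun D2 u.
Proof.
move=> mu; set p0 := (complex.Re w, complex.Im w) in mu *.
have m0 : measurable [set p0].
  rewrite (_ : [set p0] = [set complex.Re w] `*` [set complex.Im w]).
    by apply: measurableX; exact: measurable_set1.
  by apply/seteqP; split=> [_ ->//|[s t] [/= -> ->]].
have mD := @measurable_disk2 R.
have mDp : measurable (D2 `\ p0) by exact: measurableD.
apply: (@measurable_funS _ _ _ _ ((D2 `\ p0) `|` [set p0])).
- exact: measurableU.
- move=> p Dp; have [->|pp] := pselect (p = p0); first by right.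
  by left.
- apply/measurable_funU => //; split=> //; exact: measurable_fun_set1.
Qed.

Lemma bergman_factor w k : unit_disk w -> k w = 0 ->
  exists l : bergman R, forall z, unit_disk z -> k z = (z - w) * l z.
Proof.
move=> Dw kw0; have [d d0 dP] := unit_disk_near Dw.
pose s := d / 3; have s0 : 0 < s by rewrite divr_gt0.
have Rd z : square w s z -> unit_disk z.
  move=> [h1 h2]; apply: dP.
  have -> : z - w = ((complex.Re z - complex.Re w) +i* (complex.Im z - complex.Im w))%C.
    by apply: complex_eq; rewrite ?cReB ?cImB.
  apply: le_lt_trans (normc_le_ReIm _ _) _.
  have : `|complex.Re z - complex.Re w| <= s by rewrite ler_distl.
  have : `|complex.Im z - complex.Im w| <= s by rewrite ler_distl.
  by move: d0; rewrite /s; clear; lra.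
have Iw : inter (complex.Re w - s) (complex.Re w + s) (complex.Im w - s)
    (complex.Im w + s) w by split; rewrite ltrBlDr ltrDl s0.
have dk z : square w s z -> cdiff k z by move=> /Rd Dz; exact: (@bergman_analytic R k).
have [g [dg gE]] := cdiff_factor Iw dk kw0.
pose l z := if z == w then g w else k z / (z - w).
have lE z : k z = (z - w) * l z.
  rewrite /l; case: eqVneq => [->|zw]; first by rewrite subrr mul0r.
  by rewrite mulrC divfK// subr_eq0.
have al : analytic_disk l.
  move=> z Dz; have [->|zw] := eqVneq z w.
    apply: (@cdiff_near _ g _ _ _ (bdist_gt0 Iw)) (dg w Iw) => u /inter_near Iu.
    rewrite /l; case: eqVneq => [->//|uw].
    by rewrite gE// mulrC mulKf// subr_eq0.
  apply: (@cdiff_near _ (fun u => k u / (u - w)) _ _ (nc (z - w))).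
  - by rewrite normc_gt0 subr_eq0.
  - move=> u uz; rewrite /l; case: eqVneq => // uw; move: uz.
    by rewrite uw normcB ltxx.
  apply: cdiffM; first exact: (@bergman_analytic R k).
  apply: cdiffV; first by rewrite subr_eq0.
  by apply: cdiffB; [exact: cdiff_id|exact: cdiff_cst].
have [k1 k2 k3] := bergman_L2 k.
have [ml1 ml2] : measurable_fun D2 (fun p => complex.Re (l (cplx p))) /\
    measurable_fun D2 (fun p => complex.Im (l (cplx p))).
  have mD := @measurable_disk2 R.
  pose N (p : measurableTypeR R * measurableTypeR R) : R :=
    (p.1 - complex.Re w) ^+ 2 + (p.2 - complex.Im w) ^+ 2.
  have mN X : measurable_fun X N.
    apply: measurable_funTS; apply: measurable_funD; apply: measurable_funX;
      exact: measurable_funB.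
  set E := D2 `\ (complex.Re w, complex.Im w).
  have mV X : measurable_fun X (fun p => (N p)^-1).
    apply: measurable_funTS.
    rewrite (_ : (fun p => (N p)^-1) = (fun r => powR r (-1)) \o N).
      by apply: measurableT_comp; [exact: measurable_powR|exact: mN].
    by apply/funext => p /=; rewrite powR_inv1// addr_ge0 ?sqr_ge0.
  have Es : E `<=` D2 by move=> p [].
  have k1' := measurable_funS mD Es k1; have k2' := measurable_funS mD Es k2.
  have a1 : measurable_fun E (fun p : measurableTypeR R * measurableTypeR R => p.1 - complex.Re w).
    by apply: measurable_funTS; apply: measurable_funB => //; exact: measurable_fst.
  have a2 : measurable_fun E (fun p : measurableTypeR R * measurableTypeR R => p.2 - complex.Im w).
    by apply: measurable_funTS; apply: measurable_funB => //; exact: measurable_snd.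
  have lEE p : E p -> l (cplx p) = k (cplx p) * (cplx p - w)^-1.
    move=> [_ np]; rewrite /l; case: eqVneq => // pw; exfalso; apply: np.
    by rewrite -pw /= /cplx /=; case: (p).
  have invE p : (cplx p - w)^-1 = ((p.1 - complex.Re w) / N p +i*
      (- ((p.2 - complex.Im w) / N p)))%C.
    have -> : cplx p - w = ((p.1 - complex.Re w) +i* (p.2 - complex.Im w))%C.
      by apply: complex_eq; rewrite ?cReB ?cImB.
    by [].
  split; apply: (@measurable_disk_minus_pt w).
    apply: (eq_measurable_fun (fun p => complex.Re (k (cplx p)) * ((p.1 - complex.Re w) * (N p)^-1)
      + complex.Im (k (cplx p)) * ((p.2 - complex.Im w) * (N p)^-1))).
      by move=> p /set_mem Ep; rewrite lEE// cReM invE /= mulrN opprK.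
    apply: measurable_funD; apply: measurable_funM => //; exact: measurable_funM.
  apply: (eq_measurable_fun (fun p => complex.Im (k (cplx p)) * ((p.1 - complex.Re w) * (N p)^-1)
      - complex.Re (k (cplx p)) * ((p.2 - complex.Im w) * (N p)^-1))).
    by move=> p /set_mem Ep; rewrite lEE// cImM invE /= mulrN addrC.
  apply: measurable_funB; apply: measurable_funM => //; exact: measurable_funM.
have Lm : L2_disk (mulsub w l).
  rewrite (_ : mulsub w l = k); first exact: bergman_L2.
  by apply/funext => z; rewrite /mulsub -lE.
have [rho [c [_ _ _ P]]] := point_bound Dw.
have [Ll _ _] := P l al ml1 ml2 Lm.
have [l' l'E] := mk_bergman al Ll.
by exists l' => z Dz; rewrite l'E.
Qed.

Section Shift.
Variables (a b : C).
Local Notation phi := (lin_symbol a b).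
Local Notation A lambda := (shift_op (toeplitz phi) lambda).

Lemma lin_shift_kernel (zeta w : C) (f : bergman R) (Bw Bz : bergman R -> bergman R) :
  unit_disk w -> (forall k, dot k f = k w) ->
  (forall k z, unit_disk z -> Bw k z = (z - w) * k z) ->
  (forall k z, unit_disk z -> Bz k z = (z - zeta) * k z) ->
  A (phi zeta) f = (w - zeta)^* *: f + b *: Bz f.
Proof.
move=> Dw fP BwE BzE; apply: dot_extl => y.
rewrite (shiftP (lin_symbol_bounded a b)) (dotDl H).
have e0 : dot f (Bw y) = 0.
  by rewrite (dotC H (Bw y)) fP BwE// subrr mul0r rmorph0.
have Lf := bergman_L2 f; have Ly := bergman_L2 y.
have Lc : L2_disk (fun z => (z - w)^* * f z).
  apply: (@bsym_L2 _ _ (1 + nc w)) Lf; apply: (@bsym_conj _ (fun z => z - w)).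
  split.
  - by move=> z; rewrite unit_diskE => z1; have := normc_triangleB z w; lra.
  - under eq_fun do rewrite cReB.
    by apply: measurable_funB => //; exact: measurable_cplx_Re.
  - under eq_fun do rewrite cImB.
    by apply: measurable_funB => //; exact: measurable_cplx_Im.
have -> : L2_dot (fun z => (phi z - phi zeta) * f z) y =
    L2_dot (1 *: (fun z => (z - w)^* * f z) +
       ((w - zeta)^* *: (f : C -> C) + b *: (Bz f : C -> C))) y.
  apply: eq_L2_dot => // z Dz.
  rewrite -[RHS]/(1 * ((z - w)^* * f z) + ((w - zeta)^* * f z + b * Bz f z)) BzE//.
  rewrite /lin_symbol !rmorphB /=; ring.
have L0 : L2_disk (0 : C -> C).
  by have [] := bergman_submod_closed R; rewrite inE => -[].
have Lb : L2_disk (b *: (Bz f : C -> C)).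
  by rewrite -[X in L2_disk X]addr0; apply: L2_disk_lin => //; exact: bergman_L2.
rewrite !L2_dotDl//; last exact: L2_disk_lin.
have bZ : bergman_fun (b *: Bz f) = b *: bergman_fun (Bz f) by [].
rewrite mul1r -(dot_mul_op BwE) e0 add0r /bergman_dot bZ; reflexivity.
Qed.

Lemma mul_op_kernel_bound (w : C) (f : bergman R) (Bw : bergman R -> bergman R) :
  unit_disk w -> (forall k, dot k f = k w) ->
  (forall k z, unit_disk z -> Bw k z = (z - w) * k z) ->
  nrm (Bw f) ^+ 2 <= (1 - nc w ^+ 2) * nrm f ^+ 2.
Proof.
move=> Dw fP BE; have [B0 B0E] := mul_op 0.
have -> : Bw f = B0 f - w *: f.
  apply: bergman_ext => z Dz; rewrite BE//.
  rewrite -[RHS]/(B0 f z - w * f z) B0E// subr0; ring.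
rewrite !(nrm_sqr H) (nsqB H) (nsqZ H) (dotZr H) fP B0E// subr0.
have fw : f w = (nsq dot f)%:C%C.
  rewrite -fP; apply: complex_eq => //=.
  have /(congr1 (@complex.Im R)) := dotC H f f; rewrite cIm_conj => /eqP.
  by rewrite -addr_eq0 -mulr2n mulrn_eq0 /= => /eqP.
have -> : complex.Re (w^* * (w * f w)) = nc w ^+ 2 * nsq dot f.
  rewrite fw normc_sqr; case: (w) => s t.
  by rewrite !cReM !cImM cRe_conj cIm_conj /=; ring.
have : nsq dot (B0 f) <= nsq dot f.
  have := mul_op_bounded B0E f.
  rewrite Normc.normc0 addr0 mul1r -(@ler_pXn2r _ 2) ?nnegrE ?(nrm_ge0)//.
  by rewrite !(nrm_sqr H).
by lra.
Qed.

Theorem lin_symbol_spectrum_circle (zeta : C) : nc zeta = 1 ->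
  ~ invertible_op dot (A (phi zeta)).
Proof.
move=> z1 /invertible_bounded_below[c c0 lb].
have : c <= 0; last by rewrite leNgt c0.
apply: (@le0_small _ _ (1 + 2 * nc b) 1) => // s s0 s1.
pose t := 1 - s ^+ 2 / 2.
have s2 : s ^+ 2 <= 1 by rewrite expr_le1// ltW.
have s2p : 0 < s ^+ 2 by rewrite exprn_gt0.
have t0 : 0 <= t by rewrite /t; lra.
have t1 : t < 1 by rewrite /t; lra.
pose w := t%:C%C * zeta.
have nw : nc w = t by rewrite normcM normc_real z1 mulr1 ger0_norm.
have Dw : unit_disk w by rewrite unit_diskE nw.
have wz : nc (w - zeta) = s ^+ 2 / 2.
  rewrite (_ : w - zeta = (t - 1)%:C%C * zeta); last first.
    by rewrite rmorphB /= mulrBl mul1r.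
  rewrite normcM normc_real z1 mulr1 ler0_norm ?subr_le0 ?ltW// /t; lra.
have [f fP] := reproducing_kernel Dw.
have [Bw BwE] := mul_op w; have [Bz BzE] := mul_op zeta.
have fn : 0 < nrm f.
  rewrite lt0r nrm_ge0 andbT; apply/eqP => /(nrm_eq0 H) f0.
  by have := kernel_neq0 Dw fP; rewrite f0 eqxx.
have := lb f; rewrite (lin_shift_kernel Dw fP BwE BzE) => h.
have Bzf : Bz f = Bw f + (w - zeta) *: f.
  apply: bergman_ext => z Dz; rewrite BzE//.
  rewrite -[RHS]/(Bw f z + (w - zeta) * f z) BwE//; ring.
have bw : nrm (Bw f) <= s * nrm f.
  rewrite -(@ler_pXn2r _ 2) ?nnegrE ?mulr_ge0 ?nrm_ge0 ?(ltW s0)//.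
  apply: (le_trans (mul_op_kernel_bound Dw fP BwE)).
  rewrite exprMn ler_wpM2r ?sqr_ge0// nw /t.
  have : 0 <= (s ^+ 2 / 2) ^+ 2 by rewrite sqr_ge0.
  lra.
rewrite -(ler_pM2r fn); apply: (le_trans h).
apply: (le_trans (nrmD H _ _)); rewrite !(nrmZ H) normc_conj wz Bzf.
have h1 : nrm (Bw f + (w - zeta) *: f) <= s * nrm f + s ^+ 2 / 2 * nrm f.
  by apply: (le_trans (nrmD H _ _)); rewrite (nrmZ H) wz lerD2r.
have h2 : s ^+ 2 / 2 <= s.
  by rewrite expr2 -mulrA ler_piMr ?(ltW s0)// ler_pdivrMr// mul1r; lra.
have h3 : s ^+ 2 / 2 * nrm f <= s * nrm f by rewrite ler_wpM2r ?nrm_ge0.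
have h4 : nc b * nrm (Bw f + (w - zeta) *: f) <= nc b * (2 * (s * nrm f)).
  by rewrite ler_wpM2l ?normc_ge0//; lra.
rewrite mulrDl mul1r mulrDl; apply: lerD => //.
by apply: (le_trans h4); rewrite le_eqVlt; apply/orP; left; apply/eqP; ring.
Qed.

End Shift.

Theorem coanalytic_shift_fredholm a (w : C) : unit_disk w ->
  let A := shift_op (toeplitz (lin_symbol a 0)) (a + w^*) in
  [/\ fredholm dot A, fredholm_index dot A <> 0 & ~ invertible_op dot A].
Proof.
move=> Dw A.
have bphi := lin_symbol_bounded a 0.
have [B BE] := mul_op w.
have [c c0 lbB] := mul_op_bounded_below BE Dw.
have linB := mul_op_linear BE.
have adj x y : dot (B x) y = dot x (A y).
  rewrite (dotC H (A y)) (shiftP bphi) (dotC H y) (dot_mul_op BE).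
  congr (_^*); apply: eq_L2_dot => // z Dz.
  by rewrite /lin_symbol rmorphB /=; ring.
have surj : forall y, exists x, A x = y.
  exact: (adjoint_surj H linB c0 (mul_op_bounded BE) lbB adj).
have [f fP] := reproducing_kernel Dw.
have [e eP] := one_bergman.
have f0 := kernel_neq0 Dw fP.
have Af : A f = 0.
  apply: (dot_ext H) => k.
  by rewrite -adj fP BE// subrr mul0r (dot0r H).
have linA : linear A := shift_linear bphi (a + w^*).
have kerE : op_ker A = [set x | exists s : C, x = s *: f].
  apply/seteqP; split=> x; rewrite /op_ker /=; last first.
    by move=> [s ->]; rewrite (linear_opZ linA) Af scaler0.
  move=> Ax; exists (dot e x)^*; apply: (dot_ext H) => k.
  have kw0 : (k - k w *: e) w = 0.
    by rewrite -[LHS]/(k w - k w * e w) eP// mulr1 subrr.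
  have [l lE] := bergman_factor Dw kw0.
  have kB : k = k w *: e + B l.
    apply: bergman_ext => z Dz.
    have lz : k z - k w * e z = (z - w) * l z by rewrite -lE.
    by rewrite -[RHS]/(k w * e z + B l z) BE// -lz addrC subrK.
  rewrite {1}kB (dotDl H) adj Ax (dot0r H) addr0 (dotZr H) conjCK fP.
  by rewrite mulrC.
have fin : finite_dim (op_ker A).
  exists 1%N, (fun=> f); split.
    move=> s; rewrite big_ord1 => /eqP; rewrite scaler_eq0 (negbTE f0) orbF => /eqP s0 i.
    by rewrite ord1.
  rewrite kerE; apply/seteqP; split=> x /= [s ->].
    by exists (fun=> s); rewrite big_ord1.
  by exists (s ord0); rewrite big_ord1.
have kadj := op_ker_adjoint bphi surj; rewrite -/A in kadj.
have Kf : op_ker A f by [].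
split.
- split; [exact: surj_closed_range|exact: fin|].
  by rewrite kadj; exists 0%N; exact: has_dim0.
- rewrite /fredholm_index kadj dim_set0 subr0 => /eqP.
  by rewrite eqz_nat (negbTE (dim_gt0 fin Kf f0)).
- move=> [S [_ AS _]]; move/eqP: f0; apply.
  have S0 : S 0 = 0 by rewrite -{1}(linear_op0 linA) AS.
  by rewrite -[LHS]AS Af S0.
Qed.

End LinearSymbol.

(** * Winding numbers *)

Section Winding.
Variable R : realType.
Local Notation C := R[i].
Implicit Types (x y t s : R) (z w : C).

Lemma cisD x y : cis (x + y) = cis x * cis y.
Proof. by rewrite /cis cosD sinD; apply: complex_eq; rewrite ?cReM ?cImM //= addrC. Qed.

Lemma cis0 : cis (0 : R) = 1.
Proof. by rewrite /cis cos0 sin0. Qed.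

Lemma cisN x : cis (- x) = (cis x)^*.
Proof. by rewrite /cis cosN sinN. Qed.

Lemma normc_cis x : nc (cis x) = 1.
Proof. by rewrite /= cos2Dsin2 sqrtr1. Qed.

Lemma cis2pi x : cis (x + 2 * pi) = cis x.
Proof. by rewrite /cis mulr_natl cosD2pi sinD2pi. Qed.

Lemma cis_surj z : nc z = 1 -> exists x, z = cis x.
Proof.
move=> z1; have := normc_sqr z; rewrite z1 expr1n => /esym zz.
have h : -1 <= complex.Re z <= 1.
  by have := Re_le_normc z; rewrite z1 ler_norml.
have sq : 1 - complex.Re z ^+ 2 = complex.Im z ^+ 2 by rewrite -zz addrAC subrr add0r.
have [s0|/ltW s0] := leP 0 (complex.Im z).
  exists (acos (complex.Re z)); apply: complex_eq; rewrite /= ?acosK ?in_itv//.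
  by rewrite sin_acos// sq sqrtr_sqr ger0_norm.
exists (- acos (complex.Re z)); apply: complex_eq.
  by rewrite /= cosN acosK ?in_itv.
by rewrite /= sinN sin_acos// sq sqrtr_sqr ler0_norm// opprK.
Qed.

Lemma polar_right x y : 0 < x -> (x +i* y)%C = (nc (x +i* y)%C)%:C%C * cis (atan (y / x)).
Proof.
move=> x0; set t := atan _.
have ct : 0 < cos t by rewrite /t cos_atan invr_gt0 sqrtr_gt0 ltr_pwDl ?sqr_ge0.
have st : sin t = y / x * cos t.
  have := atanK (y / x); rewrite -/t /tan => <-.
  by rewrite divfK// gt_eqF.
have E : nc (x +i* y)%C = x / cos t.
  rewrite /= -[RHS]ger0_norm ?divr_ge0 ?ltW// -sqrtr_sqr; congr Num.sqrt.
  have := cos2Dsin2 t; rewrite st => c2.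
  by rewrite -[RHS]mulr1 -c2; field; rewrite !gt_eqF.
apply: complex_eq; rewrite ?cReM ?cImM E /=.
  by rewrite mul0r subr0 divfK// gt_eqF.
by rewrite mul0r addr0 st; field; rewrite !gt_eqF.
Qed.

Definition rcontinuous (f : R -> R) := forall t, {for t, continuous f}.

Lemma is_wind_cis (gamma v : R -> C) (lambda : C) (c theta : R) (k : int) :
  0 < c -> (forall t, gamma t - lambda = c%:C%C * cis (k%:~R * t + theta) * v t) ->
  (forall t, 0 < complex.Re (v t)) ->
  rcontinuous (fun t => complex.Re (v t)) -> rcontinuous (fun t => complex.Im (v t)) ->
  v (2 * pi) = v 0 -> is_wind gamma lambda k.
Proof.
move=> c0 gE v0 c1 c2 vper.
exists (fun t => k%:~R * t + theta + atan (complex.Im (v t) / complex.Re (v t))); split.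
- apply: continuous_in_subspaceT => t _.
  apply: cvgD; first by apply: cvgD; [apply: cvgMr; exact: cvg_id|exact: cvg_cst].
  apply: (@continuous_comp R R R (fun t => complex.Im (v t) / complex.Re (v t)) atan).
    apply: cvgM; first exact: c2.
    by apply: cvgV; [rewrite gt_eqF|exact: c1].
  exact: continuous_atan.
- move=> t _; rewrite gE (cisD (k%:~R * t + theta)).
  have vE : v t = (nc (v t))%:C%C * cis (atan (complex.Im (v t) / complex.Re (v t))).
    have := v0 t; case: (v t) => x y /= /polar_right; apply.
  rewrite normc_normE !normcM normc_cis normc_real gtr0_norm// mulr1 rmorphM /=.
  by rewrite {1}vE; ring.
- by rewrite vper mulr0 add0r; ring.
Qed.

Lemma is_wind_unique (gamma : R -> C) (lambda : C) (k l : int) :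
  (forall t, gamma t != lambda) ->
  is_wind gamma lambda k -> is_wind gamma lambda l -> k = l.
Proof.
move=> gl [a [ca aE ak]] [b [cb bE bl]].
have cisab t : 0 <= t <= 2 * pi -> cis (a t - b t) = 1.
  move=> ht; have n0 : `|gamma t - lambda| != 0 by rewrite normr_eq0 subr_eq0.
  have /(mulfI n0) e := etrans (esym (aE t ht)) (bE t ht).
  rewrite cisD cisN -e; apply: complex_eq; rewrite ?cReM ?cImM ?cRe_conj ?cIm_conj /=.
    by rewrite mulrN opprK -!expr2 cos2Dsin2.
  by rewrite mulrN mulrC addNr.
have pi0 : 0 <= 2 * pi :> R by rewrite mulr_ge0// pi_ge0.
pose d t := a t - b t.
have cd : {within `[0, 2 * pi], continuous d}.
  by move=> t; apply: cvgB; [exact: ca|exact: cb].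
have dd : d (2 * pi) - d 0 = 2 * pi * (k - l)%:~R.
  by rewrite intrB mulrBr -ak -bl /d; ring.
apply/eqP; rewrite -subr_eq0; apply/negPn/negP => kl.
(* Between [d 0] and [d (2 pi)], which differ by at least [2 pi], the continuous
   function [d] takes the value [d 0 + s pi], where [cis d] is [-1]. *)
have [s s1 sb] : exists2 s : R, `|s| = 1 &
    Num.min (d 0) (d (2 * pi)) <= d 0 + s * pi <= Num.max (d 0) (d (2 * pi)).
  have pp := pi_gt0 R; have := kl; rewrite neq_lt => /orP[h|h].
    exists (-1); first by rewrite normrN1.
    have h1 : (k - l)%:~R <= -1 :> R by rewrite -[-1]/((-1)%:~R) ler_int -ltzD1 addNr.
    have h2 : 2 * pi * (k - l)%:~R <= 2 * pi * (-1) :> R by rewrite ler_wpM2l.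
    by rewrite ge_min le_max; apply/andP; split; apply/orP; [right|left]; lra.
  exists 1; first by rewrite normr1.
  have h1 : 1 <= (k - l)%:~R :> R by rewrite -[1]/(1%:~R) ler_int -gtz0_ge1.
  have h2 : 2 * pi * 1 <= 2 * pi * (k - l)%:~R :> R by rewrite ler_wpM2l.
  by rewrite ge_min le_max; apply/andP; split; apply/orP; [left|right]; lra.
have [t tI dt] := IVT pi0 cd sb.
have := cisab t; rewrite in_itv /= in tI => /(_ tI).
rewrite -/(d t) dt cisD.
have -> : cis (d 0) = 1 by apply: cisab; rewrite lexx pi0.
rewrite mul1r => /(congr1 (@complex.Re R)) /=.
have [->|->] : s = 1 \/ s = -1.
- by move: s1; case: ger0P => _ <-; [left|right; rewrite opprK].
- by rewrite mul1r cospi; lra.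
- by rewrite mulN1r cosN cospi; lra.
Qed.

Lemma wind_eq (gamma : R -> C) (lambda : C) (k : int) :
  (forall t, gamma t != lambda) -> is_wind gamma lambda k -> wind gamma lambda = k.
Proof.
move=> gl wk; rewrite /wind; case: xgetP => [l _ /= wl|/(_ k)//].
exact: is_wind_unique wl wk.
Qed.

End Winding.

(** * Consequences of the Poincare condition *)

Section Contraction.
Variable R : realType.
Local Notation C := R[i].
Implicit Types (y z w u : C) (e d s t : R).

Lemma half_contraction_fixpoint (N : C -> C) (c : C) (e : R) : 0 <= e ->
  (forall y, nc (y - c) <= e -> nc (N y - c) <= e) ->
  (forall y z, nc (y - c) <= e -> nc (z - c) <= e -> nc (N y - N z) <= nc (y - z) / 2) ->
  exists2 y, nc (y - c) <= e & N y = y.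
Proof.
move=> e0 stab contr.
pose s n := iter n N c.
have sc n : nc (s n - c) <= e.
  by elim: n => [|n IH] /=; [rewrite subrr Normc.normc0|exact: stab].
have far n k : nc (s (n + k)%N - s n) <= 2 * e / 2 ^+ n.
  elim: n => [|n IH].
    rewrite add0n expr0 divr1; have := normc_dist_triangle (s k) c (s 0%N).
    by rewrite [nc (c - _)]normcB; have := sc k; have := sc 0%N; lra.
  have := contr _ _ (sc (n + k)%N) (sc n); rewrite addSn /= => /le_trans; apply.
  rewrite ler_pdivrMr// (le_trans IH)//.
  have -> : 2 * e / 2 ^+ n.+1 * 2 = 2 * e / 2 ^+ n by rewrite exprS; field; rewrite expf_neq0.
  exact: lexx.
have small (d : R) : 0 < d -> exists M, forall n, (M <= n)%N -> 2 * e / 2 ^+ n < d.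
  move=> d0; have [M MP] := exp2_shrink (2 * e) d0; exists M => n Mn.
  apply: le_lt_trans MP; rewrite ler_wpM2l ?mulr_ge0// lef_pV2 ?posrE ?exprn_gt0//.
  by rewrite ler_eXn2l// ltr1n.
have [l lP] : exists l, forall d : R, 0 < d -> exists M, forall i, (M <= i)%N -> nc (s i - l) < d.
  apply: complex_cauchy_cvg => d d0; have [M MP] := small d d0; exists M.
  suff K i j : (M <= i)%N -> (i <= j)%N -> nc (s j - s i) < d.
    move=> i j Mi Mj; have [ij|/ltnW ji] := leqP i j; last exact: K.
    by rewrite normcB; exact: K.
  by move=> Mi ij; rewrite -(subnKC ij); apply: le_lt_trans (far _ _) (MP _ Mi).
have lc : nc (l - c) <= e.
  apply/ler_addgt0Pr => d d0; have [M MP] := lP d d0.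
  have := MP M (leqnn _); have := normc_dist_triangle l (s M) c.
  by rewrite [nc (l - s M)]normcB; have := sc M; lra.
exists l => //; apply/eqP; rewrite -subr_eq0 -normc0P eq_le normc_ge0 andbT.
apply/ler_addgt0Pr => d d0; rewrite add0r.
have [M MP] := lP (d / 2) ltac:(by rewrite divr_gt0).
have h1 := MP M (leqnn _); have h2 := MP M.+1 (leqnSn _).
have h3 := contr _ _ lc (sc M); rewrite [nc (l - s M)]normcB in h3.
have h4 := normc_dist_triangle (N l) (s M.+1) l.
rewrite [s M.+1]/= in h2 h4; rewrite -/(s M) in h2 h4; lra.
Qed.

Lemma poly_lipschitz (p : {poly C}) (r : R) : 0 <= r -> exists2 K : R, 0 <= K &
  forall a b, nc a <= r -> nc b <= r ->
    nc p.[a] <= K /\ nc (p.[a] - p.[b]) <= K * nc (a - b).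
Proof.
move=> r0; elim/poly_ind: p => [|p c [K K0 IH]].
  by exists 0 => // a b _ _; rewrite !horner0 subrr Normc.normc0 mul0r.
exists (K * r + nc c + K); first by rewrite !addr_ge0 ?mulr_ge0 ?normc_ge0.
move=> a b ar br; have [h1 h2] := IH a b ar br; rewrite !hornerMXaddC.
have c0 := normc_ge0 c; have Kr : 0 <= K * r by rewrite mulr_ge0.
split.
  apply: le_trans (normc_triangle _ _) _; rewrite normcM.
  have : nc p.[a] * nc a <= K * r by rewrite ler_pM ?normc_ge0.
  lra.
have -> : p.[a] * a + c - (p.[b] * b + c) = p.[a] * (a - b) + (p.[a] - p.[b]) * b by ring.
apply: le_trans (normc_triangle _ _) _; rewrite !normcM !mulrDl.
have k1 : nc p.[a] * nc (a - b) <= K * nc (a - b) by rewrite ler_wpM2r ?normc_ge0.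
have k2 : nc (p.[a] - p.[b]) * nc b <= K * r * nc (a - b).
  by rewrite mulrAC ler_pM ?normc_ge0.
have k3 : 0 <= nc c * nc (a - b) by rewrite mulr_ge0 ?normc_ge0.
lra.
Qed.

Lemma near1_prod y z e (a b : nat) : 0 <= e -> e <= 1 -> nc (y - 1) <= e -> nc (z - 1) <= e ->
  nc (y ^+ a * z ^+ b - 1) <= (2 ^+ (a + b) - 1) * e.
Proof.
move=> e0 e1 ye ze.
have le2 x : nc (x - 1) <= e -> nc x <= 2.
  by move=> h; have := normc_triangle (x - 1) 1; rewrite subrK Normc.normc1; lra.
have step x p (B : R) : nc (x - 1) <= e -> nc (p - 1) <= (B - 1) * e ->
    nc (x * p - 1) <= (2 * B - 1) * e.
  move=> hx hp; have -> : x * p - 1 = x * (p - 1) + (x - 1) by ring.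
  apply: le_trans (normc_triangle _ _) _; rewrite normcM.
  have : nc x * nc (p - 1) <= 2 * ((B - 1) * e) by rewrite ler_pM ?normc_ge0// le2.
  lra.
elim: a => [|a IH]; last by rewrite exprS -mulrA addSn exprS; exact: step.
rewrite expr0 mul1r add0n; elim: b => [|b IH]; last by rewrite !exprS; exact: step.
by rewrite !expr0 !subrr Normc.normc0 mul0r.
Qed.

Lemma cis_dist s t : nc (cis s - cis t : C) <= `|cos s - cos t| + `|sin s - sin t|.
Proof.
rewrite (_ : cis s - cis t = ((cos s - cos t) +i* (sin s - sin t))%C).
  exact: normc_le_ReIm.
by apply: complex_eq; rewrite ?cReB ?cImB.
Qed.

Lemma continuous_lip_cis (F : C -> C) (K delta : R) : 0 <= K -> 0 <= delta ->
  (forall u v, nc u <= delta -> nc v <= delta -> nc (F u - F v) <= K * nc (u - v)) ->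
  forall t : R, {for t, continuous (fun t : R => nc (F (delta%:C%C * cis t)))}.
Proof.
move=> K0 d0 lip t; apply/cvgrPdist_lt => e e0.
pose d := e / (2 * (K * delta + 1)).
have P0 : 0 < K * delta + 1 by rewrite ltr_wpDl ?mulr_ge0.
have dp : 0 < d by rewrite divr_gt0// mulr_gt0.
have c1 := @continuous_cos R t; have c2 := @continuous_sin R t.
move/cvgrPdist_lt/(_ d dp) : c1 => c1.
move/cvgrPdist_lt/(_ d dp) : c2 => c2.
near=> s.
apply: le_lt_trans (normc_lip _ _) _.
have nd x : nc (delta%:C%C * cis x) <= delta.
  by rewrite normcM normc_real normc_cis mulr1 ger0_norm.
apply: le_lt_trans (lip _ _ (nd t) (nd s)) _.
rewrite -mulrBr normcM normc_real ger0_norm// mulrA.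
have h1 : `|cos t - cos s| < d by near: s.
have h2 : `|sin t - sin s| < d by near: s.
have h3 : nc (cis t - cis s) <= 2 * d by apply: le_trans (cis_dist _ _) _; lra.
apply: (@le_lt_trans _ _ (K * delta * (2 * d))).
  by rewrite ler_wpM2l// mulr_ge0.
apply: (@lt_le_trans _ _ ((K * delta + 1) * (2 * d))).
  by have d2 : 0 < 2 * d by [rewrite mulr_gt0]; rewrite ltr_pM2r// ltrDl.
by rewrite /d le_eqVlt; apply/orP; left; apply/eqP; field; rewrite gt_eqF.
Unshelve. all: by end_near. Qed.

(* The increments of a periodic function over a rational part of the period
   sum to zero, so they cannot keep a constant sign. *)
Lemma periodic_shift_fixed (h : R -> R) (T : R) (m : nat) : (0 < m)%N ->
  rcontinuous h -> (forall t, h (t + T) = h t) ->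
  exists t, h (t + T / m%:R) = h t.
Proof.
move=> m0 ch per; pose g t := h (t + T / m%:R) - h t.
have cg : rcontinuous g.
  move=> t; apply: cvgB; last exact: ch.
  apply: (@continuous_comp R R R (fun t => t + T / m%:R) h); last exact: ch.
  by apply: cvgD; [exact: cvg_id|exact: cvg_cst].
have mN0 : m%:R != 0 :> R by rewrite pnatr_eq0 -lt0n.
have sum0 : \sum_(0 <= j < m) g (j%:R * (T / m%:R)) = 0.
  rewrite (telescope_sumr_eq (fun j => h (j%:R * (T / m%:R)))) //.
    by rewrite mul0r -[m%:R * _]add0r mulrCA divff// mulr1 per subrr.
  by move=> j _; rewrite /g -addn1 natrD mulrDl mul1r.
have exj (sg : R) : sg != 0 -> exists t, 0 <= sg * g t.
  move=> sg0; apply: contrapT => nex.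
  have neg t : sg * g t < 0 by rewrite ltNge; apply/negP => ?; apply: nex; exists t.
  have := congr1 (fun x => sg * x) sum0; rewrite mulr0 mulr_sumr => /eqP; apply/negP.
  rewrite lt_eqF//; apply: (@lt_le_trans _ _ (\sum_(0 <= j < m) 0)).
    exact: ltr_sum_nat.
  by rewrite big1.
have [t0 h0] := exj 1 (oner_neq0 _); have n1 : -1 != 0 :> R by rewrite oppr_eq0 oner_eq0.
have [t1 h1] := exj (-1) n1.
rewrite mul1r in h0; rewrite mulN1r oppr_ge0 in h1.
have cgw a b : {within `[a, b], continuous g} by apply: continuous_in_subspaceT => t _; exact: cg.
have [t gt] : exists t, g t = 0.
  have [t01|/ltW t10] := leP t0 t1.
    have [|t _ gt] := @IVT _ g t0 t1 0 t01 (cgw _ _); last by exists t.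
    by rewrite ge_min le_max h0 h1 orbT.
  have [|t _ gt] := @IVT _ g t1 t0 0 t10 (cgw _ _); last by exists t.
  by rewrite ge_min le_max h0 h1 orbT.
by exists t; apply/eqP; rewrite -subr_eq0 -/(g t) gt.
Qed.

Lemma cis_neq1 (x : R) : 0 < x -> x < 2 * pi -> cis x != 1.
Proof.
move=> x0 x2; apply/eqP => /(congr1 (@complex.Re R)) /= c1.
have s0 : 0 < sin (x / 2) by apply: sin_gt0_pi; rewrite divr_gt0//= ltr_pdivrMr// mulrC.
have : cos x = 1 - 2 * sin (x / 2) ^+ 2.
  rewrite [X in cos X](splitr x) cosD -!expr2 -[X in _ = X - _](cos2Dsin2 (x / 2)); ring.
have : 0 < sin (x / 2) ^+ 2 by rewrite exprn_gt0.
lra.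
Qed.

Lemma cisX (x : R) n : cis x ^+ n = cis (n%:R * x).
Proof.
elim: n => [|n IH]; first by rewrite expr0 mul0r cis0.
by rewrite exprS IH -cisD -addn1 natrD mulrDl mul1r addrC.
Qed.

(* The branch near [1] of the equation [Y(u)^m = P(u Y(u))], so that [u Y(u)]
   inverts [u = z P(z)^(-1/m)] near [0]. *)
Lemma root_branch (P : {poly C}) (m : nat) (e : R) : (0 < m)%N -> P.[0] = 1 ->
  0 < e -> exists delta0 : R, 0 < delta0 /\ exists K : R, 0 <= K /\
   forall delta, 0 <= delta -> delta <= delta0 -> exists Y : C -> C,
    forall u, nc u <= delta ->
     [/\ nc (Y u - 1) <= e, Y u ^+ m = P.[u * Y u] &
         forall v, nc v <= delta -> nc (Y u - Y v) <= K * nc (u - v)].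
Proof.
move=> m0 P1 e0.
have [K K0 KP] := @poly_lipschitz P 2 ltac:(by []).
have mp : 0 < m%:R :> R by rewrite ltr0n.
have m1 : 1 <= m%:R :> R by rewrite ler1n.
have mC : m%:R != 0 :> C by rewrite pnatr_eq0 -lt0n.
have nm : nc (m%:R : C) = m%:R.
  by rewrite (_ : m%:R = (m%:R : R)%:C%C) ?normc_real ?ger0_norm ?ler0n// rmorph_nat.
pose e1 := Num.min e (2 ^+ (m + 2))^-1.
have q0 : 0 < 2 ^+ (m + 2) :> R by rewrite exprn_gt0.
have e10 : 0 < e1 by rewrite lt_min e0 invr_gt0.
have e1e : e1 <= e by rewrite ge_min lexx.
have e1q : 2 ^+ (m + 2) * e1 <= 1.
  by rewrite -ler_pdivlMl// mulr1 ge_min lexx orbT.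
have e11 : e1 <= 1.
  apply: le_trans e1q; rewrite ler_peMl ?(ltW e10)// exprn_ege1// ler1n //.
pose d0 := Num.min 1 (Num.min ((4 * (K + 1))^-1) (e1 / (2 * (K + 1)))).
have K1 : 0 < K + 1 by rewrite ltr_wpDl.
have d00 : 0 < d0 by rewrite !lt_min ltr01 invr_gt0 divr_gt0 ?mulr_gt0.
have d01 : d0 <= 1 by rewrite ge_min lexx.
have d02 : d0 * (4 * (K + 1)) <= 1.
  by rewrite -ler_pdivlMr ?mulr_gt0// mul1r !ge_min lexx orbT.
have d03 : d0 * (2 * (K + 1)) <= e1.
  by rewrite -ler_pdivlMr ?mulr_gt0// !ge_min lexx !orbT.
have norm2 y : nc (y - 1) <= e1 -> nc y <= 2.
  by move=> h; have := normc_triangle (y - 1) 1; rewrite subrK Normc.normc1; lra.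
have nuy u y : nc u <= d0 -> nc (y - 1) <= e1 -> nc (u * y) <= 2.
  move=> hu hy; rewrite normcM -[X in _ <= X]mul1r ler_pM ?normc_ge0 ?norm2//.
  exact: le_trans hu d01.
pose N u y := y - (y ^+ m - P.[u * y]) / m%:R.
have lipP u v y z : nc u <= d0 -> nc v <= d0 -> nc (y - 1) <= e1 -> nc (z - 1) <= e1 ->
    nc (P.[u * y] - P.[v * z]) <= K * nc (u * y - v * z).
  by move=> hu hv hy hz; have [] := KP (u * y) (v * z) (nuy _ _ hu hy) (nuy _ _ hv hz).
have contr u y z : nc u <= d0 -> nc (y - 1) <= e1 -> nc (z - 1) <= e1 ->
    nc (N u y - N u z) <= nc (y - z) / 2.
  move=> hu hy hz.
  set S := \sum_(i < m) (1 - y ^+ (m.-1 - i) * z ^+ i).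
  have E : N u y - N u z = ((y - z) * S + (P.[u * y] - P.[u * z])) / m%:R.
    have -> : (y - z) * S = m%:R * (y - z) - (y ^+ m - z ^+ m).
      rewrite /S subrXX sumrB big_const_ord iter_addr addr0 mulrBr mulrC.
      congr (_ * _ - _ * _); apply: eq_bigr => i _; by rewrite -subn1 -subnDA add1n.
    by rewrite /N; field.
  have hS : nc S <= m%:R / 4.
    apply: le_trans (normc_sum _ _ _) _.
    apply: (@le_trans _ _ (\sum_(i < m) 4^-1)); last first.
      by rewrite big_const_ord iter_addr addr0 -[X in X <= _]mulr_natl.
    apply: ler_sum => i _; rewrite normcB.
    apply: le_trans (near1_prod _ _ (ltW e10) e11 hy hz) _.
    have i1 : (2 : R) ^+ (m.-1 - i + i) <= 2 ^+ m.
      by rewrite ler_eXn2l ?ltr1n// subnK ?leq_pred// -ltnS prednK.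
    have i2 : (2 ^+ (m.-1 - i + i) - 1) * e1 <= 2 ^+ m * e1.
      by rewrite ler_pM2r//; lra.
    apply: (le_trans i2); move: e1q; rewrite exprD; lra.
  rewrite E normcM normcV nm ler_pdivrMr//.
  apply: le_trans (normc_triangle _ _) _; rewrite normcM.
  have h1 : nc (y - z) * nc S <= nc (y - z) * (m%:R / 4) by rewrite ler_wpM2l ?normc_ge0.
  have h2 : nc (P.[u * y] - P.[u * z]) <= nc (y - z) * 4^-1.
    apply: le_trans (lipP _ _ _ _ hu hu hy hz) _.
    rewrite -mulrBr normcM mulrA mulrC ler_wpM2l ?normc_ge0//.
    have : K * nc u <= K * d0 by rewrite ler_wpM2l.
    lra.
  have h3 : nc (y - z) * 4^-1 <= nc (y - z) * (m%:R / 4).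
    by rewrite ler_wpM2l ?normc_ge0//; lra.
  lra.
have stab u y : nc u <= d0 -> nc (y - 1) <= e1 -> nc (N u y - 1) <= e1.
  move=> hu hy; have h1 : nc (1 - 1 : C) <= e1 by rewrite subrr Normc.normc0 ltW.
  have N1 : nc (N u 1 - 1) <= e1 / 2.
    have -> : N u 1 - 1 = (P.[u * 1] - P.[0 * 1]) / m%:R.
      by rewrite /N expr1n mul0r P1; field.
    rewrite normcM normcV nm ler_pdivrMr//.
    have z0 : nc (0 : C) <= d0 by rewrite Normc.normc0 ltW.
    apply: le_trans (lipP u 0 1 1 hu z0 h1 h1) _; rewrite !mulr1 subr0.
    apply: (@le_trans _ _ (e1 / 2)); last by rewrite ler_peMr// ltW// divr_gt0.
    have : K * nc u <= K * d0 by rewrite ler_wpM2l.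
    by lra.
  have := contr u y 1 hu hy h1; have := normc_dist_triangle (N u y) (N u 1) 1; lra.
exists d0; split=> //; exists (4 * K); split; first by rewrite mulr_ge0.
move=> delta del0 dd.
have /choice[Y YP] : forall u, exists y, nc u <= delta -> nc (y - 1) <= e1 /\ N u y = y.
  move=> u; have [hu|hu] := leP (nc u) delta; last by exists 0.
  have hu' := le_trans hu dd.
  have [y y1 y2] := half_contraction_fixpoint (ltW e10) (fun y => stab u y hu')
    (fun y z => contr u y z hu').
  by exists y.
exists Y => u hu; have [y1 y2] := YP u hu; have hu' := le_trans hu dd; split.
- exact: le_trans y1 e1e.
- move/eqP: y2; rewrite /N subr_eq addrC -subr_eq subrr eq_sym => /eqP/(congr1 (fun x => x * m%:R)).
  by rewrite divfK// mul0r => /eqP; rewrite subr_eq0 => /eqP.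
move=> v hv; have [v1 v2] := YP v hv; have hv' := le_trans hv dd.
have c1 := contr u (Y u) (Y v) hu' y1 v1; rewrite y2 in c1.
have c2 : nc (N u (Y v) - N v (Y v)) <= 2 * K * nc (u - v).
  have -> : N u (Y v) - N v (Y v) = (P.[u * Y v] - P.[v * Y v]) / m%:R by rewrite /N; field.
  rewrite normcM normcV nm ler_pdivrMr//.
  apply: le_trans (lipP u v _ _ hu' hv' v1 v1) _; rewrite -mulrBl normcM.
  have n2 := norm2 _ v1.
  have k1 : K * (nc (u - v) * nc (Y v)) <= K * (nc (u - v) * 2).
    by rewrite ler_wpM2l// ler_wpM2l ?normc_ge0.
  have k2 : 2 * K * nc (u - v) <= 2 * K * nc (u - v) * m%:R.
    by rewrite ler_peMr// !mulr_ge0// normc_ge0.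
  lra.
rewrite v2 in c2; have := normc_dist_triangle (Y u) (N u (Y v)) (Y v); lra.
Qed.

Theorem equimodular_collision (P : {poly C}) (m : nat) (L : R) : (1 < m)%N -> P.[0] != 0 ->
  exists z w : C, [/\ z != w, z != 0, w != 0, nc z = nc w &
    P.[z] / z ^+ m = P.[w] / w ^+ m /\ L < nc (P.[z] / z ^+ m)].
Proof.
wlog : P L / P.[0] = 1.
  move=> W m1 P0; pose c := P.[0].
  have [||z [w [zw z0 w0 nzw [E H]]]] := W (c^-1 *: P) (L / nc c) _ m1.
  - by rewrite hornerZ mulVf.
  - by rewrite hornerZ mulVf ?oner_neq0.
  have c0 : c != 0 by [].
  exists z, w; split=> //; rewrite !hornerZ -!mulrA in E H.
  split; first by apply: (mulfI (_ : c^-1 != 0)) E; rewrite invr_eq0.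
  move: H; rewrite normcM normcV [X in _ < X]mulrC ltr_pM2r//.
  by rewrite invr_gt0 normc_gt0.
move=> P1 m1 _; have m0 := ltnW m1.
have mp : 0 < m%:R :> R by rewrite ltr0n.
pose zeta : C := cis (2 * pi / m%:R).
have pp := pi_gt0 R.
have z1 : zeta != 1.
  apply: cis_neq1; first by rewrite divr_gt0// mulr_gt0.
  by rewrite ltr_pdivrMr// ltr_pMr ?mulr_gt0// ltr1n.
have zm : zeta ^+ m = 1.
  by rewrite cisX mulrC divfK ?gt_eqF// -[2 * pi]add0r cis2pi cis0.
pose e := Num.min 2^-1 (nc (zeta - 1) / 8).
have zz : 0 < nc (zeta - 1) by rewrite normc_gt0 subr_eq0.
have e0 : 0 < e by rewrite lt_min invr_gt0 divr_gt0// ltr0n.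
have e1 : e <= 2^-1 by rewrite ge_min lexx.
have e2 : e <= nc (zeta - 1) / 8 by rewrite ge_min lexx orbT.
have [d0 [d00 [K [K0 HY]]]] := root_branch m0 P1 e0.
pose d := Num.min d0 (Num.min 1 (`|L| + 1)^-1).
have L1 : 0 < `|L| + 1 by rewrite ltr_wpDl.
have dp : 0 < d by rewrite !lt_min d00 ltr01 invr_gt0.
have dd0 : d <= d0 by rewrite ge_min lexx.
have d1 : d <= 1 by rewrite !ge_min lexx orbT.
have dL : d * (`|L| + 1) <= 1 by rewrite -ler_pdivlMr// mul1r !ge_min lexx !orbT.
have [Y YP] := HY d (ltW dp) dd0.
pose U (t : R) : C := d%:C%C * cis t.
have nU t : nc (U t) = d by rewrite normcM normc_real normc_cis mulr1 gtr0_norm.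
have Ud t : nc (U t) <= d by rewrite nU.
have hc : rcontinuous (fun t => nc (Y (U t))).
  apply: (continuous_lip_cis K0 (ltW dp)) => u v hu hv.
  by have [_ _] := YP u hu; exact.
have hper t : nc (Y (U (t + 2 * pi))) = nc (Y (U t)) by rewrite /U cis2pi.
have [t ht] := periodic_shift_fixed m0 hc hper.
pose u := U t; pose v := U (t + 2 * pi / m%:R).
have vE : v = zeta * u by rewrite /v /U cisD -/zeta /u /U; ring.
have [yu1 yu2 _] := YP u (Ud _); have [yv1 yv2 _] := YP v (Ud _).
have u0 : u != 0 by rewrite -normc_gt0 nU.
have v0 : v != 0 by rewrite -normc_gt0 nU.
have Yn y : nc (y - 1) <= e -> 2^-1 <= nc y.
  move=> h; have := normc_triangle (1 - y) y; rewrite subrK Normc.normc1.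
  by rewrite [nc (1 - y)]normcB; lra.
have Y0 y : nc (y - 1) <= e -> y != 0.
  by move=> /Yn h; rewrite -normc_gt0 (lt_le_trans _ h)// invr_gt0.
have Yu0 := Y0 _ yu1; have Yv0 := Y0 _ yv1.
have val x y : x != 0 -> y != 0 -> y ^+ m = P.[x * y] -> P.[x * y] / (x * y) ^+ m = x ^- m.
  move=> x0 y0 <-; rewrite exprMn invfM mulrC -mulrA mulVf ?mulr1// expf_neq0//.
exists (u * Y u), (v * Y v); split.
- apply/eqP => E.
  have {}E : Y u = zeta * Y v.
    by apply: (mulfI u0); apply: (etrans E); rewrite [X in X * _]vE mulrAC mulrC.
  have E2 : (zeta - 1) * Y v = (Y u - 1) - (Y v - 1) by rewrite E; ring.
  have := congr1 (@nc R) E2; rewrite normcM.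
  have := normc_triangleB (Y u - 1) (Y v - 1); have := Yn _ yv1.
  move=> h1 h2 h3; have : nc (zeta - 1) * 2^-1 <= nc (zeta - 1) * nc (Y v).
    by rewrite ler_pM2l.
  lra.
- by rewrite mulf_neq0.
- by rewrite mulf_neq0.
- rewrite [LHS]normcM [RHS]normcM (nU t : nc u = d) (nU _ : nc v = d).
  by congr (_ * _); exact: esym ht.
- have vm : v ^+ m = u ^+ m by rewrite vE (exprMn m zeta u) zm mul1r.
  rewrite (val u (Y u) u0 Yu0 yu2) (val v (Y v) v0 Yv0 yv2); split; first by rewrite vm.
  rewrite normcV normcX (nU t : nc u = d) (le_lt_trans (ler_norm L))//.
  apply: (@lt_le_trans _ _ (d^-1)).
    rewrite -[ltRHS]mul1r ltr_pdivlMr// mulrC.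
    by apply: lt_le_trans dL; rewrite ltr_pM2l// ltrDl.
  rewrite lef_pV2 ?posrE ?exprn_gt0//.
  by rewrite -{2}(expr1 d) ler_wiXn2l// ltW.
Qed.

End Contraction.

Section SymbolPolynomial.
Variable R : realType.
Local Notation C := R[i].
Implicit Types (z w lambda : C).
Variables (m n : nat) (alpha : int -> C).
Hypothesis m1 : (1 <= m)%N.
Local Notation Q := (symbol_poly m n alpha).

Lemma symbol_polyE lambda z : (Q lambda).[z] = (Q 0).[z] - lambda * z ^+ m.
Proof. by rewrite /symbol_poly scale0r subr0 hornerD hornerN hornerZ hornerXn. Qed.

Lemma symbol_poly0E z : (Q 0).[z] =
  1 + \sum_(1 <= i < (m + n).+1) alpha (i%:Z - m%:Z) * z ^+ i.
Proof.
rewrite /symbol_poly scale0r subr0 hornerD hornerC horner_sum; congr (_ + _).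
by apply: eq_bigr => i _; rewrite hornerZ hornerXn.
Qed.

Lemma conj_unit z : nc z = 1 -> z * z^* = 1.
Proof.
move=> z1; have := normc_sqr z; rewrite z1 expr1n.
case: z {z1} => x y /= h; apply: complex_eq; rewrite ?cReM ?cImM /=; last by ring.
by rewrite mulrN opprK -!expr2 -h.
Qed.

Lemma symbol_circle lambda z : nc z = 1 ->
  (Q lambda).[z] = z ^+ m * (symbol m n alpha z - lambda).
Proof.
move=> z1; rewrite symbol_polyE mulrBr [lambda * _]mulrC; congr (_ - _).
have zk k : z ^+ k * (z ^+ k)^* = 1 by rewrite rmorphXn -exprMn conj_unit// expr1n.
rewrite symbol_poly0E /symbol mulrDr.
rewrite (@big_cat_nat _ _ _ m) //=; last by rewrite leqW// leq_addr.
rewrite addrA; congr (_ + _).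
  rewrite /symbol_q hornerD hornerXn horner_sum rmorphD mulrDr/= zk; congr (_ + _).
  rewrite rmorph_sum mulr_sumr; apply: eq_big_nat => i /andP[_ im].
  rewrite hornerZ hornerXn rmorphM /= conjCK mulrCA; congr (_ * _).
    by congr alpha; rewrite -opprB subzn// ltnW.
  have -> : z ^+ m = z ^+ i * z ^+ (m - i) by rewrite -exprD subnKC// ltnW.
  by rewrite -mulrA zk mulr1.
rewrite /symbol_p horner_sum mulr_sumr -{1}[m]add0n big_addn.
rewrite (_ : (m + n).+1 - m = n.+1)%N; last by rewrite -addnS addKn.
apply: eq_bigr => i _; rewrite hornerZ hornerXn mulrCA -exprD addnC.
by rewrite PoszD [X in alpha X]addrAC subrr add0r.
Qed.

Lemma symbol_poly_at0 lambda : (Q lambda).[0] = 1.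
Proof.
rewrite symbol_polyE expr0n (gtn_eqF m1) mulr0 subr0 symbol_poly0E big1_seq ?addr0//.
by move=> i /andP[_]; rewrite mem_index_iota => /andP[i0 _]; rewrite expr0n gtn_eqF// mulr0.
Qed.

Lemma poincare_equimodular (p : {poly C}) z w : poincare p -> root p z -> root p w ->
  nc z = nc w -> z = w.
Proof.
move=> [p0 [s [pE us]]] rz rw zw.
have ins x : root p x -> x \in s.
  rewrite pE rootZ ?lead_coef_eq0// root_prod_XsubC//.
have := us; move: (ins z rz) (ins w rw) => zs ws.
have nE : [seq `|a| | a <- s] = map (fun a => (nc a)%:C%C) s by [].
move=> u; rewrite -(nth_index 0 zs) -(nth_index 0 ws); congr nth.
apply/eqP; rewrite -(nth_uniq 0 _ _ u) ?size_map ?index_mem//.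
by rewrite !(nth_map 0) ?index_mem// !nth_index// !normc_normE zw.
Qed.

Definition symbol_range := symbol m n alpha @` @unit_circle R.

Lemma symbol_range_bound : exists L : R, forall lambda, symbol_range lambda -> nc lambda <= L.
Proof.
have [K K0 KP] := @poly_lipschitz R (Q 0) 1 ler01.
exists K => _ [z /unit_circleP z1 <-].
have := (KP z z _ _).1; rewrite z1 lexx => /(_ isT isT).
by rewrite symbol_circle// subr0 normcM normcX z1 expr1n mul1r.
Qed.

Hypothesis hyp : forall lambda, ~ symbol_range lambda -> poincare (Q lambda).

Lemma poincare_m1 : m = 1%N.
Proof.
apply/eqP; rewrite eqn_leq m1 andbT leqNgt; apply/negP => m2.
have [L LP] := symbol_range_bound.
have Q0 : (Q 0).[0] != 0 by rewrite symbol_poly_at0 oner_neq0.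
have [z [w [zw z0 w0 nzw [E big]]]] := equimodular_collision L m2 Q0.
move/eqP: zw; apply; set lambda := _ / z ^+ m in E big.
have nr : ~ symbol_range lambda by move=> /LP; rewrite leNgt big.
apply: (poincare_equimodular (hyp nr)) nzw.
- by rewrite /root symbol_polyE /lambda divfK ?subrr// expf_neq0.
- by rewrite /root symbol_polyE E divfK ?subrr// expf_neq0.
Qed.

Hypothesis hn : alpha n%:Z != 0.

Lemma poincare_n1 : (n <= 1)%N.
Proof.
rewrite leqNgt; apply/negP => n2; have [L LP] := symbol_range_bound.
pose P : {poly C} := \sum_(i < (m + n).+1) (Q 0)`_i *: 'X^(m + n - i).
have szQ : (size (Q 0%R) <= (m + n).+1)%N.
  rewrite /symbol_poly scale0r subr0 (leq_trans (size_polyD _ _))// geq_max.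
  rewrite size_poly1 /=.
  apply: (leq_trans (size_sum _ _ _)); apply/bigmax_leqP_seq => i.
  rewrite mem_index_iota => /andP[_ ilt] _.
  by rewrite (leq_trans (size_scale_leq _ _))// size_polyXn.
have PE t : t != 0 -> P.[t] = t ^+ (m + n) * (Q 0).[t^-1].
  move=> t0; rewrite /P horner_sum (horner_coef_wide _ szQ) mulr_sumr.
  apply: eq_bigr => i _; rewrite hornerZ hornerXn mulrCA; congr (_ * _).
  have im : (i <= m + n)%N by rewrite -ltnS.
  have -> : t ^+ (m + n) = t ^+ (m + n - i) * t ^+ i by rewrite -exprD subnK.
  by rewrite -mulrA exprVn divff ?mulr1// expf_neq0.
have P0 : P.[0] != 0.
  rewrite /P horner_sum big_ord_recr /= big1 ?add0r => [|i _]; last first.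
    by rewrite hornerZ hornerXn expr0n subn_eq0 leqNgt ltn_ord mulr0.
  rewrite subnn hornerZ hornerXn expr0 mulr1.
  rewrite /symbol_poly scale0r subr0 coefD coef1 addn_eq0 gtn_eqF//= add0r coef_sum.
  rewrite (big_cat_nat (n := m + n))//=; last by rewrite addn_gt0 m1.
  rewrite big_nat1 coefZ coefXn eqxx mulr1 big1_seq ?add0r.
    by rewrite PoszD addrAC subrr add0r.
  move=> i /andP[_]; rewrite mem_index_iota => /andP[_ ilt].
  by rewrite coefZ coefXn gtn_eqF// mulr0.
have [z [w [zw z0 w0 nzw [E big]]]] := equimodular_collision L n2 P0.
have conv t : t != 0 -> (Q 0).[t^-1] = P.[t] / t ^+ n * t^-1 ^+ m.
  move=> t0; rewrite PE// exprD exprVn; field; rewrite !expf_neq0//.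
set lambda := P.[z] / z ^+ n in E big.
have nr : ~ symbol_range lambda by move=> /LP; rewrite leNgt big.
have : z^-1 = w^-1.
  apply: (poincare_equimodular (hyp nr)); last by rewrite !normcV nzw.
  - by rewrite /root symbol_polyE conv// subrr.
  - by rewrite /root symbol_polyE conv// -E subrr.
by move=> /invr_inj; apply/eqP.
Qed.

End SymbolPolynomial.

(** * The spectrum *)

Section Assembly.
Variable R : realType.
Local Notation C := R[i].
Implicit Types (z w lambda a b u : C).
Local Notation dot := (@bergman_dot R).

Lemma symbol10 (alpha : int -> C) : symbol 1 0 alpha = lin_symbol (alpha 0) 0.
Proof.
apply/funext => z; rewrite /symbol /symbol_q /symbol_p /lin_symbol big_geq//.
by rewrite big_nat1 addr0 hornerXn expr1 hornerZ hornerXn expr0 mulr1 mul0r addr0.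
Qed.

Lemma symbol11 (alpha : int -> C) : symbol 1 1 alpha = lin_symbol (alpha 0) (alpha 1).
Proof.
apply/funext => z; rewrite /symbol /symbol_q /symbol_p /lin_symbol big_geq//.
rewrite big_nat_recr//= big_nat1 addr0 hornerXn expr1 hornerD !hornerZ !hornerXn.
by rewrite expr0 mulr1 expr1 addrA.
Qed.

Lemma poincare_unimodular (alpha : int -> C) : alpha 1 != 0 ->
  (forall lambda, ~ symbol_range 1 1 alpha lambda -> poincare (symbol_poly 1 1 alpha lambda)) ->
  nc (alpha 1) = 1.
Proof.
move=> a1 hyp; pose z := sqrtC (- (alpha 1)^-1).
have z2 : alpha 1 * z ^+ 2 = -1 by rewrite sqrtCK mulrN divff.
have z0 : z != 0.
  apply/eqP => z0; move: z2; rewrite z0 expr0n mulr0 => /eqP.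
  by rewrite eq_sym oppr_eq0 oner_eq0.
have [[zeta /unit_circleP n1 zE]|nr] := pselect (symbol_range 1 1 alpha (alpha 0)).
  move: zE; rewrite symbol11 /lin_symbol addrAC => /eqP.
  rewrite -subr_eq0 addrK addr_eq0 => /eqP/(congr1 (@nc R)).
  by rewrite normc_conj normcN normcM n1 mulr1.
have E x : (symbol_poly 1 1 alpha (alpha 0)).[x] = 1 + alpha 1 * x ^+ 2.
  rewrite symbol_polyE symbol_poly0E big_nat_recr//= big_nat1 subrr expr1.
  have -> : 2%:Z - 1%:Z = 1%:Z :> int by [].
  by rewrite addrAC [RHS]addrC -!addrA; ring.
have : z = - z.
  apply: (poincare_equimodular (hyp _ nr)); last by rewrite normcN.
  - by rewrite /root E z2 subrr.
  - by rewrite /root E sqrrN z2 subrr.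
move=> /eqP; rewrite -addr_eq0 -mulr2n mulrn_eq0 /= => /eqP z00.
by rewrite z00 eqxx in z0.
Qed.

Definition ctc (F : R -> C) :=
  rcontinuous (fun t => complex.Re (F t)) /\ rcontinuous (fun t => complex.Im (F t)).

Lemma ctc_cst u : ctc (fun=> u).
Proof. by split=> t; exact: cvg_cst. Qed.
Lemma ctc_cis : ctc (fun t => cis t).
Proof. by split=> t; [exact: continuous_cos|exact: continuous_sin]. Qed.
Lemma eq_rcontinuous (f g : R -> R) : f =1 g -> rcontinuous g -> rcontinuous f.
Proof. by move=> /funext ->. Qed.
Lemma ctcD (F G : R -> C) : ctc F -> ctc G -> ctc (fun t => F t + G t).
Proof.
move=> [F1 F2] [G1 G2]; split.
  apply: eq_rcontinuous (fun t => cReD (F t) (G t)) _ => t.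
  by apply: cvgD; [exact: F1|exact: G1].
apply: eq_rcontinuous (fun t => cImD (F t) (G t)) _ => t.
by apply: cvgD; [exact: F2|exact: G2].
Qed.
Lemma ctcM (F G : R -> C) : ctc F -> ctc G -> ctc (fun t => F t * G t).
Proof.
move=> [F1 F2] [G1 G2]; split.
  apply: eq_rcontinuous (fun t => cReM (F t) (G t)) _ => t.
  by apply: cvgB; apply: cvgM; [exact: F1|exact: G1|exact: F2|exact: G2].
apply: eq_rcontinuous (fun t => cImM (F t) (G t)) _ => t.
by apply: cvgD; apply: cvgM; [exact: F1|exact: G2|exact: F2|exact: G1].
Qed.
Lemma ctc_conj (F : R -> C) : ctc F -> ctc (fun t => (F t)^*).
Proof.
move=> [F1 F2]; split; first exact: eq_rcontinuous (fun t => cRe_conj (F t)) F1.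
apply: eq_rcontinuous (fun t => cIm_conj (F t)) _ => t.
by apply: cvgN; exact: F2.
Qed.

Lemma polar z : z != 0 -> exists2 theta : R, 0 < nc z & z = (nc z)%:C%C * cis theta.
Proof.
move=> z0; have nz : 0 < nc z by rewrite normc_gt0.
have nzC : (nc z)%:C%C != 0 :> C by rewrite -normc_gt0 normc_real gtr0_norm.
have [|theta tE] := @cis_surj R (z / (nc z)%:C%C).
  by rewrite normcM normcV normc_real gtr0_norm// divff// gt_eqF.
by exists theta => //; rewrite -tE mulrC divfK.
Qed.

Lemma wind_half_plane a b lambda u : u != 0 ->
  (forall t : R, 0 < complex.Re (u * (lin_symbol a b (cis t) - lambda))) ->
  wind (fun t => lin_symbol a b (cis t)) lambda = 0.
Proof.
move=> u0 pos; have iu0 : u^-1 != 0 by rewrite invr_eq0.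
apply: wind_eq.
  move=> t; apply/eqP => E; have := pos t; rewrite E subrr mulr0 /= ltxx//.
have [theta n0 uE] := polar iu0.
have [c1 c2] : ctc (fun t => u * (lin_symbol a b (cis t) - lambda)).
  apply: ctcM; first exact: ctc_cst.
  apply: ctcD; last exact: ctc_cst.
  apply: ctcD.
    by apply: ctcD; [apply: ctc_conj; exact: ctc_cis|exact: ctc_cst].
  by apply: ctcM; [exact: ctc_cst|exact: ctc_cis].
apply: (is_wind_cis (theta := theta) n0 _ pos c1 c2) => [t|].
  have -> : 0%:~R * t + theta = theta by rewrite mulr0z mul0r add0r.
  by rewrite -uE mulKf.
by rewrite -[2 * pi]add0r cis2pi.
Qed.

Lemma wind_coanalytic a w : nc w < 1 ->
  wind (fun t => lin_symbol a 0 (cis t)) (a + w^*) = -1.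
Proof.
move=> w1; have E (t : R) : lin_symbol a 0 (cis t) - (a + w^*) = (cis t)^* - w^*.
  by rewrite /lin_symbol; ring.
have vc : ctc (fun t => 1 - w^* * cis t).
  rewrite (_ : (fun t => _) = (fun t => 1 + - w^* * cis t)).
    apply: ctcD; first exact: ctc_cst.
    by apply: ctcM; [exact: ctc_cst|exact: ctc_cis].
  by apply/funext => t; rewrite mulNr.
apply: wind_eq.
  move=> t; rewrite -subr_eq0 E -rmorphB conjC_eq0 subr_eq0; apply/eqP => e.
  by move: w1; rewrite -e normc_cis ltxx.
apply: (@is_wind_cis _ _ (fun t => 1 - w^* * cis t) _ 1 0).
- exact: ltr01.
- move=> t; rewrite E mul1r addr0 mulrN1z mulN1r cisN mulrBr mulr1 mulrCA.
  by rewrite [X in _ * X]mulrC conj_unit ?mulr1// normc_cis.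
- move=> t; rewrite cReB subr_gt0; apply: le_lt_trans (ler_norm _) _.
  apply: le_lt_trans (Re_le_normc _) _.
  by rewrite normcM normc_conj normc_cis mulr1.
- exact: vc.1.
- exact: vc.2.
- by rewrite -[2 * pi]add0r cis2pi.
Qed.

Lemma half_plane_case a b lambda u (delta : R) : 0 < delta ->
  (forall z, nc z <= 1 -> delta <= complex.Re (u * (lin_symbol a b z - lambda))) ->
  [/\ invertible_op dot (shift_op (toeplitz (lin_symbol a b)) lambda),
      fredholm_index dot (shift_op (toeplitz (lin_symbol a b)) lambda) = 0 &
      wind (fun t => lin_symbol a b (cis t)) lambda = 0].
Proof.
move=> d0 pos; have bs := lin_symbol_bounded a b.
have [inv surj] := @coercive_invertible _ _ _ lambda u delta bs d0
  ltac:(by move=> z; rewrite unit_diskE => /ltW /pos).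
split=> //; first exact: invertible_index0 bs inv surj.
apply: (@wind_half_plane _ _ _ u).
  apply/eqP => u0; have := pos 0; rewrite u0 mul0r Normc.normc0 ler01 => /(_ isT) /=.
  by rewrite leNgt d0.
by move=> t; apply: lt_le_trans d0 _; apply: pos; rewrite normc_cis.
Qed.

Definition spectral_alternative a b lambda : Prop :=
  let A := shift_op (toeplitz (lin_symbol a b)) lambda in
  let k := wind (fun t => lin_symbol a b (cis t)) lambda in
  [/\ invertible_op dot A, fredholm_index dot A = 0 & k = 0] \/
  [/\ ~ invertible_op dot A, fredholm dot A, fredholm_index dot A <> 0 & k <> 0].

Lemma alternative_disk a lambda : ~ (lin_symbol a 0 @` @unit_circle R) lambda ->
  spectral_alternative a 0 lambda.
Proof.
move=> nl; pose nu := lambda - a.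
have lE z : lin_symbol a 0 z - lambda = z^* - nu by rewrite /lin_symbol /nu; ring.
have [n1|n1|n1] := ltgtP (nc nu) 1.
- right; have Dw : unit_disk (nu^*) by rewrite unit_diskE normc_conj.
  have E : lambda = a + (nu^*)^* by rewrite conjCK /nu addrC subrK.
  have [h1 h2 h3] := coanalytic_shift_fredholm a Dw; rewrite E; split=> //.
  by rewrite wind_coanalytic// normc_conj.
- left; apply: (@half_plane_case _ _ _ (- nu^*) (nc nu ^+ 2 - nc nu)).
    by rewrite subr_gt0 expr2 ltr_pMr// (lt_trans ltr01).
  move=> z z1; rewrite lE.
  have -> : complex.Re (- nu^* * (z^* - nu)) = nc nu ^+ 2 - complex.Re (nu^* * z^*).
    rewrite normc_sqr; case: (nu) z {z1} => p q [x y].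
    by rewrite !cReM ?cReN ?cReB ?cImN ?cImB !cRe_conj !cIm_conj /=; ring.
  rewrite lerD2l lerN2; apply: le_trans (ler_norm _) _; apply: le_trans (Re_le_normc _) _.
  by rewrite normcM !normc_conj ler_piMr ?normc_ge0.
- exfalso; apply: nl; exists (nu^*); first by apply/unit_circleP; rewrite normc_conj.
  by rewrite /lin_symbol conjCK mul0r addr0 /nu subrK.
Qed.

Lemma Re_rotate (q r : R) z :
  complex.Re ('i%C * q%:C%C * (r%:C%C - z)) = q * complex.Im z.
Proof. by case: z => x y; rewrite !cReM !cImM cReB cImB /=; ring. Qed.

Lemma alternative_segment a b lambda : nc b = 1 ->
  ~ (lin_symbol a b @` @unit_circle R) lambda -> spectral_alternative a b lambda.
Proof.
move=> b1 nl; have [x bE] := cis_surj b1.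
pose c : C := cis (x / 2).
have c1 : nc c = 1 by exact: normc_cis.
have cc := conj_unit c1.
have c2 : b = c * c by rewrite /c -cisD -splitr.
pose nu := c^* * (lambda - a).
have lE z : lin_symbol a b z - lambda = c * ((2 * complex.Re (c * z))%:C%C - nu).
  have -> : (2 * complex.Re (c * z))%:C%C = c * z + (c * z)^*.
    case: (c * z) => p q; apply: complex_eq => /=; first by ring.
    by rewrite subrr.
  rewrite /lin_symbol /nu c2 rmorphM /= mulrBr mulrA cc mul1r mulrDr mulrA.
  by rewrite [c * (c^* * _)]mulrA cc mul1r; ring.
have cl u z : c^* * u * (lin_symbol a b z - lambda) =
    u * ((2 * complex.Re (c * z))%:C%C - nu).
  by rewrite lE mulrACA -[RHS]mul1r -cc; ring.
have rb z : nc z <= 1 -> -2 <= 2 * complex.Re (c * z) <= 2.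
  move=> z1; have : `|complex.Re (c * z)| <= 1.
    by apply: le_trans (Re_le_normc _) _; rewrite normcM c1 mul1r.
  by rewrite ler_norml => /andP[h1 h2]; apply/andP; split; lra.
have [q0|q0] := eqVneq (complex.Im nu) 0; last first.
  left; apply: (@half_plane_case _ _ _ (c^* * ('i%C * (complex.Im nu)%:C%C))
    (complex.Im nu ^+ 2)); first by rewrite exprn_even_gt0.
  by move=> z _; rewrite cl Re_rotate expr2.
have [p2|p2] := ltP 2 (complex.Re nu).
  left; apply: (@half_plane_case _ _ _ (c^* * (-1)) (complex.Re nu - 2)).
    by rewrite subr_gt0.
  move=> z /rb /andP[_ h]; rewrite cl mulN1r cReN cReB /=; lra.
have [p3|p3] := ltP (complex.Re nu) (-2).
  left; apply: (@half_plane_case _ _ _ (c^* * 1) (-2 - complex.Re nu)).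
    by rewrite subr_gt0.
  move=> z /rb /andP[h _]; rewrite cl mul1r cReB /=; lra.
exfalso; apply: nl; exists (c^* * cis (acos (complex.Re nu / 2))).
  by apply/unit_circleP; rewrite normcM normc_conj c1 normc_cis mulr1.
apply/eqP; rewrite -subr_eq0 lE mulf_eq0; apply/orP; right.
rewrite mulrA cc mul1r /= acosK ?in_itv/=; last by apply/andP; split; lra.
rewrite subr_eq0; apply/eqP; apply: complex_eq => /=; last by rewrite q0.
by rewrite mulrC divfK.
Qed.

Lemma spectrum_of_alternative a b :
  let phi := lin_symbol a b in
  let phiT := phi @` @unit_circle R in
  let T := toeplitz phi in
  (forall lambda, ~ phiT lambda -> spectral_alternative a b lambda) ->
  spectrum dot T =
    phiT `|` [set lambda | ~ ess_spectrum dot T lambda /\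
                fredholm_index dot (shift_op T lambda) <> 0] /\
  phiT `|` [set lambda | ~ ess_spectrum dot T lambda /\
                fredholm_index dot (shift_op T lambda) <> 0] =
    phiT `|` [set lambda | ~ phiT lambda /\
                wind (fun t => phi (cis t)) lambda <> 0].
Proof.
move=> phi phiT T alt.
have onT lambda : phiT lambda -> spectrum dot T lambda.
  by move=> [z /unit_circleP z1 <-]; exact: lin_symbol_spectrum_circle.
split; apply/seteqP; split=> lambda.
- have [pl _|nl] := pselect (phiT lambda); first by left.
  by case: (alt lambda nl) => [[inv _ _] /(_ inv)//|[_ h1 h2 _] _]; right; split=> // /(_ h1).
- case=> [/onT//|[_ h]] inv; have [pl|nl] := pselect (phiT lambda).
    exact: onT pl inv.
  by case: (alt lambda nl) => [[_ h0 _]|[ninv _ _ _]]; [exact: h|exact: ninv].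
- case=> [pl|[h1 h2]]; first by left.
  have [pl|nl] := pselect (phiT lambda); first by left.
  by right; split=> //; case: (alt lambda nl) => [[_ h0 _]|[_ _ _ h3]//].
- case=> [pl|[nl h]]; first by left.
  by right; case: (alt lambda nl) => [[_ _ h0]|[_ h1 h2 _]]; [exfalso|split=> // /(_ h1)].
Qed.

End Assembly.

Theorem theorem4p5 (R : realType) (m n : nat) (alpha : int -> R[i])
    (hm : (1 <= m)%N) (hn : alpha n%:Z != 0) :
  let phi := symbol m n alpha in
  let phiT := phi @` @unit_circle R in
  let T := toeplitz phi in
  let dot := @bergman_dot R in
  (forall lambda, ~ phiT lambda -> poincare (symbol_poly m n alpha lambda)) ->
  spectrum dot T =
    phiT `|` [set lambda | ~ ess_spectrum dot T lambda /\
                fredholm_index dot (shift_op T lambda) <> 0] /\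
  phiT `|` [set lambda | ~ ess_spectrum dot T lambda /\
                fredholm_index dot (shift_op T lambda) <> 0] =
    phiT `|` [set lambda | ~ phiT lambda /\
                wind (fun t => phi (cis t)) lambda <> 0].
Proof.
move=> phi phiT T dot hyp; rewrite {}/phiT {}/T {}/dot {}/phi in hyp *.
have m1 := poincare_m1 hm hyp; have n1 := poincare_n1 hm hyp hn; subst m.
case: n n1 hn hyp => [|[|//]] _ hn hyp.
  rewrite symbol10; apply: spectrum_of_alternative => lambda.
  exact: alternative_disk.
have b1 := poincare_unimodular hn hyp.
rewrite symbol11; apply: spectrum_of_alternative => lambda.
exact: alternative_segment.
Qed.
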